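(* Let $(\mathcal{M},\|\cdot\|)$ be a $d$-dimensional metric space admitting locality-sensitive hashing with exponent function $\rho(\cdot)$ (see context), $c>1$, $r>0$. Let $\bar{k}=\arg\min_{k\in\mathbb{Z}_{\ge1}}\max\{\rho(c^{1/k}),1/k\}$ and $\beta=\max\{\rho(c^{1/\bar{k}}),1/\bar{k}\}$. There exists an algorithm for solving the relaxed fair $(c,r)$-ANN problem on $n$-point datasets that uses $\widetilde{O}(d\,n^{\beta})$ time per query and $\widetilde{O}(n^{1+\rho(c^{1/\bar{k}})})$ space for pre-processing.
   Context: For a dataset $S\subseteq\mathcal{M}$ of $n$ points, $B_S(q,r):=\{p\in S:\|p-q\|\le r\}$. Relaxed fair $(c,r)$-ANN: given a query $q$, if $B_S(q,r)\neq\emptyset$ the algorithm must output a point chosen uniformly at random, independently of past queries, from $B_S(q,r')$, where $r'\in[r,cr]$ is a random variable depending on $q$ and $S$; if $B_S(q,r)=\emptyset$ it may either answer $\perp$ or output a uniformly random point from $B_S(q,r')$ for some $r'\in(r,cr]$. For every approximation factor $c'>1$ the space admits a monotone $(c',r,p_1,p_2)$-LSH family ($\|x-y\|\le r\Rightarrow\Pr_h[h(x)=h(y)]\ge p_1$, $\|x-y\|\ge c'r\Rightarrow\Pr_h[h(x)=h(y)]\le p_2$), computable in $O(d)$ time, with $\rho(c')=\log(1/p_1)/\log(1/p_2)\in(0,1)$. $\widetilde{O}$ hides polylogarithmic factors.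
   Formalization: Zero error is impossible from LSH alone: for any a, with probability ≥ 1−m·n^{-a} over pre-processing, m queries fixed in advance are answered fairly, ⊥ having probability ≤ n^{-a} when B_S(q,r)≠∅. LSH is assumed at every radius; distances and hashing cost d; a hash function takes one cell. *)

(* Defs.v *)
From HB Require Import structures.
From mathcomp Require Import all_boot all_order all_algebra.
From mathcomp Require Import all_classical all_reals all_analysis.

Set Implicit Arguments.
Unset Strict Implicit.
Unset Printing Implicit Defensive.

Import Order.TTheory GRing.Theory Num.Def Num.Theory.
Import numFieldNormedType.Exports.

Local Open Scope classical_set_scope.
Local Open Scope ring_scope.

(** * Locality-sensitive hashing *)

(* A distribution over hash functions; hash values are coded as reals. *)
Record hash_family (R : realType) (M : Type) := HashFamily {
  hf_disp : measure_display ;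
  hf_seed : measurableType hf_disp ;
  hf_law : probability hf_seed R ;
  hf_eval : hf_seed -> M -> R
}.

Definition collision (R : realType) (M : Type) (F : hash_family R M) (x y : M)
    : \bar R :=
  hf_law F [set w | hf_eval w x = hf_eval w y].

Definition is_LSH (R : realType) (M : metricType R) (F : hash_family R M)
    (c' s p1 p2 : R) : Prop :=
  [/\ forall x, measurable_fun setT (fun w : hf_seed F => hf_eval w x),
      forall x y : M, mdist x y <= s -> (p1%:E <= collision F x y)%E
    & forall x y : M, c' * s <= mdist x y -> (collision F x y <= p2%:E)%E].

(* The collision probability does not increase with the distance. *)
Definition monotone_LSH (R : realType) (M : metricType R) (F : hash_family R M)
    : Prop :=
  forall x y x' y' : M, mdist x y <= mdist x' y' ->
    (collision F x' y' <= collision F x y)%E.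

(** * A randomized random access machine *)

(* Words are naturals below a modulus [W] (a power of n in the theorem, that
   is, words of O(log n) bits). Real registers hold distances, hash values and
   real constants; there is no rounding of a real to a word, and no memory of
   reals. Memory consists of cells holding a word and of cells holding a hash
   function. A program is a fixed finite text, independent of n. *)

Inductive wop := Add | Sub | Mul | Div | Mod.
Inductive rop := RAdd | RSub | RMul | RDiv.

Inductive wexp :=
  | WLit of nat
  | WReg of nat
  | WGet of wexp
  | WBin of wop & wexp & wexp.

Inductive pointref := Data of wexp | Query.

Inductive rexp (R : Type) :=
  | RLit of R
  | RReg of nat
  | ROfW of wexp
  | RBin of rop & rexp R & rexp R
  | Dist of pointref & pointref
  | Hash of wexp & pointref.

Inductive bexp (R : Type) :=
  | WLt of wexp & wexp
  | RLe of rexp R & rexp R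
  | BNot of bexp R
  | BAnd of bexp R & bexp R.

Inductive cmd (R : Type) :=
  | Skip
  | SetW of nat & wexp
  | SetR of nat & rexp R
  | Put of wexp & wexp
  (* [DrawHash a c' s]: put in hash cell [a] a fresh sample of the family for
     approximation factor [c'] and radius [s] *)
  | DrawHash of wexp & R & R
  (* [Rand i e]: a uniform element of {0, ..., e - 1} *)
  | Rand of nat & wexp
  | Seq of cmd R & cmd R
  | If of bexp R & cmd R & cmd R
  | While of bexp R & cmd R.

Arguments Skip {R}.

Record memory (R M : Type) := Memory {
  words : nat -> nat ;
  hashes : nat -> M -> R
}.

(* [wtop], [htop]: one plus the largest address written so far. *)
Record state (R M : Type) := State {
  wreg : nat -> nat ;
  rreg : nat -> R ;
  st_mem : memory R M ;
  st_time : nat ;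
  wtop : nat ;
  htop : nat
}.

Definition used_space (R M : Type) (s : state R M) : nat := (wtop s + htop s)%N.

Definition upd (T : Type) (f : nat -> T) (i : nat) (v : T) : nat -> T :=
  fun j => if j == i then v else f j.

Section machine.
Context {R : realType} {M : metricType R}.
Variables (d : nat) (lsh : R -> R -> hash_family R M).
Variables (n : nat) (S : 'I_n -> M) (W : nat).
(* The query point; [None] during preprocessing. *)
Variable q : option M.

Local Notation state := (state R M).

Definition tick (t : nat) (s : state) : state :=
  State (wreg s) (rreg s) (st_mem s) (st_time s + t)%N (wtop s) (htop s).
Definition set_wreg (i v : nat) (s : state) : state :=
  State (upd (wreg s) i v) (rreg s) (st_mem s) (st_time s) (wtop s) (htop s).
Definition set_rreg (i : nat) (x : R) (s : state) : state :=
  State (wreg s) (upd (rreg s) i x) (st_mem s) (st_time s) (wtop s) (htop s).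
Definition set_word (a v : nat) (s : state) : state :=
  State (wreg s) (rreg s) (Memory (upd (words (st_mem s)) a v) (hashes (st_mem s)))
    (st_time s) (maxn (wtop s) a.+1) (htop s).
Definition set_hash (a : nat) (h : M -> R) (s : state) : state :=
  State (wreg s) (rreg s) (Memory (words (st_mem s)) (upd (hashes (st_mem s)) a h))
    (st_time s) (wtop s) (maxn (htop s) a.+1).

Definition wop_eval (o : wop) (u v : nat) : nat :=
  match o with
  | Add => (u + v)%N | Sub => (u - v)%N | Mul => (u * v)%N
  | Div => (u %/ v)%N | Mod => (u %% v)%N
  end.

Definition rop_eval (o : rop) (x y : R) : R :=
  match o with
  | RAdd => x + y | RSub => x - y | RMul => x * y | RDiv => x / y
  end.

Fixpoint weval (s : state) (e : wexp) : nat :=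
  match e with
  | WLit v => (v %% W)%N
  | WReg i => wreg s i
  | WGet e => words (st_mem s) (weval s e)
  | WBin o e1 e2 => (wop_eval o (weval s e1) (weval s e2) %% W)%N
  end.

Definition peval (s : state) (p : pointref) : option M :=
  match p with
  | Data e => omap S (insub (weval s e))
  | Query => q
  end.

Fixpoint reval (s : state) (e : rexp R) : R :=
  match e with
  | RLit x => x
  | RReg i => rreg s i
  | ROfW e => (weval s e)%:R
  | RBin o e1 e2 => rop_eval o (reval s e1) (reval s e2)
  | Dist p1 p2 =>
      match peval s p1, peval s p2 with
      | Some x, Some y => mdist x y
      | _, _ => 0
      end
  | Hash a p => if peval s p is Some x then hashes (st_mem s) (weval s a) x else 0
  end.

Fixpoint beval (s : state) (b : bexp R) : bool :=
  match b with
  | WLt e1 e2 => (weval s e1 < weval s e2)%N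
  | RLe e1 e2 => reval s e1 <= reval s e2
  | BNot b => ~~ beval s b
  | BAnd b1 b2 => beval s b1 && beval s b2
  end.

(* Every operation costs 1, except that distance computations and the sampling
   and evaluation of hash functions cost [d]. *)
Fixpoint wcost (e : wexp) : nat :=
  match e with
  | WLit _ | WReg _ => 1%N
  | WGet e => (wcost e).+1
  | WBin _ e1 e2 => (wcost e1 + wcost e2).+1%N
  end.

Definition pcost (p : pointref) : nat := if p is Data e then wcost e else 1%N.

Fixpoint rcost (e : rexp R) : nat :=
  match e with
  | RLit _ | RReg _ => 1%N
  | ROfW e => (wcost e).+1
  | RBin _ e1 e2 => (rcost e1 + rcost e2).+1%N
  | Dist p1 p2 => (d + pcost p1 + pcost p2)%N
  | Hash a p => (d + wcost a + pcost p)%N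
  end.

Fixpoint bcost (b : bexp R) : nat :=
  match b with
  | WLt e1 e2 => (wcost e1 + wcost e2).+1%N
  | RLe e1 e2 => (rcost e1 + rcost e2).+1%N
  | BNot b => (bcost b).+1
  | BAnd b1 b2 => (bcost b1 + bcost b2).+1%N
  end.

(* [exec fuel c k s] is the expectation of [k] over the final state of [c]
   started in [s]; runs that need more than [fuel] count for 0. The integral of
   a nonnegative non-measurable function is its lower integral, so that a lower
   bound on an [exec] of an indicator is meaningful for every event. *)
Fixpoint exec (fuel : nat) (c : cmd R) (k : state -> \bar R) (s : state)
    {struct fuel} : \bar R :=
  if fuel is fuel'.+1 then
    match c with
    | Skip => k (tick 1%N s)
    | SetW i e => k (tick (wcost e).+1 (set_wreg i (weval s e) s))
    | SetR i e => k (tick (rcost e).+1 (set_rreg i (reval s e) s))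
    | Put a e =>
        k (tick (wcost a + wcost e).+1%N (set_word (weval s a) (weval s e) s))
    | DrawHash a c' r =>
        (\int[hf_law (lsh c' r)]_w
           k (tick (d + wcost a).+1%N
                (set_hash (weval s a) (hf_eval w) s)))%E
    | Rand i e =>
        let m := weval s e in
        let s' := tick (wcost e).+1 s in
        if m == 0%N then k (set_wreg i 0%N s')
        else ((m%:R^-1)%:E * \sum_(v < m) k (set_wreg i v s'))%E
    | Seq c1 c2 => exec fuel' c1 (exec fuel' c2 k) s
    | If b c1 c2 => exec fuel' (if beval s b then c1 else c2) k
                      (tick (bcost b).+1 s)
    | While b c1 =>
        let s' := tick (bcost b).+1 s in
        if beval s b then exec fuel' c1 (exec fuel' (While b c1) k) s'
        else k s'
    end
  else 0%E.

(* [k] is nonnegative in all uses, so [exec] increases with the fuel; diverging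
   runs contribute 0. *)
Definition run (c : cmd R) (k : state -> \bar R) (s : state) : \bar R :=
  ereal_sup (range (fun fuel => exec fuel c k s)).

(* Register 0 holds n initially, all other registers 0. *)
Definition boot (m : memory R M) : state :=
  State (upd (fun=> 0%N) 0%N n) (fun=> 0) m 0%N 0%N 0%N.

End machine.

Definition zero_memory (R : realType) (M : metricType R) : memory R M :=
  Memory (fun=> 0%N) (fun _ _ => 0).

(** * Relaxed fair near neighbors *)

Definition near_set (R : realType) (M : metricType R) (n : nat) (S : 'I_n -> M)
    (q : M) (x : R) : {set 'I_n} :=
  [set i | mdist (S i) q <= x]%SET.

(* The word i + 1 denotes the answer [S i], and 0 denotes the answer bottom.
   [law] is the law of the answer: it must be obtained by drawing a radius, equal to
   [rad j] with probability [wt j], and then a uniform point of the ball of that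
   radius, the remaining mass being on bottom. As S is finite there are finitely
   many balls around q, so finitely many radii suffice. If the ball of radius r
   is not empty, bottom is a failure, of probability at most [delta]. *)
Definition relaxed_fair (R : realType) (M : metricType R) (n : nat)
    (S : 'I_n -> M) (c r : R) (delta : R) (q : M) (law : nat -> \bar R) : Prop :=
  exists (m : nat) (rad wt : 'I_m -> R),
    [/\ forall j,
          [/\ (if near_set S q r != finset.set0 then r <= rad j else r < rad j),
              rad j <= c * r, near_set S q (rad j) != finset.set0 & 0 <= wt j],
        forall i : 'I_n, law i.+1 =
          (\sum_(j | i \in near_set S q (rad j))
              wt j / #|near_set S q (rad j)|%:R)%:E,
        law 0%N = (1 - \sum_j wt j)%:E,
        forall o, (n < o)%N -> law o = 0%E
      & near_set S q r != finset.set0 -> (law 0%N <= delta%:E)%E].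

Section data_structure.
Context {R : realType} {M : metricType R}.
Variables (d : nat) (lsh : R -> R -> hash_family R M).
Variables (n : nat) (S : 'I_n -> M) (W : nat).
Variables pre query : cmd R.

Definition preprocess (k : state R M -> \bar R) : \bar R :=
  run d lsh S W None pre k (boot n (zero_memory M)).

Definition ask (m : memory R M) (q : M) (k : state R M -> \bar R) : \bar R :=
  run d lsh S W (Some q) query k (boot n m).

(* Expectation of [k] over the (answer, running time) pairs of successive
   queries, each one starting from the memory left by the previous one. *)
Fixpoint session (m : memory R M) (qs : seq M) (k : seq (nat * nat) -> \bar R)
    : \bar R :=
  if qs is q :: qs' then
    ask m q (fun s => session (st_mem s) qs'
                        (fun l => k ((wreg s 0%N, st_time s) :: l)))
  else k [::].

Definition answer_law (m : memory R M) (q : M) (o : nat) : \bar R :=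
  ask m q (fun s => (wreg s 0%N == o)%:R%:E).

(* Each query is answered fairly, and independently of the other ones. *)
Definition fair_session (c r delta : R) (qs : seq M) (m : memory R M) : Prop :=
  {in qs, forall q, relaxed_fair S c r delta q (answer_law m q)} /\
  forall os : seq nat, size os = size qs ->
    session m qs (fun l => (unzip1 l == os)%:R%:E) =
    (\prod_(x <- zip qs os) answer_law m x.1 x.2)%E.

End data_structure.

Definition level_exponent (R : realType) (rho : R -> R) (c : R) (k : nat) : R :=
  Num.max (rho (c `^ k%:R^-1)) k%:R^-1.

(* Main.v *)
Require Import Defs.
From HB Require Import structures.
From mathcomp Require Import all_boot all_order all_algebra.
From mathcomp Require Import all_classical all_reals all_analysis.
From mathcomp Require Import fingroup perm measurable_realfun zify lra ring.

Set Implicit Arguments.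
Unset Strict Implicit.
Unset Printing Implicit Defensive.

Import Order.TTheory GRing.Theory Num.Def Num.Theory.
Import numFieldNormedType.Exports.

Local Open Scope classical_set_scope.
Local Open Scope ring_scope.

(** The balls around the query are refined into levels of radii r c^(i/k), i < k.
    At each level there are O(log n) independent copies of L = O~(n^rho) hash
    tables, a table being the points sorted by a random polynomial combination of
    K = O(log n) hash values of the family for the factor c^(1/k).
    In one copy, a random element of the union (with multiplicity) of the buckets
    of the query, a point p in table j say, is accepted if p is near and p collides
    with the query in none of the U tables preceding j cyclically, U being uniform
    below L. The gaps between the tables where p collides add up to L, so p is
    returned with probability 1 / T, T being the total size of the buckets,
    whatever p is: an accepted point is uniform in the ball as soon as every near
    point collides somewhere. The number of scanning steps is charged to a budget
    tested only between trials, so that running out of budget introduces no bias.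
    As n <= N^k with N = O(n^(1/k)), some level satisfies |B_(i+1)| <= N |B_i|; there
    T is O~(|B_i| (L + N)) in some copy, and the budget O~(L + N) suffices. The
    randomness of the preprocessing enters through pessimistic estimators, whose
    bounds are established one sample at a time. *)

(** The obstacle is that fairness must hold for a structure sampled once and reused, while good
    memories need not form a measurable set. Hence uniformity and independence rest only on
    randomness drawn at query time: on a fixed memory in which every near point collides in each
    copy, an answer follows an exact mixture of uniform laws on balls, and a query erases its
    scratch cells, so the next one meets the same memory. Preprocessing only has to reach such a
    memory, up to a failure probability delta per query point. A second obstacle is the points
    between two consecutive radii, whose collision probability an LSH family leaves free.
    Monotonicity supplies a threshold P >= p1 separating near points from all others; the number of
    tables is tuned to P, leaving about A expected collisions per intermediate point and copy. Hash
    values are reals that memory cannot hold, so tables are compared through fingerprints recomputed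
    on demand; coefficients below n L K keep false collisions at 1 / (n L) per point and table. The
    number A of copies is a multiple of K, which makes the failure probabilities polynomially
    small. *)

Section semantics.
Context {R : realType} {M : metricType R}.
Variables (d : nat) (lsh : R -> R -> hash_family R M).
Variables (n : nat) (S : 'I_n -> M) (W : nat) (q : option M).

Local Notation state := (state R M).
Local Notation exec := (exec d lsh S W q).
Local Notation beval := (beval S W q).
Local Notation bcost := (@bcost R d).

(** No measurability is required: the integral of a nonnegative function is a supremum over the
    simple functions below it, so it is monotone as it stands. Continuations of [exec] are
    integrated without being known to be measurable. *)
Lemma ge0_le_lower_integral (dsp : measure_display) (T : measurableType dsp)
    (mu : {measure set T -> \bar R}) (f g : T -> \bar R) :
  (forall x, 0 <= f x)%E -> (forall x, f x <= g x)%E ->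
  (\int[mu]_x f x <= \int[mu]_x g x)%E.
Proof.
move=> f0 fg; have g0 x : (0 <= g x)%E by apply: le_trans (f0 x) (fg x).
rewrite !ge0_integralTE//; apply: ereal_sup_le => _ [h hf <-].
by exists h => // x; apply: le_trans (hf x) (fg x).
Qed.

Lemma exec_ge0 fuel c (k : state -> \bar R) s :
  (forall s, 0 <= k s)%E -> (0 <= exec fuel c k s)%E.
Proof.
elim: fuel c k s => [|f IH] c k s k0; first by rewrite /= lexx.
case: c => [|i e|i e|a e|a c' r|i e|c1 c2|b c1 c2|b c1] //=.
- by apply: integral_ge0 => w _; exact: k0.
- case: ifP => // _; apply: mule_ge0; first by rewrite lee_fin invr_ge0.
  by apply: sume_ge0 => v _; exact: k0.
- by apply: (IH) => s'; exact: IH.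
- exact: IH.
- by case: ifP => // _; apply: (IH) => s'; exact: IH.
Qed.

Lemma exec_mono fuel c (k k' : state -> \bar R) s :
  (forall s, 0 <= k s)%E -> (forall s, k s <= k' s)%E ->
  (exec fuel c k s <= exec fuel c k' s)%E.
Proof.
elim: fuel c k k' s => [|f IH] c k k' s k0 kk'; first by rewrite /= lexx.
case: c => [|i e|i e|a e|a c' r|i e|c1 c2|b c1 c2|b c1] //=.
- exact: ge0_le_lower_integral.
- case: ifP => // _; apply: lee_wpmul2l; first by rewrite lee_fin invr_ge0.
  by apply: lee_sum => v _; exact: kk'.
- apply: (IH) => [s'|s']; [exact: exec_ge0|exact: IH].
- exact: IH.
- by case: ifP => // _; apply: (IH) => [s'|s']; [exact: exec_ge0|exact: IH].
Qed.

Lemma exec_fuelS fuel c (k : state -> \bar R) s :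
  (forall s, 0 <= k s)%E -> (exec fuel c k s <= exec fuel.+1 c k s)%E.
Proof.
elim: fuel c k s => [|f IH] c k s k0; first exact: exec_ge0.
case: c => [|i e|i e|a e|a c' r|i e|c1 c2|b c1 c2|b c1] //.
- change (exec f c1 (exec f c2 k) s <= exec f.+1 c1 (exec f.+1 c2 k) s)%E.
  apply: (le_trans (IH _ _ _ _)); first by move=> s'; exact: exec_ge0.
  by apply: exec_mono => s'; [exact: exec_ge0|exact: IH].
- exact: (IH (if beval s b then c1 else c2)).
- rewrite [leLHS]/= [leRHS]/=; case: ifP => // _.
  apply: (le_trans (IH _ _ _ _)); first by move=> s'; exact: exec_ge0.
  by apply: exec_mono => s'; [exact: exec_ge0|exact: IH].
Qed.

Lemma exec_fuel_mono f f' c (k : state -> \bar R) s :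
  (f <= f')%N -> (forall s, 0 <= k s)%E -> (exec f c k s <= exec f' c k s)%E.
Proof.
move=> /subnK <- k0; elim: (f' - f)%N => // m IH.
by rewrite addSn; apply: (le_trans IH); exact: exec_fuelS.
Qed.

Lemma exec_le1 fuel c (k : state -> \bar R) s :
  (forall s, 0 <= k s <= 1)%E -> (exec fuel c k s <= 1)%E.
Proof.
elim: fuel c k s => [|f IH] c k s k01; first by rewrite /= lee_fin.
have k0 s' : (0 <= k s')%E by case/andP: (k01 s').
have k1 s' : (k s' <= 1)%E by case/andP: (k01 s').
case: c => [|i e|i e|a e|a c' r|i e|c1 c2|b c1 c2|b c1] //=.
- apply: (@le_trans _ _ (\int[hf_law (lsh c' r)]_w (cst 1) w)%E).
    exact: ge0_le_lower_integral.
  rewrite integral_cst// mul1e; by rewrite -[X in (X <= _)%E]/(hf_law (lsh c' r) setT) probability_setT.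
- case: eqP => // m0.
  rewrite muleC lee_pdivrMr ?ltr0n ?lt0n; last exact/eqP.
  rewrite mul1e; apply: (@le_trans _ _ (\sum_(v < weval W s e) 1)%E).
    by apply: lee_sum => v _; exact: k1.
  by rewrite sumEFin sumr_const card_ord.
- by apply: (IH) => s'; rewrite exec_ge0//=; exact: IH.
- exact: IH.
- by case: ifP => // _; apply: (IH) => s'; rewrite exec_ge0//=; exact: IH.
Qed.

Lemma run_ge fuel c (k : state -> \bar R) s :
  (exec fuel c k s <= run d lsh S W q c k s)%E.
Proof. by apply: ereal_sup_ubound; exists fuel. Qed.

Lemma run_le1 c (k : state -> \bar R) s :
  (forall s, 0 <= k s <= 1)%E -> (run d lsh S W q c k s <= 1)%E.
Proof. by move=> k01; apply: ge_ereal_sup => _ [f _ <-]; exact: exec_le1. Qed.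

Lemma run_ge0 c (k : state -> \bar R) s :
  (forall s, 0 <= k s)%E -> (0 <= run d lsh S W q c k s)%E.
Proof. by move=> k0; apply: le_trans (run_ge 0 c k s); exact: exec_ge0. Qed.

(** The supremum over fuels is attained when the expectation is eventually constant; this is how an
    exact law is read off [run]. *)
Lemma run_eventually N c (k : state -> \bar R) s v : (forall s, 0 <= k s)%E ->
  (forall fuel, (N <= fuel)%N -> exec fuel c k s = v) ->
  run d lsh S W q c k s = v.
Proof.
move=> k0 h; apply/eqP; rewrite eq_le; apply/andP; split; last first.
  by rewrite -(h N)//; exact: run_ge.
apply: ge_ereal_sup => _ [f _ <-]; rewrite -(h (maxn N f)) ?leq_maxl//.
by apply: exec_fuel_mono => //; exact: leq_maxr.
Qed.

(** * Deterministic executions *)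

(** Stated for all continuations at once, since [exec] passes the rest of the program as a
    continuation; sequential composition is then immediate. Specifications below give one [N] for
    all initial states, because after a random choice all branches run on the same fuel. *)
Definition runs (N : nat) (c : cmd R) (s s' : state) : Prop :=
  forall fuel k, (N <= fuel)%N -> exec fuel c k s = k s'.

Lemma runs_mono N N' c s s' : (N <= N')%N -> runs N c s s' -> runs N' c s s'.
Proof. by move=> le h f k hf; apply: h; apply: leq_trans hf. Qed.

Lemma runs_seq N1 N2 c1 c2 s s1 s2 : runs N1 c1 s s1 -> runs N2 c2 s1 s2 ->
  runs (maxn N1 N2).+1 (Seq c1 c2) s s2.
Proof.
move=> h1 h2 [//|f] k; rewrite ltnS geq_max => /andP[l1 l2] /=.
by rewrite h1// h2.
Qed.

Lemma runs_if N b c1 c2 s s' :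
  runs N (if beval s b then c1 else c2) (tick (bcost b).+1 s) s' ->
  runs N.+1 (If b c1 c2) s s'.
Proof. by move=> h [//|f] k lf /=; rewrite h. Qed.

(** The invariant describes the state before the last evaluation of the guard, whose cost the
    conclusion adds. The variant is bounded by a fixed [m] so that the fuel does not depend on the
    state. *)
Lemma runs_while N (V : state -> nat) (I : state -> Prop) b c m :
  (forall s, I s -> beval s b -> exists s',
     [/\ runs N c (tick (bcost b).+1 s) s', I s' & (V s' < V s)%N]) ->
  forall s, I s -> (V s <= m)%N -> exists s',
    [/\ runs (N + m).+1 (While b c) s (tick (bcost b).+1 s'), I s' & ~~ beval s' b].
Proof.
move=> step; elim: m => [|m IH] s Is Vs; have [bt|bf] := boolP (beval s b).
- by have [s' [_ _]] := step _ Is bt; lia.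
- by exists s; split=> // -[//|f] k _ /=; rewrite (negbTE bf).
- have [s1 [r1 I1 V1]] := step _ Is bt.
  have [|s2 [r2 I2 b2]] := IH _ I1; first lia.
  exists s2; split=> // -[//|f] k lf /=; rewrite bt r1; last lia.
  by rewrite r2//; lia.
- by exists s; split=> // -[//|f] k _ /=; rewrite (negbTE bf).
Qed.

Fixpoint straight (c : cmd R) : bool :=
  match c with
  | DrawHash _ _ _ | Rand _ _ | While _ _ => false
  | Seq c1 c2 | If _ c1 c2 => straight c1 && straight c2
  | _ => true
  end.

Fixpoint sexec (c : cmd R) (s : state) : state :=
  match c with
  | Skip => tick 1%N s
  | SetW i e => tick (wcost e).+1 (set_wreg i (weval W s e) s)
  | SetR i e => tick (rcost d e).+1 (set_rreg i (reval S W q s e) s)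
  | Put a e => tick (wcost a + wcost e).+1%N (set_word (weval W s a) (weval W s e) s)
  | Seq c1 c2 => sexec c2 (sexec c1 s)
  | If b c1 c2 => if beval s b then sexec c1 (tick (bcost b).+1 s)
                  else sexec c2 (tick (bcost b).+1 s)
  | _ => s
  end.

(** Fuel measures nesting depth, not the number of steps: both halves of a [Seq] receive the same
    fuel, hence the maximum. *)
Fixpoint csize (c : cmd R) : nat :=
  match c with
  | Seq c1 c2 | If _ c1 c2 => (maxn (csize c1) (csize c2)).+1
  | While _ c1 => (csize c1).+1
  | _ => 1%N
  end.

Lemma runs_straight c s : straight c -> runs (csize c) c s (sexec c s).
Proof.
elim: c s => //= [|i e|i e|a e|c1 IH1 c2 IH2|b c1 IH1 c2 IH2] s; try by move=> _ [].
- by case/andP=> st1 st2; apply: runs_seq; [exact: IH1|exact: IH2].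
- case/andP=> st1 st2; apply: runs_if; case: ifP => _.
    by apply: runs_mono (IH1 _ st1); exact: leq_maxl.
  by apply: runs_mono (IH2 _ st2); exact: leq_maxr.
Qed.

(** * Finitely supported executions *)

Definition wsum (mu : seq (R * state)) (f : state -> R) : R :=
  \sum_(x <- mu) x.1 * f x.2.

(** A law is a list of weighted states, possibly with repetitions: expectations become finite sums,
    with no measurability to check. *)
Definition supported (Q : state -> Prop) (mu : seq (R * state)) : Prop :=
  List.Forall (fun x => 0 <= x.1 /\ Q x.2) mu /\ wsum mu (fun=> 1) = 1.

Definition dbind (mu : seq (R * state)) (g : state -> seq (R * state)) :=
  flatten [seq [seq (x.1 * y.1, y.2) | y <- g x.2] | x <- mu].

(** Nonnegativity of [k] lets the extended-real sums distribute when two laws are composed. *)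
Definition yields (N : nat) (c : cmd R) (s : state) (mu : seq (R * state)) : Prop :=
  forall fuel k, (N <= fuel)%N -> (forall s, 0 <= k s)%E ->
  exec fuel c k s = (\sum_(x <- mu) x.1%:E * k x.2)%E.

Lemma wsum_cons x mu f : wsum (x :: mu) f = x.1 * f x.2 + wsum mu f.
Proof. by rewrite /wsum big_cons. Qed.

Lemma wsum_nil f : wsum [::] f = 0.
Proof. by rewrite /wsum big_nil. Qed.

Lemma wsumE mu f : (\sum_(x <- mu) x.1%:E * (f x.2)%:E)%E = (wsum mu f)%:E.
Proof. by rewrite -sumEFin. Qed.

Lemma wsum_dbind mu g f : wsum (dbind mu g) f = wsum mu (fun s => wsum (g s) f).
Proof.
elim: mu => [|x mu IH]; first by rewrite !wsum_nil.
rewrite wsum_cons -IH /dbind /= /wsum big_cat/=; congr (_ + _).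
by rewrite big_map mulr_sumr; apply: eq_bigr => y _ /=; rewrite mulrA.
Qed.

Lemma supported_le (Q : state -> Prop) mu f g : supported Q mu ->
  (forall s, Q s -> f s <= g s) -> wsum mu f <= wsum mu g.
Proof.
case=> + _ fg; elim=> [|x m [x0 Qx] _ IH]; first by rewrite !wsum_nil.
by rewrite !wsum_cons lerD// ler_wpM2l// fg.
Qed.

Lemma supported_eq (Q : state -> Prop) mu f g : supported Q mu ->
  (forall s, Q s -> f s = g s) -> wsum mu f = wsum mu g.
Proof.
case=> + _ fg; elim=> [|x m [x0 Qx] _ IH]; first by rewrite !wsum_nil.
by rewrite !wsum_cons fg// IH.
Qed.

Lemma wsumD mu f g : wsum mu (fun s => f s + g s) = wsum mu f + wsum mu g.
Proof. by rewrite /wsum -big_split/=; apply: eq_bigr => x _; rewrite mulrDr. Qed.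

Lemma wsumZ mu a f : wsum mu (fun s => a * f s) = a * wsum mu f.
Proof. by rewrite /wsum mulr_sumr; apply: eq_bigr => x _; rewrite mulrCA. Qed.

Lemma wsumZr mu a f : wsum mu (fun s => f s * a) = wsum mu f * a.
Proof. by rewrite mulrC -wsumZ; apply: eq_bigr => x _; rewrite (mulrC a). Qed.

Lemma wsum_sum (I : finType) (P : pred I) mu (f : I -> state -> R) :
  wsum mu (fun s => \sum_(i | P i) f i s) = \sum_(i | P i) wsum mu (f i).
Proof.
by rewrite /wsum exchange_big/=; apply: eq_bigr => x _; rewrite mulr_sumr.
Qed.

Lemma supported_mono (Q Q' : state -> Prop) mu :
  (forall s, Q s -> Q' s) -> supported Q mu -> supported Q' mu.
Proof.
move=> QQ' [h h1]; split=> //; elim: h => {h1} [|x m [x0 Qx] _ IH]; constructor=> //.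
by split=> //; exact: QQ'.
Qed.

Lemma supported_dbind (Q Q' : state -> Prop) mu g : supported Q mu ->
  (forall s, Q s -> supported Q' (g s)) -> supported Q' (dbind mu g).
Proof.
move=> sm h; split; last first.
  rewrite wsum_dbind; transitivity (wsum mu (fun=> 1)); last exact: (proj2 sm).
  by apply: supported_eq (sm) _ => s /h[].
case: sm => + _; elim=> [|x m [x0 Qx] _ IH]; first exact: List.Forall_nil.
rewrite /dbind /=; apply/List.Forall_app; split=> //.
have [+ _] := h _ Qx; elim=> [|y l [y0 Qy] _ IHl]; constructor=> //=.
by split=> //; exact: mulr_ge0.
Qed.

Lemma expect_eq (Q : state -> Prop) mu (k k' : state -> \bar R) : supported Q mu ->
  (forall s, Q s -> k s = k' s) ->
  (\sum_(x <- mu) x.1%:E * k x.2 = \sum_(x <- mu) x.1%:E * k' x.2)%E.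
Proof.
case=> + _ k0; elim=> [|x m [x0 Qx] _ IH]; first by rewrite !big_nil.
by rewrite !big_cons IH k0.
Qed.

Lemma expect_dbind (Q : state -> Prop) mu g (k : state -> \bar R) : supported Q mu ->
  (forall s, Q s -> exists Q', supported Q' (g s)) -> (forall s, 0 <= k s)%E ->
  (\sum_(x <- dbind mu g) x.1%:E * k x.2 =
   \sum_(x <- mu) x.1%:E * \sum_(y <- g x.2) y.1%:E * k y.2)%E.
Proof.
case=> + _ h k0; elim=> [|x m [x0 Qx] _ IH]; first by rewrite !big_nil.
rewrite big_cons -IH {IH} /dbind /= big_cat/=; congr (_ + _)%E.
have [Q' [+ _]] := h _ Qx; elim=> [|y l [y0 Qy] sl IHl]; first by rewrite !big_nil mule0.
rewrite /= !big_cons IHl ge0_muleDr ?EFinM ?muleA//; first by rewrite mule_ge0.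
elim: sl {IHl} => [|z l0 [z0 _] _ IHz]; first by rewrite big_nil.
by rewrite big_cons adde_ge0// mule_ge0.
Qed.

Lemma yields_mono N N' c s mu : (N <= N')%N -> yields N c s mu -> yields N' c s mu.
Proof. by move=> le h f k hf k0; apply: h => //; apply: leq_trans hf. Qed.

Lemma runs_yields N c s s' : runs N c s s' -> yields N c s [:: (1, s')].
Proof. by move=> h f k lf k0; rewrite h// big_seq1 mul1e. Qed.

Lemma supported1 (Q : state -> Prop) s : Q s -> supported Q [:: (1, s)].
Proof.
move=> Qs; split; first by constructor; [split=> //=; exact: ler01|constructor].
by rewrite wsum_cons wsum_nil addr0 mulr1.
Qed.

Lemma yields_seq N1 N2 c1 c2 s mu g (Q : state -> Prop) :
  yields N1 c1 s mu -> supported Q mu ->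
  (forall s', Q s' -> yields N2 c2 s' (g s') /\ exists Q', supported Q' (g s')) ->
  yields (maxn N1 N2).+1 (Seq c1 c2) s (dbind mu g).
Proof.
move=> h1 sm h2 [//|f] k; rewrite ltnS geq_max => /andP[l1 l2] k0 /=.
rewrite h1//; last by move=> s'; exact: exec_ge0.
rewrite (expect_dbind sm) => [|s' /h2[]//|//].
apply: (@expect_eq Q mu (exec f c2 k)
  (fun s' => \sum_(y <- g s') y.1%:E * k y.2)%E) => // s' Qs.
by rewrite (proj1 (h2 _ Qs)).
Qed.

Lemma yields_while N1 N2 b c s mu g (Q : state -> Prop) : beval s b ->
  yields N1 c (tick (bcost b).+1 s) mu -> supported Q mu ->
  (forall s', Q s' -> yields N2 (While b c) s' (g s') /\ exists Q', supported Q' (g s')) ->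
  yields (maxn N1 N2).+1 (While b c) s (dbind mu g).
Proof.
move=> bs h1 sm h2 [//|f] k; rewrite ltnS geq_max => /andP[l1 l2] k0 /=.
rewrite bs h1//; last by move=> s'; exact: exec_ge0.
rewrite (expect_dbind sm) => [|s' /h2[]//|//].
apply: (@expect_eq Q mu (exec f (While b c) k)
  (fun s' => \sum_(y <- g s') y.1%:E * k y.2)%E) => // s' Qs.
by rewrite (proj1 (h2 _ Qs)).
Qed.

Lemma runs_while_false b c s : ~~ beval s b ->
  runs 1 (While b c) s (tick (bcost b).+1 s).
Proof. by move=> bs [//|f] k _ /=; rewrite (negbTE bs). Qed.

Definition duniform (m : nat) (g : nat -> seq (R * state)) : seq (R * state) :=
  flatten [seq [seq (m%:R^-1 * y.1, y.2) | y <- g v] | v <- iota 0 m].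

Lemma wsum_duniform m g f :
  wsum (duniform m g) f = m%:R^-1 * \sum_(v < m) wsum (g v) f.
Proof.
rewrite /duniform -(big_mkord xpredT (fun v => wsum (g v) f)) /index_iota subn0.
elim: (iota 0 m) => [|x l IH]; first by rewrite wsum_nil big_nil mulr0.
rewrite /= /wsum big_cat big_cons mulrDr/=; congr (_ + _); last exact: IH.
by rewrite big_map mulr_sumr; apply: eq_bigr => y _ /=; rewrite mulrA.
Qed.

Lemma supported_duniform m g (Q : state -> Prop) : (0 < m)%N ->
  (forall v, (v < m)%N -> supported Q (g v)) -> supported Q (duniform m g).
Proof.
move=> m0 h; split; last first.
  rewrite wsum_duniform (eq_bigr (fun=> 1)); last by move=> v _; have [] := h v (ltn_ord v).
  by rewrite sumr_const card_ord mulVf// pnatr_eq0 -lt0n.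
rewrite /duniform.
have : forall v, v \in iota 0 m -> supported Q (g v) by move=> v; rewrite mem_iota => /andP[_ ?]; exact: h.
elim: (iota 0 m) => [|x l IH] hl; first exact: List.Forall_nil.
apply/List.Forall_app; split; last by apply: (IH) => v vl; apply: hl; rewrite inE vl orbT.
have [+ _] := hl x (mem_head _ _); elim=> [|y l0 [y0 Qy] _ IHl]; constructor=> //=.
by split=> //; rewrite mulr_ge0// invr_ge0.
Qed.

Lemma yields_rand N i e c s g (Q : state -> Prop) : (0 < weval W s e)%N ->
  (forall v, (v < weval W s e)%N ->
     yields N c (set_wreg i v (tick (wcost e).+1 s)) (g v) /\ supported Q (g v)) ->
  yields N.+2 (Seq (Rand R i e) c) s (duniform (weval W s e) g).
Proof.
move=> m0 h [//|[//|f]] k lf k0; set m := weval W s e in h m0 *.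
have -> : exec f.+2 (Seq (Rand R i e) c) k s = (m%:R^-1%:E *
    \sum_(v < m) exec f.+1 c k (set_wreg i v (tick (wcost e).+1 s)))%E.
  by rewrite -[LHS]/(if m == 0%N then _ else _) gtn_eqF.
have -> : (\sum_(x <- duniform m g) x.1%:E * k x.2 =
   \sum_(v < m) m%:R^-1%:E * \sum_(x <- g v) x.1%:E * k x.2)%E.
  rewrite /duniform -(big_mkord xpredT (fun v => (m%:R^-1%:E * \sum_(x <- g v) x.1%:E * k x.2)%E)).
  rewrite /index_iota subn0.
  have : forall v, v \in iota 0 m -> supported Q (g v).
    by move=> v; rewrite mem_iota => /andP[_ ?]; have [] := h v.
  elim: (iota 0 m) => [|x l IH] hl; first by rewrite !big_nil.
  rewrite /= big_cat big_cons IH; last by move=> v vl; apply: hl; rewrite inE vl orbT.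
  congr (_ + _)%E; have sx := hl x (mem_head _ _).
  rewrite big_map; case: sx => + _; elim=> [|y l0 [y0 Qy] sl IHl]; first by rewrite !big_nil mule0.
  rewrite !big_cons IHl ge0_muleDr ?EFinM ?muleA//; first by rewrite mule_ge0.
  elim: sl {IHl} => [|z ? [z0 _] _ IHz]; first by rewrite big_nil.
  by rewrite big_cons adde_ge0// mule_ge0.
rewrite ge0_sume_distrr; last by move=> v _; exact: exec_ge0.
apply: eq_bigr => v _; have [hy _] := h v (ltn_ord v).
by rewrite (hy f.+1 k)//; lia.
Qed.

End semantics.

(** * Pessimistic estimators for successive samples *)

Section estimators.
Context {R : realType} {M : Type}.
Variables (F : hash_family R M) (m : nat).

Local Notation sample := ((M -> R) * nat)%type.

Definition scons (x : sample) (xs : nat -> sample) : nat -> sample :=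
  fun u => if u is u'.+1 then xs u' else x.

Definition sshift (t : nat) (xs : nat -> sample) : nat -> sample :=
  fun u => xs (t + u)%N.

(* [b] bounds the expectation of [f] over [t] successive samples (a hash function
   and a uniform coefficient below [m]). Only the partial expectations have to be
   measurable, one sample at a time, hence no joint measurability is needed. *)
Fixpoint pessim (t : nat) (f : (nat -> sample) -> R) (b : R) : Prop :=
  if t is t'.+1 then
    exists g : hf_seed F -> nat -> R,
      [/\ forall w v, 0 <= g w v,
          forall v, measurable_fun setT (fun w => g w v),
          forall w v, pessim t' (fun xs => f (scons (hf_eval w, v) xs)) (g w v)
        & (\int[hf_law F]_w (m%:R^-1 * \sum_(v < m) g w v)%:E <= b%:E)%E]
  else forall xs, f xs <= b.

Lemma pessim_le t f f' b b' : (forall xs, f xs <= f' xs) -> b' <= b ->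
  pessim t f' b' -> pessim t f b.
Proof.
elim: t f f' b b' => [|t IH] f f' b b' ff' bb' /=.
  by move=> h xs; apply: le_trans (ff' xs) (le_trans (h xs) bb').
move=> [g [g0 mg hg ig]]; exists g; split=> //.
  by move=> w v; apply: IH (hg w v).
by apply: le_trans ig _; rewrite lee_fin.
Qed.

Hypothesis m_gt0 : (0 < m)%N.

Let mR_neq0 : (m%:R : R) != 0.
Proof. by rewrite pnatr_eq0 -lt0n. Qed.

Lemma mean_cst (a : R) : m%:R^-1 * \sum_(v < m) a = a.
Proof. by rewrite sumr_const card_ord -[a *+ m]mulr_natr mulrCA mulVf// mulr1. Qed.

Lemma prob_integral_cst (a : R) : (\int[hf_law F]_w a%:E = a%:E)%E.
Proof.
rewrite (integral_cst _ measurableT a%:E).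
by rewrite -[X in (_ * X)%E]/(hf_law F setT) probability_setT mule1.
Qed.

Lemma mean_ge0 (g : hf_seed F -> nat -> R) w : (forall w v, 0 <= g w v) ->
  (0%:E <= (m%:R^-1 * \sum_(v < m) g w v)%:E)%E.
Proof. by move=> g0; rewrite lee_fin mulr_ge0 ?invr_ge0// sumr_ge0. Qed.

Lemma measurable_mean (g : hf_seed F -> nat -> R) :
  (forall v, measurable_fun setT (fun w => g w v)) ->
  measurable_fun setT (fun w => m%:R^-1 * \sum_(v < m) g w v).
Proof.
move=> mg; apply: measurable_funM => //.
exact: measurable_sum.
Qed.

(** The integrand [f] need not be measurable, so the bound goes through the measurable minorant [h],
    the positive part of one minus the mean of [g]: its integral and that of the mean add up to at
    least 1. Truncation at 0 keeps the lower integral monotone. *)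
Lemma mean_lower_bound (g : hf_seed F -> nat -> R) (f : hf_seed F -> nat -> \bar R) (b : R) :
  (forall w v, 0 <= g w v) -> (forall v, measurable_fun setT (fun w => g w v)) ->
  (\int[hf_law F]_w (m%:R^-1 * \sum_(v < m) g w v)%:E <= b%:E)%E ->
  (forall w v, 0 <= f w v)%E -> (forall w v, (v < m)%N -> (1 - g w v)%:E <= f w v)%E ->
  ((1 - b)%:E <= \int[hf_law F]_w (m%:R^-1%:E * \sum_(v < m) f w v))%E.
Proof.
move=> g0 mg ib f0 gf.
pose G w := m%:R^-1 * \sum_(v < m) g w v.
pose h w := Num.max 0 (1 - G w).
have mG : measurable_fun setT G by exact: measurable_mean.
have mh : measurable_fun setT h.
  by apply: measurable_maxr => //; apply: measurable_funB.
have hle : (\int[hf_law F]_w (h w)%:E <= \int[hf_law F]_w (m%:R^-1%:E * \sum_(v < m) f w v))%E.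
  apply: ge0_le_lower_integral => w; first by rewrite lee_fin le_max lexx.
  rewrite /h EFin_max ge_max; apply/andP; split.
    by apply: mule_ge0; [rewrite lee_fin invr_ge0|exact: sume_ge0].
  rewrite -[1 in X in (X <= _)%E]mean_cst /G -mulrBr -sumrB EFinM -sumEFin.
  apply: lee_wpmul2l; first by rewrite lee_fin invr_ge0.
  by apply: lee_sum => v _; exact: gf.
apply: le_trans hle; rewrite EFinB.
have : (1%:E <= \int[hf_law F]_w (h w)%:E + \int[hf_law F]_w (G w)%:E)%E.
  rewrite -ge0_integralD//.
  - rewrite -(prob_integral_cst 1); apply: ge0_le_lower_integral => w; first by rewrite lee_fin.
    by rewrite -EFinD lee_fin -lerBlDr /h le_max lexx orbT.
  - by move=> w _; rewrite lee_fin le_max lexx.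
  - exact/measurable_EFinP.
  - by move=> w _; exact: mean_ge0.
  - exact/measurable_EFinP.
move=> h1; rewrite leeBlDr//; apply: le_trans h1 _.
exact: leeD2l.
Qed.

Lemma pessim_cst t (a : R) : 0 <= a -> pessim t (fun=> a) a.
Proof.
move=> a0; elim: t => [|t IH] //=; exists (fun _ _ => a); split=> //.
by under eq_integral do rewrite mean_cst; rewrite prob_integral_cst.
Qed.

Lemma pessimD t f1 f2 b1 b2 : pessim t f1 b1 -> pessim t f2 b2 ->
  pessim t (fun xs => f1 xs + f2 xs) (b1 + b2).
Proof.
elim: t f1 f2 b1 b2 => [|t IH] f1 f2 b1 b2 /=.
  by move=> h1 h2 xs; rewrite lerD.
move=> [g1 [g10 mg1 hg1 ig1]] [g2 [g20 mg2 hg2 ig2]].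
exists (fun w v => g1 w v + g2 w v); split=> //.
- by move=> w v; rewrite addr_ge0.
- by move=> v; apply: measurable_funD.
- by move=> w v; apply: IH.
- under eq_integral do rewrite big_split mulrDr EFinD/=.
  rewrite ge0_integralD//; first by rewrite EFinD; apply: leeD.
  + by move=> w _; exact: mean_ge0.
  + exact/measurable_EFinP/measurable_mean.
  + by move=> w _; exact: mean_ge0.
  + exact/measurable_EFinP/measurable_mean.
Qed.

Lemma pessimZ t f b a : 0 <= a -> pessim t f b ->
  pessim t (fun xs => a * f xs) (a * b).
Proof.
move=> a0; elim: t f b => [|t IH] f b /=; first by move=> h xs; rewrite ler_wpM2l.
move=> [g [g0 mg hg ig]]; exists (fun w v => a * g w v); split=> //.
- by move=> w v; rewrite mulr_ge0.
- by move=> v; apply: measurable_funM.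
- by move=> w v; apply: IH.
- under eq_integral do rewrite -mulr_sumr mulrCA EFinM.
  rewrite ge0_integralZl_EFin//.
  + by rewrite EFinM; apply: lee_wpmul2l.
  + by move=> w _; exact: mean_ge0.
  + exact/measurable_EFinP/measurable_mean.
Qed.

(** Independence of consecutive blocks of samples: whatever the first block, the second factor is
    bounded by the constant [b2], which is carried through the first block. *)
Lemma pessimM t1 t2 f1 f2 b1 b2 :
  (forall xs, 0 <= f1 xs) -> (forall xs, 0 <= f2 xs) -> 0 <= b2 ->
  pessim t1 f1 b1 -> pessim t2 f2 b2 ->
  pessim (t1 + t2) (fun xs => f1 xs * f2 (sshift t1 xs)) (b1 * b2).
Proof.
move=> + f20 b20 + h2; elim: t1 f1 b1 => [|t1 IH] f1 b1 f10 /=.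
  (* With no sample left in the first block, any sequence at all witnesses [0 <= b1]. *)
  move=> h1; have b10 : 0 <= b1 by apply: le_trans (f10 (fun=> (fun=> 0, 0%N))) (h1 _).
  apply: pessim_le (pessimZ b10 h2) => // xs.
  by apply: ler_pM => //; apply: f20.
move=> [g [g0 mg hg ig]]; exists (fun w v => g w v * b2); split=> //.
- by move=> w v; rewrite mulr_ge0.
- by move=> v; apply: measurable_funM.
- by move=> w v; apply: (IH (fun xs => f1 (scons (hf_eval w, v) xs))).
- under eq_integral do rewrite -mulr_suml mulrA mulrC EFinM.
  rewrite ge0_integralZl_EFin//.
  + by rewrite mulrC EFinM; apply: lee_wpmul2l.
  + by move=> w _; exact: mean_ge0.
  + exact/measurable_EFinP/measurable_mean.
Qed.

Lemma pessim_sum t (I : Type) (r : seq I) (P : pred I) f b :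
  (forall i, P i -> pessim t (f i) (b i)) ->
  pessim t (fun xs => \sum_(i <- r | P i) f i xs) (\sum_(i <- r | P i) b i).
Proof.
move=> h; elim: r => [|i r IH].
  rewrite big_nil; apply: (@pessim_le _ _ (fun=> 0) _ 0) (pessim_cst _ _) => //.
  by move=> xs; rewrite big_nil.
rewrite big_cons; case: ifP => Pi.
  apply: pessim_le (pessimD (h i Pi) IH) => // xs; by rewrite big_cons Pi.
by apply: pessim_le IH => // xs; rewrite big_cons Pi.
Qed.

Lemma pessim_shift t0 t t1 f b : (forall xs, 0 <= f xs) -> 0 <= b ->
  pessim t f b -> pessim (t0 + (t + t1)) (fun xs => f (sshift t0 xs)) b.
Proof.
move=> f0 b0 h.
have h1 : pessim (t + t1) f b.
  rewrite -[b]mulr1; apply: pessim_le (pessimM (f2 := fun=> 1) _ _ _ h (pessim_cst _ _)) => //.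
  by move=> xs; rewrite mulr1.
rewrite -[b]mul1r; apply: pessim_le (pessimM (f1 := fun=> 1) _ _ _ (pessim_cst _ _) h1) => //.
by move=> xs; rewrite mul1r.
Qed.

Lemma pessim_block t A f b i : (forall xs, 0 <= f xs) -> 0 <= b -> (i < A)%N ->
  pessim t f b -> pessim (A * t) (fun xs => f (sshift (i * t) xs)) b.
Proof.
move=> f0 b0 iA h.
have -> : (A * t = i * t + (t + (A - i.+1) * t))%N.
  by rewrite addnA -mulSnr -mulnDl subnKC.
exact: pessim_shift.
Qed.

Lemma pessim_prod t A f b : (forall xs, 0 <= f xs) -> 0 <= b ->
  pessim t f b ->
  pessim (A * t) (fun xs => \prod_(i < A) f (sshift (i * t) xs)) (b ^+ A).
Proof.
move=> f0 b0 h; elim: A => [|A IH].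
  by rewrite mul0n expr0 => xs; rewrite big_ord0.
rewrite mulSnr exprSr.
apply: pessim_le (pessimM _ _ _ IH h) => //.
  by move=> xs; rewrite big_ord_recr.
by move=> xs; exact: prodr_ge0.
Qed.

(** The difference of two fingerprints, started from an accumulated difference [g]. It consumes the
    first sample first, as [pessim] does, whereas [hval] follows the loop of the machine and peels
    off the last one. *)
Fixpoint hdiff (x y : M) (g : R) (xs : nat -> sample) (t : nat) : R :=
  if t is t'.+1 then
    hdiff x y (g * (xs 0%N).2%:R + ((xs 0%N).1 x - (xs 0%N).1 y)) (sshift 1 xs) t'
  else g.

Fixpoint hval (xs : nat -> sample) (x : M) (t : nat) : R :=
  if t is t'.+1 then hval xs x t' * (xs t').2%:R + (xs t').1 x else 0.

Lemma hdiffS x y g xs t : hdiff x y g xs t.+1 =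
  hdiff x y g xs t * (xs t).2%:R + ((xs t).1 x - (xs t).1 y).
Proof. by elim: t g xs => [|t IH] g xs //; rewrite -[LHS]/(hdiff _ _ _ _ t.+1) IH. Qed.

Lemma hdiffE x y xs t : hdiff x y 0 xs t = hval xs x t - hval xs y t.
Proof. by elim: t => [|t IH]; rewrite ?hdiffS ?IH /= ?subr0//; ring. Qed.

Hypothesis mF : forall x, measurable_fun setT (fun w : hf_seed F => hf_eval w x).

Lemma measurable_collision x y (a : R) :
  measurable [set w : hf_seed F | a + (hf_eval w x - hf_eval w y) = 0].
Proof.
have mf : measurable_fun setT (fun w : hf_seed F => a + (hf_eval w x - hf_eval w y)).
  by apply: measurable_funD => //; apply: measurable_funB.
by rewrite -[X in measurable X]setTI; exact: (mf measurableT _ (measurable_set1 0)).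
Qed.

Lemma integral_affine_indic (a b : R) (A : set (hf_seed F)) : 0 <= a -> 0 <= b ->
  measurable A -> (\int[hf_law F]_w (a + b * \1_A w)%:E = a%:E + b%:E * hf_law F A)%E.
Proof.
move=> a0 b0 mA; under eq_integral do rewrite EFinD EFinM.
rewrite ge0_integralD//; last 2 first.
- by move=> w _; rewrite -EFinM lee_fin mulr_ge0.
- by apply/measurable_EFinP; apply: measurable_funM => //; exact: measurable_indic.
rewrite prob_integral_cst ge0_integralZl_EFin//; last exact/measurable_EFinP/measurable_indic.
by rewrite integral_indic// setIT.
Qed.

Lemma collision_set x y :
  [set w : hf_seed F | 0 + (hf_eval w x - hf_eval w y) = 0] =
  [set w | hf_eval w x = hf_eval w y].
Proof.
apply/seteqP; split=> w /=; rewrite add0r; first by move/subr0_eq.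
by move=> ->; rewrite subrr.
Qed.

(** A zero difference stays zero only if the next hash function collides, which contributes a factor
    [P]. A nonzero [g] leads to zero for at most one coefficient [v], because the values [g * v] are
    distinct; each step thus adds at most 1 / m of false collisions. *)
Lemma pessim_collision x y (P : R) t g : 0 <= P <= 1 -> (collision F x y <= P%:E)%E ->
  pessim t (fun xs => (hdiff x y g xs t == 0)%:R)
    ((if g == 0 then P ^+ t else 0) + t%:R / m%:R).
Proof.
move=> /andP[P0 P1] hP; elim: t g => [|t IH] g.
  by rewrite /= => xs; rewrite mul0r addr0; case: ifP.
pose E v := [set w : hf_seed F | g * v%:R + (hf_eval w x - hf_eval w y) = 0].
have mE v : measurable (E v) by exact: measurable_collision.
exists (fun w v => t%:R / m%:R + P ^+ t * \1_(E v) w); split.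
- by move=> w v; rewrite addr_ge0 ?divr_ge0// mulr_ge0 ?exprn_ge0.
- by move=> v; apply: measurable_funD => //; apply: measurable_funM => //; exact: measurable_indic.
- move=> w v; rewrite addrC; apply: pessim_le (IH (g * v%:R + (hf_eval w x - hf_eval w y))) => //.
  rewrite lerD2r indicE; case: eqP => [h|_].
    by rewrite mem_set// mulr1.
  by rewrite mulr_ge0 ?exprn_ge0.
have [g0|g0] := eqVneq g 0.
- have EE v : E v = [set w | hf_eval w x = hf_eval w y].
    by rewrite /E g0 mul0r collision_set.
  under eq_integral do under eq_bigr do rewrite EE.
  under eq_integral do rewrite mean_cst.
  rewrite integral_affine_indic ?divr_ge0 ?exprn_ge0//; last by rewrite -(EE 0%N).
  rewrite (addrC (P ^+ t.+1)) EFinD; apply: leeD; first by rewrite lee_fin ler_pM2r ?invr_gt0 ?ltr0n// ler_nat.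
  by rewrite exprSr EFinM; apply: lee_wpmul2l => //; rewrite lee_fin exprn_ge0.
- apply: (@le_trans _ _ (\int[hf_law F]_w ((t.+1)%:R / m%:R)%:E)%E); last first.
    by rewrite prob_integral_cst add0r.
  apply: ge0_le_lower_integral => w.
    rewrite lee_fin mulr_ge0 ?invr_ge0// sumr_ge0// => v _.
    by rewrite addr_ge0 ?divr_ge0// mulr_ge0 ?exprn_ge0.
  rewrite lee_fin big_split/= mulrDr mean_cst -natr1 mulrDl lerD2l mulrC.
  rewrite ler_pM2r ?invr_gt0 ?ltr0n// -mulr_sumr mulr_ile1 ?exprn_ge0 ?exprn_ile1 ?sumr_ge0//.
  case: (pickP (fun v : 'I_m => w \in E v)) => [v0 v0E|noE]; last first.
    by rewrite big1// => v _; rewrite indicE noE.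
  rewrite (bigD1 v0)//= big1 ?addr0 ?indicE ?v0E// => v vv0.
  rewrite indicE; case: (boolP (w \in E v)) => // vE; case/negP: vv0.
  move: v0E vE => /set_mem h1 /set_mem h2.
  apply/eqP/val_inj/eqP => /=; rewrite -(eqr_nat R); apply/eqP/(mulfI g0).
  by apply: (addIr (hf_eval w x - hf_eval w y)); rewrite h1 h2.
Qed.

(** It suffices for a collision that all [t] hash functions collide; false collisions only help, so
    the coefficients play no part in the bound. *)
Lemma pessim_no_collision x y (p : R) t g : 0 <= p <= 1 -> (p%:E <= collision F x y)%E ->
  pessim t (fun xs => (hdiff x y g xs t != 0)%:R)
    (if g == 0 then 1 - p ^+ t else 1).
Proof.
move=> /andP[p0 p1] hp; elim: t g => [|t IH] g.
  by rewrite /= => xs; rewrite subrr; case: ifP.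
have [g0|g0] := eqVneq g 0; last first.
  by apply: pessim_le (pessim_cst t.+1 ler01) => // xs; case: eqP.
rewrite g0.
pose E := [set w : hf_seed F | hf_eval w x = hf_eval w y].
have mE : measurable E by rewrite /E -collision_set; exact: measurable_collision.
have pt1 : p ^+ t <= 1 by exact: exprn_ile1.
have pt0 : 0 <= p ^+ t by exact: exprn_ge0.
exists (fun w v => (1 - p ^+ t) + p ^+ t * \1_(~` E) w); split.
- by move=> w v; rewrite addr_ge0 ?subr_ge0// mulr_ge0.
- move=> v; apply: measurable_funD => //; apply: measurable_funM => //.
  by apply: measurable_indic; exact: measurableC.
- move=> w v; apply: pessim_le (IH (0 * v%:R + (hf_eval w x - hf_eval w y))) => //.
  rewrite mul0r add0r subr_eq0 indicE; case: eqP => h.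
    by rewrite memNset ?mulr0 ?addr0//= => /(_ h).
  by rewrite mem_set// mulr1 subrK.
under eq_integral do rewrite mean_cst.
rewrite integral_affine_indic ?subr_ge0//; last exact: measurableC.
have -> : hf_law F (~` E) = (1 - collision F x y)%E by exact: probability_setC.
move: hp; have /fineK <- : collision F x y \is a fin_num by exact: fin_num_measure.
rewrite lee_fin -EFinB -EFinM -EFinD lee_fin => hp.
rewrite exprSr mulrBr mulr1 addrA subrK lerD2l lerN2.
by rewrite ler_wpM2l.
Qed.

End estimators.

(** * Subroutines *)

Section code.
Context {R : realType}.
Variables (k i : nat).

(** Word memory is divided into residue classes modulo 2 (k + 1): classes 2i and 2i + 1 hold the
    coefficients and the sorted tables of level i, the last two hold the scratch data of queries.
    Interleaving lets arrays whose lengths grow with n coexist in a program text that does not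
    depend on n. *)
Definition nkinds : nat := (k.+1).*2.
Definition cell (z kind : nat) (e : wexp) : wexp :=
  WBin Add (WBin Mul e (WLit z)) (WLit kind).
Definition coef_cell (e : wexp) := cell nkinds i.*2 e.
Definition table_cell (e : wexp) := cell nkinds i.*2.+1 e.
Definition cum_cell (e : wexp) := cell nkinds k.*2 e.
Definition start_cell (e : wexp) := cell nkinds k.*2.+1 e.
Definition hash_cell (e : wexp) := cell k i e.

Definition incr (r : nat) : cmd R := SetW R r (WBin Add (WReg r) (WLit 1)).

(* Registers: 1 = n, 2 = number K of hash functions per table, 3 = number L of
   tables per copy, 4 = number A of copies, 5 = n^(1/k) rounded up, 6 = budget of
   a copy, 7 = range of the coefficients, 8 = A * L, 9 = current table,
   11 = current point, 0 = answer. *)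
Definition hash_index : wexp := WBin Add (WBin Mul (WReg 9) (WReg 2)) (WReg 10).

Definition eval_hash (P : pointref) : cmd R :=
  Seq (SetR 0 (RLit 0)) (Seq (SetW R 10 (WLit 0))
    (While (WLt R (WReg 10) (WReg 2))
      (Seq (SetR 0 (RBin RAdd
                      (RBin RMul (RReg R 0) (ROfW R (WGet (coef_cell hash_index))))
                      (Hash R (hash_cell hash_index) P)))
           (incr 10)))).

(* Register 12 receives the number of indices below register [re] at which the
   test, a decreasing predicate of the index in register 14, succeeds. *)
Definition bsearch (re : nat) (test : cmd R) (cond : bexp R) : cmd R :=
  Seq (SetW R 12 (WLit 0)) (Seq (SetW R 13 (WReg re))
    (While (WLt R (WReg 12) (WReg 13))
      (Seq (SetW R 14 (WBin Div (WBin Add (WReg 12) (WReg 13)) (WLit 2)))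
        (Seq test
          (If cond (SetW R 12 (WBin Add (WReg 14) (WLit 1))) (SetW R 13 (WReg 14))))))).

End code.

(** The bit length, which bounds the number of rounds of a bisection. *)
Definition lg (x : nat) : nat := if x is 0%N then 0%N else (trunc_log 2 x).+1.

Lemma lg_half x y : (0 < x)%N -> (y <= x./2)%N -> (lg y < lg x)%N.
Proof.
case: x => // x _; case: y => // y hy; rewrite /lg ltnS.
rewrite (@trunc_log2S x.+1) ?ltnS; last by lia.
by rewrite leq_trunc_log.
Qed.

(** Innermost reductions are removed first, so that each side condition is plain arithmetic. *)
Ltac nomod := repeat match goal with
  | |- context [modn ?a ?b] =>
      lazymatch a with
      | context [modn _ _] => fail
      | _ => rewrite (@modn_small a b); [|lia]
      end
  end.

Ltac rst := match goal with
  | |- @runs ?R ?M ?d ?lsh ?n ?S ?W ?q _ ?c ?s _ =>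
      exact (@runs_straight R M d lsh n S W q c s isT)
  end.

Section subroutines.
Context {R : realType} {M : metricType R}.
Variables (d : nat) (lsh : R -> R -> hash_family R M).
Variables (n : nat) (S : 'I_n -> M) (W : nat) (q : option M).

Local Notation state := (state R M).
Local Notation runs := (runs d lsh S W q).
Local Notation sexec := (sexec d S W q).
Local Notation beval := (beval S W q).
Local Notation bcost := (@bcost R d).

Definition memtop (s : state) := (st_mem s, wtop s, htop s).

Definition regs_frame (ws rs : seq nat) (s s' : state) : Prop :=
  (forall x, x \notin ws -> wreg s' x = wreg s x) /\
  (forall x, x \notin rs -> rreg s' x = rreg s x).

#[local] Hint Resolve allss : core.

Lemma regs_frame_trans ws1 rs1 ws2 rs2 ws rs s1 s2 s3 :
  regs_frame ws1 rs1 s1 s2 -> regs_frame ws2 rs2 s2 s3 ->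
  all [in ws] ws1 -> all [in ws] ws2 ->
  all [in rs] rs1 -> all [in rs] rs2 -> regs_frame ws rs s1 s3.
Proof.
move=> [h1 h1'] [h2 h2'] /allP w1 /allP w2 /allP r1 /allP r2; split=> x xn.
- by rewrite h2 ?h1//; apply: contra xn; [exact: w1|exact: w2].
- by rewrite h2' ?h1'//; apply: contra xn; [exact: r1|exact: r2].
Qed.

Lemma regs_frame_sub ws1 rs1 ws rs s1 s2 : regs_frame ws1 rs1 s1 s2 ->
  all [in ws] ws1 -> all [in rs] rs1 -> regs_frame ws rs s1 s2.
Proof.
move=> [h1 h1'] /allP w1 /allP r1; split=> x xn.
- by rewrite h1//; apply: contra xn; exact: w1.
- by rewrite h1'//; apply: contra xn; exact: r1.
Qed.

Lemma regs_frame_tickl ws rs t s s' : regs_frame ws rs (tick t s) s' ->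
  regs_frame ws rs s s'.
Proof. by []. Qed.

Fixpoint wmods (c : cmd R) : seq nat :=
  match c with
  | SetW i _ | Rand i _ => [:: i]
  | Seq c1 c2 | If _ c1 c2 => wmods c1 ++ wmods c2
  | While _ c1 => wmods c1
  | _ => [::]
  end.

Fixpoint rmods (c : cmd R) : seq nat :=
  match c with
  | SetR i _ => [:: i]
  | Seq c1 c2 | If _ c1 c2 => rmods c1 ++ rmods c2
  | While _ c1 => rmods c1
  | _ => [::]
  end.

Fixpoint scost (c : cmd R) : nat :=
  match c with
  | Skip => 1
  | SetW _ e => (wcost e).+1
  | SetR _ e => (rcost d e).+1
  | Put a e => (wcost a + wcost e).+1
  | Seq c1 c2 => scost c1 + scost c2
  | If b c1 c2 => (bcost b).+1 + maxn (scost c1) (scost c2)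
  | _ => 0
  end%N.

Fixpoint noput (c : cmd R) : bool :=
  match c with
  | Put _ _ | DrawHash _ _ _ => false
  | Seq c1 c2 | If _ c1 c2 => noput c1 && noput c2
  | While _ c1 => noput c1
  | _ => true
  end.

Lemma sexec_frame c s : regs_frame (wmods c) (rmods c) s (sexec c s).
Proof.
elim: c s => //= [j e|j e|c1 IH1 c2 IH2|b c1 IH1 c2 IH2] s.
- by split=> x //=; rewrite inE /upd => /negbTE ->.
- by split=> x //=; rewrite inE /upd => /negbTE ->.
- by apply: regs_frame_trans (IH1 s) (IH2 _) _ _ _ _; apply/allP => x; rewrite mem_cat => ->//;
  rewrite orbT.
- case: ifP => _.
    by apply: regs_frame_sub (IH1 (tick _ s)) _ _; apply/allP => x; rewrite mem_cat => ->.
  by apply: regs_frame_sub (IH2 (tick _ s)) _ _; apply/allP => x; rewrite mem_cat => ->; rewrite orbT.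
Qed.

Lemma sexec_memtop c s : noput c -> memtop (sexec c s) = memtop s.
Proof.
elim: c s => //= [c1 IH1 c2 IH2|b c1 IH1 c2 IH2] s /andP[n1 n2].
  by rewrite IH2// IH1.
by case: ifP => _; rewrite ?IH1 ?IH2.
Qed.

Lemma sexec_time c s : (st_time (sexec c s) <= st_time s + scost c)%N.
Proof.
elim: c s => [|? ?|? ?|? ?|? ? ?|? ?|c1 IH1 c2 IH2|b c1 IH1 c2 IH2|b c1 _] s /=; try lia.
- have := IH1 s; have := IH2 (sexec c1 s); lia.
- by case: ifP => _; [have := IH1 (tick (bcost b).+1 s)|have := IH2 (tick (bcost b).+1 s)] => /=; lia.
Qed.

Lemma memtop_mem s s' : memtop s' = memtop s -> st_mem s' = st_mem s.
Proof. by case. Qed.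

Definition samples (k i : nat) (m : memory R M) : nat -> (M -> R) * nat :=
  fun t => (hashes m (t * k + i)%N, words m (t * nkinds k + i.*2)%N).

Definition table_hash (k i K : nat) (m : memory R M) (J : nat) (x : M) : R :=
  hval (sshift (J * K) (samples k i m)) x K.

Definition hash_time (K : nat) : nat := ((d + 40) * K.+1)%N.

(** Both admissible references cost one step and read nothing that the loop modifies. The room
    required of [W] covers the addresses of all [K] samples of the table. *)
Lemma eval_hash_spec k i K P :
  (0 < K)%N -> (i < k)%N -> (nkinds k < W)%N ->
  P = Query \/ P = Data (WReg 11) ->
  exists N, forall s J x, wreg s 2 = K -> wreg s 9 = J ->
    ((J * K + K) * nkinds k + nkinds k < W)%N -> peval S W q s P = Some x ->
  exists s', [/\ runs N (eval_hash k i P) s s',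
     regs_frame [:: 10%N] [:: 0%N] s s', memtop s' = memtop s,
     (st_time s' <= st_time s + hash_time K)%N
   & rreg s' 0 = table_hash k i K (st_mem s) J x].
Proof.
move=> K0 ik zW hP.
rewrite /eval_hash; set body := Seq (SetR 0 _) (incr 10).
have [N HN] : exists N, forall s J x, wreg s 2 = K -> wreg s 9 = J ->
    ((J * K + K) * nkinds k + nkinds k < W)%N -> peval S W q s P = Some x ->
    wreg s 10 = 0%N -> rreg s 0 = 0 ->
  exists s', [/\ runs N (While (WLt R (WReg 10) (WReg 2)) body) s s',
     regs_frame [:: 10%N] [:: 0%N] s s', memtop s' = memtop s,
     (st_time s' <= st_time s + (d + 40) * K + 5)%N
   & rreg s' 0 = table_hash k i K (st_mem s) J x].
  eexists => s J x s2 s9 hW sP s10 r0.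
  pose I s1 := [/\ regs_frame [:: 10%N] [:: 0%N] s s1, memtop s1 = memtop s,
       (wreg s1 10 <= K)%N, (st_time s1 <= st_time s + (d + 40) * wreg s1 10)%N
     & rreg s1 0 = hval (sshift (J * K) (samples k i (st_mem s))) x (wreg s1 10)].
  have step s1 : I s1 -> beval s1 (WLt R (WReg 10) (WReg 2)) -> exists s2,
      [/\ runs (csize body) body (tick 4 s1) s2, I s2 & (K - wreg s2 10 < K - wreg s1 10)%N].
    move=> [fr mt le tm rv]; rewrite /= (proj1 fr 2%N)// s2 => lt.
    have s19 : wreg s1 9 = J by rewrite (proj1 fr).
    have s12 : wreg s1 2 = K by rewrite (proj1 fr).
    have m1 := memtop_mem mt.
    have fW : ((J * K + wreg s1 10) * nkinds k + nkinds k < W)%N.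
      apply: leq_ltn_trans hW; rewrite leq_add2r leq_mul2r; apply/orP; right; lia.
    have fW' : ((J * K + wreg s1 10) * k + k < W)%N.
      apply: leq_ltn_trans fW; apply: leq_add; rewrite ?leq_mul2l; rewrite /nkinds; lia.
    have KW : (K < W)%N.
      apply: leq_ltn_trans hW; apply: (@leq_trans ((J * K + K) * nkinds k)); last lia.
      by apply: leq_trans (leq_pmulr _ _); rewrite /nkinds; lia.
    have fJ : (J * K + wreg s1 10 < W)%N.
      apply: leq_ltn_trans fW; apply: (@leq_trans ((J * K + wreg s1 10) * nkinds k)); last lia.
      by apply: leq_pmulr; rewrite /nkinds; lia.
    have i2 : (i.*2 < nkinds k)%N by rewrite /nkinds; lia.
    have kz : (k < nkinds k)%N by rewrite /nkinds; lia.
    have w10 : wreg (sexec body (tick 4 s1)) 10 = (wreg s1 10).+1.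
      by rewrite /= /upd /=; nomod; lia.
    exists (sexec body (tick 4 s1)); split.
    + rst.
    + split.
      * by apply: regs_frame_trans fr (sexec_frame body (tick 4 s1)) _ _ _ _.
      * by rewrite sexec_memtop.
      * by rewrite w10; lia.
      * have pc : (pcost P <= 1)%N by case: hP => ->.
        have := sexec_time body (tick 4 s1); rewrite w10 mulnS.
        by set X := st_time (sexec _ _); rewrite /=; lia.
      * rewrite w10 [LHS]/= /upd/= s19 s12 m1.
        have -> : peval S W q (tick 4 s1) P = Some x.
          by case: hP sP => -> //=; rewrite (proj1 fr).
        by nomod; rewrite rv.
    + by rewrite w10; lia.
  have I0 : I s by split=> //; rewrite ?s10 ?r0//; lia.
  have [s' [r [fr mt le tm rv] gf]] := runs_while step I0 (leq_subr _ _).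
  have e10 : wreg s' 10 = K by move: gf; rewrite /= (proj1 fr 2%N) ?s2 //; lia.
  exists (tick 4 s'); split=> //=; first exact: r.
    by move: tm; rewrite e10; lia.
  by rewrite rv e10.
eexists => s J x s2 s9 hW sP.
have [||||||s' [r fr mt tm rv]] := HN (sexec (Seq (SetR 0 (RLit 0)) (SetW R 10 (WLit 0))) s) J x.
- by rewrite /= /upd.
- by rewrite /= /upd.
- by [].
- by case: hP sP => ->.
- by rewrite /= /upd /= mod0n.
- by rewrite /= /upd.
exists s'; split=> //.
- apply: runs_seq; first rst.
  by apply: runs_seq; [rst|exact: r].
- apply: regs_frame_trans (sexec_frame (Seq (SetR 0 (RLit 0)) (SetW R 10 (WLit 0))) s) fr _ _ _ _ => //.
- apply: leq_trans tm _; rewrite /= /hash_time; lia.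
Qed.

(** The predicate [f] comes after the fuel bound because it depends on the contents of the state.
    The modulus exceeds twice the range since the midpoint is computed from a sum. *)
Lemma bsearch_spec Nt tw tr tt tc NN re test cond :
  12%N \notin tw -> 13%N \notin tw -> 14%N \notin tw -> re != 12%N ->
  (NN.*2.+2 < W)%N -> (bcost cond <= tc)%N ->
  exists N, forall s0 (f : nat -> bool), wreg s0 re = NN ->
    (forall x y, (x <= y)%N -> (y < NN)%N -> f y -> f x) ->
    (forall s1 x, regs_frame (12%N :: 13%N :: 14%N :: tw) tr s0 s1 ->
      memtop s1 = memtop s0 -> wreg s1 14 = x -> (x < NN)%N ->
      exists s2, [/\ runs Nt test s1 s2, regs_frame tw tr s1 s2,
        memtop s2 = memtop s1, (st_time s2 <= st_time s1 + tt)%N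
      & beval s2 cond = f x]) ->
  exists s', [/\ runs N (bsearch re test cond) s0 s',
     regs_frame (12%N :: 13%N :: 14%N :: tw) tr s0 s', memtop s' = memtop s0,
     (st_time s' <= st_time s0 + (tt + tc + 20) * lg NN + 10)%N
   & (wreg s' 12 <= NN)%N /\ forall x, (x < NN)%N -> f x = (x < wreg s' 12)%N].
Proof.
move=> t12 t13 t14 re12 hW hc.
set ws := [:: 12%N, 13%N, 14%N & tw].
rewrite /bsearch; set c1 := SetW R 14 _.
set c2 := If cond _ _.
set T := (tt + tc + 20)%N.
have subtw : all [in ws] tw by apply/allP => x; rewrite !inE => ->; rewrite !orbT.
have subws : all [in ws] ws by [].
have [N HN] : exists N, forall s0 (f : nat -> bool), wreg s0 12 = 0%N -> wreg s0 13 = NN ->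
    (forall x y, (x <= y)%N -> (y < NN)%N -> f y -> f x) ->
    (forall s1 x, regs_frame ws tr s0 s1 ->
      memtop s1 = memtop s0 -> wreg s1 14 = x -> (x < NN)%N ->
      exists s2, [/\ runs Nt test s1 s2, regs_frame tw tr s1 s2,
        memtop s2 = memtop s1, (st_time s2 <= st_time s1 + tt)%N
      & beval s2 cond = f x]) ->
  exists s', [/\ runs N (While (WLt R (WReg 12) (WReg 13)) (Seq c1 (Seq test c2))) s0 s',
     regs_frame ws tr s0 s', memtop s' = memtop s0,
     (st_time s' <= st_time s0 + T * lg NN + 5)%N
   & (wreg s' 12 <= NN)%N /\ forall x, (x < NN)%N -> f x = (x < wreg s' 12)%N].
  exists (maxn (csize c1) (maxn Nt (csize c2)).+1 + NN).+2 => s0 f z12 z13 mono ht.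
  (* The term [T * lg] is a potential that pays for the rounds still to come. *)
  pose I s1 := [/\ regs_frame ws tr s0 s1, memtop s1 = memtop s0,
       (wreg s1 12 <= wreg s1 13 <= NN)%N,
       (st_time s1 + T * lg (wreg s1 13 - wreg s1 12) <= st_time s0 + T * lg NN)%N
     & (forall x, (x < wreg s1 12)%N -> f x) /\
       (forall x, (wreg s1 13 <= x)%N -> (x < NN)%N -> ~~ f x)].
  have step s1 : I s1 -> beval s1 (WLt R (WReg 12) (WReg 13)) -> exists s2,
      [/\ runs (maxn (csize c1) (maxn Nt (csize c2)).+1).+1 (Seq c1 (Seq test c2)) (tick 4 s1) s2,
        I s2 & (wreg s2 13 - wreg s2 12 < wreg s1 13 - wreg s1 12)%N].
    move=> [fr mt le tm [fl fh]]; rewrite /= => lt.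
    set s1' := tick 4 s1.
    set mid := ((wreg s1 12 + wreg s1 13) %/ 2)%N.
    have midlt : (mid < wreg s1 13)%N by rewrite /mid; lia.
    have midge : (wreg s1 12 <= mid)%N by rewrite /mid; lia.
    have mid2 : (mid.*2 <= wreg s1 12 + wreg s1 13 <= mid.*2.+1)%N by rewrite /mid; lia.
    have m14 : wreg (sexec c1 s1') 14 = mid by rewrite /= /upd/=; nomod.
    move: mid midlt midge mid2 m14 => mid midlt midge mid2 m14.
    have fr1 : regs_frame ws tr s0 (sexec c1 s1').
      by apply: regs_frame_trans fr (sexec_frame c1 s1') _ _ _ _.
    have [||s2 [r2 fr2 mt2 tm2 cd]] := ht (sexec c1 s1') mid fr1 _ m14; [by []|lia|].
    have g12 : wreg s2 12 = wreg s1 12 by rewrite (proj1 fr2).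
    have g13 : wreg s2 13 = wreg s1 13 by rewrite (proj1 fr2).
    have g14 : wreg s2 14 = mid by rewrite (proj1 fr2).
    have tm3 := sexec_time c2 s2.
    have tm1 := sexec_time c1 s1'.
    have fr3 : regs_frame ws tr s0 (sexec c2 s2).
      have fr12 : regs_frame ws tr s0 s2 by apply: regs_frame_trans fr1 fr2 _ _ _ _.
      by apply: regs_frame_trans fr12 (sexec_frame c2 s2) _ _ _ _.
    have fmid x : (x <= mid)%N -> f mid -> f x by move=> xm; apply: mono => //; lia.
    have nfmid x : (mid <= x)%N -> (x < NN)%N -> ~~ f mid -> ~~ f x.
      by move=> xm xN; apply: contra; apply: mono.
    exists (sexec c2 s2); split.
    + apply: runs_seq; first rst.
      by apply: runs_seq; [exact: r2|rst].
    + have mt3 : memtop (sexec c2 s2) = memtop s0 by rewrite sexec_memtop// mt2.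
      have lgs y : (y <= (wreg s1 13 - wreg s1 12)./2)%N ->
          (st_time (sexec c2 s2) + T * lg y <= st_time s0 + T * lg NN)%N.
        move=> hy; apply: leq_trans tm; have := lg_half _ hy.
        rewrite subn_gt0 lt => /(_ isT) => hlg.
        apply: (@leq_trans (st_time s1 + T + T * lg y)); last first.
          by rewrite -addnA leq_add2l -mulnS leq_mul2l hlg orbT.
        rewrite leq_add2r; move: tm1 tm2 tm3; rewrite /= /T; lia.
      have z12' : wreg (sexec c2 s2) 12 = if f mid then mid.+1 else wreg s1 12.
        by rewrite /= cd; case: ifP => _ //; rewrite /= /upd/= g14; nomod; lia.
      have z13' : wreg (sexec c2 s2) 13 = if f mid then wreg s1 13 else mid.
        by rewrite /= cd; case: ifP => _ //; rewrite /= /upd/= g14.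
      split=> //.
      * by rewrite z12' z13'; case: ifP => _; lia.
      * by apply: lgs; rewrite z12' z13'; case: ifP => _; lia.
      * rewrite z12' z13'; case: ifPn => fm; split=> //.
        - by move=> x; rewrite ltnS => xm; exact: fmid.
        - by move=> x xm xN; exact: nfmid fm.
    + have -> : wreg (sexec c2 s2) 12 = if f mid then mid.+1 else wreg s1 12.
        by rewrite /= cd; case: ifP => _ //; rewrite /= /upd/= g14; nomod; lia.
      have -> : wreg (sexec c2 s2) 13 = if f mid then wreg s1 13 else mid.
        by rewrite /= cd; case: ifP => _ //; rewrite /= /upd/= g14.
      by case: ifP => _; lia.
  have I0 : I s0.
    split=> //; rewrite ?z12 ?z13 ?subn0//; first lia.
    by split=> // x xN xN'; lia.
  have V0 : (wreg s0 13 - wreg s0 12 <= NN)%N by rewrite z12 z13 subn0.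
  have [s' [r [fr mt le tm [fl fh]] gf]] := runs_while step I0 V0.
  exists (tick 4 s'); move: gf; rewrite /= -leqNgt => gf.
  have eq : wreg s' 12 = wreg s' 13 by lia.
  split=> //.
  - by move: tm; rewrite /=; lia.
  - split=> /=; first lia.
    move=> x xN; case: ltnP => xl; first by rewrite fl.
    by apply/negbTE/fh => //; rewrite -eq.
exists (maxn 1 (maxn 1 N).+1).+1 => s0 f sre mono ht.
set c0 := (Seq (SetW R 12 (WLit 0)) (SetW R 13 (WReg re))).
have fr0 := sexec_frame c0 s0.
have fr0' : regs_frame ws tr s0 (sexec c0 s0).
  by apply: regs_frame_sub fr0 _ _.
have [||||s' [r fr mt tm res]] := HN (sexec c0 s0) f.
- by rewrite /= /upd /= mod0n.
- by rewrite /= /upd/= (negbTE re12).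
- exact: mono.
- move=> s1 x fr1 mt1 h14 xN; apply: ht => //.
  by apply: regs_frame_trans fr0' fr1 _ _ _ _.
exists s'; split=> //.
- apply: runs_seq; first rst.
  by apply: runs_seq; [rst|exact: r].
- by apply: regs_frame_trans fr0' fr _ _ _ _.
- apply: leq_trans tm _; rewrite /=; lia.
Qed.

End subroutines.

(** * Buckets of the query point *)

Section bucket_code.
Context {R : realType}.
Variables (k i : nat).

Definition probe : cmd R :=
  Seq (SetW R 11 (WGet (table_cell k i
         (WBin Add (WBin Mul (WReg 9) (WReg 1)) (WReg 14)))))
      (eval_hash k i (Data (WReg 11))).

(** Counting the entries of a sorted table that are below, then at most, the fingerprint of the
    query gives the two ends of its bucket. *)
Definition below : bexp R := BNot (RLe (RReg R 1) (RReg R 0)).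
Definition atmost : bexp R := RLe (RReg R 0) (RReg R 1).

Definition store_bucket : cmd R :=
  Seq (Put R (start_cell k (WReg 15)) (WReg 23))
    (Seq (Put R (cum_cell k (WReg 15)) (WReg 18))
      (Seq (SetW R 18 (WBin Add (WReg 18) (WBin Defs.Sub (WReg 12) (WReg 23))))
        (incr 15))).

Definition find_bucket : cmd R :=
  Seq (SetW R 9 (WBin Add (WReg 16) (WReg 15)))
    (Seq (eval_hash k i Query)
      (Seq (SetR 1 (RReg R 0))
        (Seq (bsearch 1 probe below)
          (Seq (SetW R 23 (WReg 12))
            (Seq (bsearch 1 probe atmost) store_bucket))))).

Definition find_buckets : cmd R :=
  Seq (SetW R 15 (WLit 0)) (Seq (SetW R 18 (WLit 0))
    (While (WLt R (WReg 15) (WReg 3)) find_bucket)).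

Definition erase : cmd R :=
  Seq (Put R (start_cell k (WReg 15)) (WLit 0))
    (Seq (Put R (cum_cell k (WReg 15)) (WLit 0)) (incr 15)).

(** Erasing the scratch cells gives back the very memory left by the preprocessing; the independence
    of successive queries rests on it. *)
Definition erase_buckets : cmd R :=
  Seq (SetW R 15 (WLit 0)) (While (WLt R (WReg 15) (WReg 3)) erase).

End bucket_code.

Section trial_code.
Context {R : realType}.
Variables (k i : nat) (rr : R).

Definition pick_point : cmd R :=
  Seq (bsearch 3 Skip (BNot (WLt R (WReg 19) (WGet (cum_cell k (WReg 14))))))
    (Seq (SetW R 15 (WBin Defs.Sub (WReg 12) (WLit 1)))
      (Seq (SetW R 9 (WBin Add (WReg 16) (WReg 15)))
        (Seq (SetW R 11 (WGet (table_cell k i (WBin Add (WBin Mul (WReg 9) (WReg 1))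
               (WBin Add (WGet (start_cell k (WReg 15)))
                 (WBin Defs.Sub (WReg 19) (WGet (cum_cell k (WReg 15)))))))))
          (Seq (SetW R 21 (WLit 0)) (SetW R 22 (WLit 0)))))).

(** Register 21 counts the tables walked backwards from [j]; [L] is added before subtracting because
    words are natural numbers. *)
Definition scan_step : cmd R :=
  Seq (Seq (incr 21) (SetW R 9 (WBin Add (WReg 16)
           (WBin Defs.Mod (WBin Defs.Sub (WBin Add (WReg 15) (WReg 3)) (WReg 21)) (WReg 3)))))
    (Seq (eval_hash k i Query)
      (Seq (SetR 1 (RReg R 0))
        (Seq (eval_hash k i (Data (WReg 11)))
          (If (BAnd (RLe (RReg R 0) (RReg R 1)) (RLe (RReg R 1) (RReg R 0)))
             (SetW R 22 (WLit 1)) Skip)))).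

Definition scan_guard : bexp R :=
  BAnd (WLt R (WReg 21) (WReg 20)) (WLt R (WReg 22) (WLit 1)).

(** A far point is rejected before any scan and costs one unit of budget; only near points pay for
    scanning. The subtraction from the budget is truncated, which absorbs the overrun of the last
    trial. *)
Definition settle : cmd R :=
  Seq (If (RLe (Dist R (Data (WReg 11)) Query) (RLit rr))
         (Seq (While scan_guard scan_step)
            (If (WLt R (WReg 22) (WLit 1)) (SetW R 0 (WBin Add (WReg 11) (WLit 1))) Skip))
         Skip)
    (SetW R 24 (WBin Defs.Sub (WReg 24) (WBin Add (WReg 21) (WLit 1)))).

Definition trial : cmd R :=
  Seq (Rand R 19 (WReg 18)) (Seq (Rand R 20 (WReg 3)) (Seq pick_point settle)).

End trial_code.

(** * Bucket search, choice of a candidate and rejection step *)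

Section buckets.
Context {R : realType} {M : metricType R}.
Variables (d : nat) (lsh : R -> R -> hash_family R M).
Variables (n : nat) (S : 'I_n -> M) (W : nat) (x0 : M).

Local Notation state := (state R M).
Local Notation runs := (runs d lsh S W (Some x0)).
Local Notation sexec := (sexec d S W (Some x0)).
Local Notation beval := (beval S W (Some x0)).
Local Notation bcost := (@bcost R d).

Lemma peval_data (q : option M) (s : state) r (p : 'I_n) : wreg s r = p ->
  peval S W q s (Data (WReg r)) = Some (S p).
Proof. by move=> h; rewrite /= h valK. Qed.

Variables (k i K L A : nat) (m0 : memory R M).
Hypotheses (ik : (i < k)%N) (K_gt0 : (0 < K)%N) (L_gt0 : (0 < L)%N).
Hypotheses (A_gt0 : (0 < A)%N) (n_gt0 : (0 < n)%N).
Local Notation z := (nkinds k).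
Hypothesis HW : ((A * L * (K + n) + L + 3) * z < W)%N.

Local Notation th := (table_hash k i K m0).

(** Only the permutation is stored; the fingerprints that it sorts are recomputed from the sampled
    hash functions. *)
Definition table_sorted (m : memory R M) (J : nat) (pi : {perm 'I_n}) : Prop :=
  (forall x : 'I_n, words m ((J * n + x) * z + i.*2.+1)%N = pi x) /\
  (forall x y : 'I_n, (x <= y)%N ->
     table_hash k i K m J (S (pi x)) <= table_hash k i K m J (S (pi y))).

Variable pi : nat -> {perm 'I_n}.
Hypothesis tables : forall J, (J < A * L)%N -> table_sorted m0 J (pi J).

Definition scratch (a : nat) : bool := (k.*2 <= a %% z)%N && (a %/ z < L)%N.
Hypothesis scratch0 : forall a, scratch a -> words m0 a = 0%N.

Definition same_but_scratch (m : memory R M) : Prop :=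
  hashes m = hashes m0 /\ forall a, ~~ scratch a -> words m a = words m0 a.

Let z_gt1 : (1 < z)%N.
Proof. by rewrite /nkinds; lia. Qed.

Lemma cell_mod x kd : (kd < z)%N ->
  ((x * z + kd) %% z = kd /\ (x * z + kd) %/ z = x)%N.
Proof. by move=> kz; rewrite modnMDl modn_small// divnMDl ?divn_small ?addn0//; lia. Qed.

Lemma cell_inj x kd x' kd' : (kd < z)%N -> (kd' < z)%N ->
  (x * z + kd == x' * z + kd')%N = (x == x') && (kd == kd').
Proof.
move=> kz kz'; apply/eqP/andP => [h|[/eqP-> /eqP->]//].
have [m1 d1] := cell_mod x kz; have [m2 d2] := cell_mod x' kz'.
by split; apply/eqP; [rewrite -d1 h d2|rewrite -m1 h m2].
Qed.

Lemma cell_lt x : (x <= A * L * (K + n) + L + 1)%N -> (x * z + z < W)%N.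
Proof.
move=> hx; apply: leq_ltn_trans HW; rewrite -mulSnr leq_mul2r; apply/orP; right; lia.
Qed.

Let zW : (z < W)%N. Proof. by have := @cell_lt 0; rewrite mul0n add0n; apply; lia. Qed.

Lemma hash_index_lt J : (J < A * L)%N -> ((J * K + K) * z + z < W)%N.
Proof.
move=> hJ; apply: cell_lt; rewrite -mulSnr mulnDr -!addnA; apply: leq_trans (leq_addr _ _).
by rewrite leq_mul2r hJ orbT.
Qed.

Lemma table_index_lt J x : (J < A * L)%N -> (x < n)%N ->
  [/\ ((J * n + x) * z + z < W)%N, (J * n + x < W)%N & (J * n < W)%N].
Proof.
move=> hJ hx; have h : (J * n + x <= A * L * (K + n) + L + 1)%N.
  rewrite mulnDr; have : (J.+1 * n <= A * L * n)%N by rewrite leq_mul2r hJ orbT.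
  by rewrite mulSn; lia.
have hz := cell_lt h; have : (J * n + x <= (J * n + x) * z)%N by apply: leq_pmulr; lia.
by split; lia.
Qed.

Lemma small_lt : [/\ (A * L + L.*2.+2 < W)%N, (n.*2.+2 < W)%N, (L.*2.+2 < W)%N & (A * L * n + n < W)%N].
Proof.
have h1 : (A * L <= A * L * (K + n))%N by apply: leq_pmulr; lia.
have h2 : (A * L * n <= A * L * (K + n))%N by rewrite leq_mul2l; apply/orP; right; lia.
have h3 : (n <= A * L * n)%N by apply: leq_pmull; rewrite muln_gt0 A_gt0.
have h4 : (L <= A * L)%N by apply: leq_pmull.
have h5 : ((A * L * (K + n) + L + 3) * 2 <= (A * L * (K + n) + L + 3) * z)%N.
  by rewrite leq_mul2l z_gt1 orbT.
by split; lia.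
Qed.

Lemma samples_same m : same_but_scratch m -> samples k i m = samples k i m0.
Proof.
move=> [hm wm]; apply/funext => t; rewrite /samples hm wm//.
rewrite /scratch; have [|-> _] := @cell_mod t i.*2; rewrite /nkinds; lia.
Qed.

Lemma table_hash_same m : same_but_scratch m -> table_hash k i K m = th.
Proof. by move=> hm; apply/funext => J; apply/funext => x; rewrite /table_hash samples_same. Qed.

Lemma table_same m J (x : 'I_n) : same_but_scratch m -> (J < A * L)%N ->
  words m ((J * n + x) * z + i.*2.+1)%N = pi J x.
Proof.
move=> [hm wm] hJ; rewrite wm; first by have [-> _] := tables hJ.
rewrite /scratch; have [|-> _] := @cell_mod (J * n + x)%N i.*2.+1; rewrite /nkinds; lia.
Qed.

Lemma probe_spec : exists N, forall s J (x : 'I_n), same_but_scratch (st_mem s) ->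
  wreg s 1 = n -> wreg s 2 = K -> wreg s 9 = J -> (J < A * L)%N -> wreg s 14 = x ->
  exists s', [/\ runs N (probe k i) s s', regs_frame [:: 10%N; 11%N] [:: 0%N] s s',
     memtop s' = memtop s, (st_time s' <= st_time s + hash_time d K + 20)%N
   & rreg s' 0 = th J (S (pi J x))].
Proof.
have [|N HN] := @eval_hash_spec R M d lsh n S W (Some x0) k i K (Data (WReg 11)) K_gt0 ik zW.
  by right.
exists (maxn 1 N).+1 => s J x hm s1 s2 s9 hJ s14.
rewrite /probe; set c := SetW R 11 _.
have fr1 := sexec_frame d S W (Some x0) c s.
have tm1 := sexec_time d S W (Some x0) c s.
have [f1 f2 f3] := table_index_lt hJ (ltn_ord x).
have iz : (i.*2.+1 < z)%N by rewrite /nkinds; lia.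
have e11 : wreg (sexec c s) 11 = pi J x.
  rewrite /= /upd/= s9 s1 s14; nomod; exact: table_same.
have [||||s' [r fr mt tm rv]] := HN (sexec c s) J (S (pi J x)).
- by rewrite (proj1 fr1 2%N).
- by rewrite (proj1 fr1 9%N).
- exact: hash_index_lt.
- exact: peval_data.
exists s'; split.
- by apply: runs_seq; [rst|exact: r].
- by apply: regs_frame_trans fr1 fr _ _ _ _.
- by rewrite mt sexec_memtop.
- by apply: leq_trans tm _; move: tm1; set X := st_time _; rewrite /=; lia.
- by rewrite rv table_hash_same.
Qed.

Definition coll (J : nat) (p : 'I_n) : bool := th J (S p) == th J x0.

Definition bucket_size (J : nat) : nat := #|[set p | coll J p]%SET|.

Definition bucket_at (J lo : nat) : Prop :=
  (lo + bucket_size J <= n)%N /\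
  forall y : 'I_n, (lo <= y < lo + bucket_size J)%N = coll J (pi J y).

Lemma card_ord_interval lo hi : (lo <= hi <= n)%N ->
  #|[set y : 'I_n | (lo <= y < hi)%N]%SET| = (hi - lo)%N.
Proof.
move=> /andP[lh hn]; rewrite -sum1_card.
rewrite (eq_bigl (fun y : 'I_n => (lo <= y < hi)%N)); last by move=> y; rewrite inE.
rewrite -(big_mkord (fun y => (lo <= y < hi)%N) (fun=> 1%N)).
rewrite (@big_cat_nat _ _ _ hi 0 n)//= (@big_cat_nat _ _ _ lo 0 hi)//=.
rewrite big_nat_cond big_pred0; last by move=> y; lia.
rewrite [X in (_ + _ + X)%N](_ : _ = 0%N); last by rewrite big_nat_cond big_pred0// => y; lia.
rewrite add0n addn0 big_nat_cond (eq_bigl (fun y => (lo <= y < hi)%N && true)).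
  by rewrite -big_nat_cond sum_nat_const_nat muln1.
by move=> y; lia.
Qed.

Lemma bucket_atP J lo hi : (lo <= n)%N -> (hi <= n)%N ->
  (forall y : 'I_n, (y < lo)%N = (th J (S (pi J y)) < th J x0)) ->
  (forall y : 'I_n, (y < hi)%N = (th J (S (pi J y)) <= th J x0)) ->
  bucket_at J lo /\ (hi = lo + bucket_size J)%N.
Proof.
move=> lon hin hlo hhi.
have lh : (lo <= hi)%N.
  (* Otherwise the entry at position [hi] would be below the fingerprint of the query without being
     at most equal to it. *)
  rewrite leqNgt; apply/negP => hl; have hn : (hi < n)%N by lia.
  have := hlo (Ordinal hn); have := hhi (Ordinal hn) => /=; rewrite ltnn hl => h1 h2.
  by move: (esym h1); rewrite ltW.
have e : (hi = lo + bucket_size J)%N.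
  rewrite /bucket_size.
  have -> : [set p | coll J p]%SET = [set pi J y | y in [set y : 'I_n | (lo <= y < hi)%N]%SET]%SET.
    apply/setP => p; rewrite inE; apply/idP/imsetP => [cp|[y]].
      exists ((pi J)^-1%g p); last by rewrite permKV.
      rewrite inE leqNgt hlo hhi permKV; move: cp; rewrite /coll => /eqP ->.
      by rewrite ltxx lexx.
    rewrite inE leqNgt hlo hhi -leNgt => h ->; by rewrite /coll eq_le andbC.
  rewrite card_imset; last exact: perm_inj.
  by rewrite card_ord_interval ?lh ?hin// subnKC.
split=> //; split; first by rewrite -e.
by move=> y; rewrite -e leqNgt hlo hhi -leNgt /coll eq_le andbC.
Qed.

Definition probe_time : nat := ((hash_time d K + 100) * (lg n).+1)%N.

Definition cum (j0 j : nat) : nat := (\sum_(j' < j) bucket_size (j0 + j'))%N.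

Lemma bucket_size_le J : (bucket_size J <= n)%N.
Proof. by rewrite /bucket_size; apply: leq_trans (max_card _) _; rewrite card_ord. Qed.

Lemma cum_le j0 j : (cum j0 j <= j * n)%N.
Proof.
apply: (@leq_trans (\sum_(j' < j) n)%N); last by rewrite sum_nat_const card_ord.
by apply: leq_sum => j' _; exact: bucket_size_le.
Qed.

(** One statement for both ends of a bucket, [f] standing for either comparison; its monotonicity
    turns sortedness into the decreasing predicate needed by the bisection. *)
Lemma bucket_search cond (f : R -> R -> bool) :
  (forall v a b, a <= b -> f v b -> f v a) ->
  (forall s, beval s cond = f (rreg s 1) (rreg s 0)) -> (bcost cond <= 10)%N ->
  exists N, forall s J, same_but_scratch (st_mem s) ->
    wreg s 1 = n -> wreg s 2 = K -> wreg s 9 = J -> (J < A * L)%N ->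
  exists s', [/\ runs N (bsearch 1 (probe k i) cond) s s',
     regs_frame [:: 12%N; 13%N; 14%N; 10%N; 11%N] [:: 0%N] s s', memtop s' = memtop s,
     (st_time s' <= st_time s + probe_time)%N
   & (wreg s' 12 <= n)%N /\
     forall y : 'I_n, (y < wreg s' 12)%N = f (rreg s 1) (th J (S (pi J y)))].
Proof.
move=> fmono hc cc; have [Nt Ht] := probe_spec; have [_ nW _ _] := small_lt.
have [//|//|//|//|N HN] := @bsearch_spec R M d lsh n S W (Some x0) Nt [:: 10%N; 11%N] [:: 0%N]
  (hash_time d K + 20) 10 n 1 (probe k i) cond _ _ _ _ nW cc.
exists N => s J hm s1 s2 s9 hJ.
(* The bisection works with a predicate on all naturals; its value from [n] on is never
   consulted. *)
pose g y := if insub y is Some x then f (rreg s 1) (th J (S (pi J x))) else false.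
have gE (x : 'I_n) : g x = f (rreg s 1) (th J (S (pi J x))) by rewrite /g valK.
have [//|||s' [r fr mt tm [le hz]]] := HN s g _ _ _.
- move=> x y xy yn; have xn : (x < n)%N by lia.
  rewrite (gE (Ordinal yn)) (gE (Ordinal xn)); apply: fmono.
  by have [_] := tables hJ; apply.
- move=> s3 x fr mt s14 xn.
  have [||||||s4 [r fr4 mt4 tm4 rv]] := Ht s3 J (Ordinal xn).
  + by rewrite (memtop_mem mt).
  + by rewrite (proj1 fr 1%N).
  + by rewrite (proj1 fr 2%N).
  + by rewrite (proj1 fr 9%N).
  + by [].
  + by [].
  exists s4; split=> //; first by rewrite addnA.
  by rewrite hc rv (proj2 fr4 1%N)// (proj2 fr 1%N)// (gE (Ordinal xn)).
exists s'; split=> //.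
- apply: leq_trans tm _; rewrite /probe_time -!addnA leq_add2l.
  by rewrite mulnS; have : ((hash_time d K + 50) * lg n <= (hash_time d K + 100) * lg n)%N;
    [rewrite leq_mul2r; apply/orP; right|]; lia.
- by split=> // y; rewrite -hz// gE.
Qed.

Lemma find_bucket_spec : exists N, forall s j j0, same_but_scratch (st_mem s) ->
    wreg s 1 = n -> wreg s 2 = K -> wreg s 15 = j -> (j < L)%N ->
    wreg s 16 = j0 -> (j0 + L <= A * L)%N -> wreg s 18 = cum j0 j ->
  exists s', [/\ runs N (find_bucket k i) s s',
     regs_frame [:: 9%N; 10%N; 11%N; 12%N; 13%N; 14%N; 15%N; 18%N; 23%N] [:: 0%N; 1%N] s s',
     (st_time s' <= st_time s + 3 * probe_time)%N,
     wreg s' 15 = j.+1 /\ wreg s' 18 = cum j0 j.+1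
   & exists2 lo, bucket_at (j0 + j) lo &
     st_mem s' = Memory (upd (upd (words (st_mem s)) (j * z + k.*2.+1) lo)
                             (j * z + k.*2) (cum j0 j)) (hashes (st_mem s))].
Proof.
have [|N1 H1] := @eval_hash_spec R M d lsh n S W (Some x0) k i K Query K_gt0 ik zW.
  by left.
have [|//|//|N2 H2] := @bucket_search (below (R:=R)) (fun v a => a < v).
- by move=> v a b; apply: le_lt_trans.
- by move=> s; rewrite ltNge.
have [|//|//|N3 H3] := @bucket_search (atmost (R:=R)) (fun v a => a <= v).
  by move=> v a b; apply: le_trans.
have [bW1 bW2 bW3 bW4] := small_lt.
eexists => s j j0 hm s1 s2 s15 jL s16 j0L s18.
have hJ : (j0 + j < A * L)%N by lia.
pose c1 := SetW R 9 (WBin Add (WReg 16) (WReg 15)).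
have fr1 := sexec_frame d S W (Some x0) c1 s.
have e9 : wreg (sexec c1 s) 9 = (j0 + j)%N by rewrite /= /upd/= s16 s15; nomod.
have tm1 := sexec_time d S W (Some x0) c1 s; have mt1 : memtop (sexec c1 s) = memtop s by [].
move: (sexec c1 s) fr1 e9 tm1 mt1 (ltac:(rst) : runs 1 c1 s (sexec c1 s)) => t1 fr1 e9 tm1 mt1 t1E.
have [||||t2 [r2 fr2 mt2 tm2 rv2]] := H1 t1 (j0 + j)%N x0.
- by rewrite (proj1 fr1 2%N).
- by [].
- exact: hash_index_lt.
- by [].
pose c3 := SetR 1 (RReg R 0).
have fr3 := sexec_frame d S W (Some x0) c3 t2.
have tm3 := sexec_time d S W (Some x0) c3 t2; have mt3 : memtop (sexec c3 t2) = memtop t2 by [].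
have rv3 : rreg (sexec c3 t2) 1 = th (j0 + j) x0.
  by rewrite /= /upd/= rv2 (memtop_mem mt1) table_hash_same.
move: (sexec c3 t2) fr3 tm3 mt3 rv3 (ltac:(rst) : runs 1 c3 t2 (sexec c3 t2)) => t3 fr3 tm3 mt3 rv3 t3E.
have [|||||t4 [r4 fr4 mt4 tm4 [le4 h4]]] := H2 t3 (j0 + j)%N.
- by rewrite (memtop_mem mt3) (memtop_mem mt2) (memtop_mem mt1).
- by rewrite (proj1 fr3 1%N)// (proj1 fr2 1%N)// (proj1 fr1 1%N).
- by rewrite (proj1 fr3 2%N)// (proj1 fr2 2%N)// (proj1 fr1 2%N).
- by rewrite (proj1 fr3 9%N)// (proj1 fr2 9%N)//.
- by [].
pose c5 := SetW R 23 (WReg 12).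
have fr5 := sexec_frame d S W (Some x0) c5 t4.
have tm5 := sexec_time d S W (Some x0) c5 t4; have mt5 : memtop (sexec c5 t4) = memtop t4 by [].
have e23 : wreg (sexec c5 t4) 23 = wreg t4 12 by [].
move: (sexec c5 t4) fr5 tm5 mt5 e23 (ltac:(rst) : runs 1 c5 t4 (sexec c5 t4)) => t5 fr5 tm5 mt5 e23 t5E.
have mt5s : memtop t5 = memtop s by rewrite mt5 mt4 mt3 mt2 mt1.
have [|||||t6 [r6 fr6 mt6 tm6 [le6 h6]]] := H3 t5 (j0 + j)%N.
- by rewrite (memtop_mem mt5s).
- by rewrite (proj1 fr5 1%N)// (proj1 fr4 1%N)// (proj1 fr3 1%N)// (proj1 fr2 1%N)// (proj1 fr1 1%N).
- by rewrite (proj1 fr5 2%N)// (proj1 fr4 2%N)// (proj1 fr3 2%N)// (proj1 fr2 2%N)// (proj1 fr1 2%N).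
- by rewrite (proj1 fr5 9%N)// (proj1 fr4 9%N)// (proj1 fr3 9%N)// (proj1 fr2 9%N).
- by [].
have r51 : rreg t5 1 = th (j0 + j) x0 by rewrite (proj2 fr5 1%N)// (proj2 fr4 1%N).
have f23 : wreg t6 23 = wreg t4 12 by rewrite (proj1 fr6 23%N).
have [hb hi] : bucket_at (j0 + j) (wreg t4 12) /\
    (wreg t6 12 = wreg t4 12 + bucket_size (j0 + j))%N.
  apply: bucket_atP => // y; first by rewrite h4 rv3.
  by rewrite h6 r51.
have fr16 : regs_frame [:: 9%N; 10%N; 11%N; 12%N; 13%N; 14%N; 23%N] [:: 0%N; 1%N] s t6.
  have g2 : regs_frame [:: 9%N; 10%N] [:: 0%N] s t2 by apply: regs_frame_trans fr1 fr2 _ _ _ _.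
  have g3 : regs_frame [:: 9%N; 10%N] [:: 0%N; 1%N] s t3 by apply: regs_frame_trans g2 fr3 _ _ _ _.
  have g4 : regs_frame [:: 9%N; 10%N; 11%N; 12%N; 13%N; 14%N] [:: 0%N; 1%N] s t4.
    by apply: regs_frame_trans g3 fr4 _ _ _ _.
  have g5 : regs_frame [:: 9%N; 10%N; 11%N; 12%N; 13%N; 14%N; 23%N] [:: 0%N; 1%N] s t5.
    by apply: regs_frame_trans g4 fr5 _ _ _ _.
  by apply: regs_frame_trans g5 fr6 _ _ _ _.
have m6 : st_mem t6 = st_mem s by rewrite (memtop_mem mt6) (memtop_mem mt5s).
have e15 : wreg t6 15 = j by rewrite (proj1 fr16 15%N).
have e18 : wreg t6 18 = cum j0 j by rewrite (proj1 fr16 18%N).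
have cl := cum_le j0 j; have bsl := bucket_size_le (j0 + j).
have jn : (j * n + n <= A * L * n)%N by rewrite -mulSnr leq_mul2r; apply/orP; right; lia.
have jz : (j * z + z < W)%N by apply: cell_lt; lia.
have kz : (k.*2.+1 < z)%N by rewrite /nkinds; lia.
have fr7 := sexec_frame d S W (Some x0) (store_bucket k) t6.
have tm7 := sexec_time d S W (Some x0) (store_bucket k) t6.
exists (sexec (store_bucket k) t6); split.
- rewrite /find_bucket; apply: runs_seq; first exact: t1E.
  apply: runs_seq; first exact: r2.
  apply: runs_seq; first exact: t3E.
  apply: runs_seq; first exact: r4.
  apply: runs_seq; first exact: t5E.
  apply: runs_seq; first exact: r6.
  rst.
- by apply: regs_frame_trans fr16 fr7 _ _ _ _.
- move: tm1 tm2 tm3 tm4 tm5 tm6 tm7; set X := st_time (sexec _ _); rewrite /= /probe_time; lia.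
- split; first by rewrite /= /upd/= e15; nomod; lia.
  rewrite /= /upd/= f23 hi e18; nomod; rewrite /cum big_ord_recr/=; lia.
- exists (wreg t4 12) => //.
  rewrite /= m6 f23 e15 e18; by nomod.
Qed.


Definition buckets_stored (j0 j : nat) (lo : nat -> nat) (m : memory R M) : Prop :=
  forall j', (j' < j)%N ->
    [/\ words m (j' * z + k.*2.+1)%N = lo j', words m (j' * z + k.*2)%N = cum j0 j'
      & bucket_at (j0 + j') (lo j')].

Lemma scratch_cum j : (j < L)%N -> scratch (j * z + k.*2)%N.
Proof. by move=> jL; rewrite /scratch; have [|-> ->] := @cell_mod j k.*2; rewrite /nkinds; lia. Qed.

Lemma scratch_start j : (j < L)%N -> scratch (j * z + k.*2.+1)%N.
Proof. by move=> jL; rewrite /scratch; have [|-> ->] := @cell_mod j k.*2.+1; rewrite /nkinds; lia. Qed.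

Lemma scratchP a : scratch a ->
  exists2 j, (j < L)%N & a = (j * z + k.*2)%N \/ a = (j * z + k.*2.+1)%N.
Proof.
move=> /andP[h1 h2]; exists (a %/ z)%N => //.
have h3 : (a %% z < k.*2.+2)%N by have := @ltn_pmod a z (ltnW z_gt1); rewrite -doubleS.
have [e|e] : (a %% z = k.*2 \/ a %% z = k.*2.+1)%N by move: (a %% z)%N h1 h3 => x; lia.
  by left; rewrite {1}(divn_eq a z) e.
by right; rewrite {1}(divn_eq a z) e.
Qed.

Lemma find_buckets_spec : exists N, forall s j0, same_but_scratch (st_mem s) ->
    wreg s 1 = n -> wreg s 2 = K -> wreg s 3 = L ->
    wreg s 16 = j0 -> (j0 + L <= A * L)%N ->
  exists s', [/\ runs N (find_buckets k i) s s',
     regs_frame [:: 9%N; 10%N; 11%N; 12%N; 13%N; 14%N; 15%N; 18%N; 23%N] [:: 0%N; 1%N] s s',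
     (st_time s' <= st_time s + (3 * probe_time + 10) * L.+1)%N,
     wreg s' 18 = cum j0 L /\ same_but_scratch (st_mem s')
   & exists lo, buckets_stored j0 L lo (st_mem s')].
Proof.
have [Nb Hb] := find_bucket_spec.
have [bW1 bW2 bW3 bW4] := small_lt.
set ws := [:: 9%N; 10%N; 11%N; 12%N; 13%N; 14%N; 15%N; 18%N; 23%N]; set rs := [:: 0%N; 1%N].
eexists => s j0 hm s1 s2 s3 s16 j0L.
pose c0 : cmd R := Seq (SetW R 15 (WLit 0)) (SetW R 18 (WLit 0)).
pose b : bexp R := WLt R (WReg 15) (WReg 3).
pose I s1 := [/\ regs_frame ws rs s s1, same_but_scratch (st_mem s1),
   (wreg s1 15 <= L)%N /\ wreg s1 18 = cum j0 (wreg s1 15),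
   (st_time s1 <= st_time s + 5 + (3 * probe_time + 5) * wreg s1 15)%N
 & exists lo, buckets_stored j0 (wreg s1 15) lo (st_mem s1)].
have step t : I t -> beval t b -> exists t',
    [/\ runs Nb (find_bucket k i) (tick 4 t) t', I t' & (L - wreg t' 15 < L - wreg t 15)%N].
  move=> [fr sm [le e18] tm [lo hlo]]; rewrite /= (proj1 fr 3%N)// s3 => lt.
  have [||||||||t' [r fr' tm' [e15' e18'] [lo' hb' me]]] := Hb (tick 4 t) (wreg t 15) j0.
  - by [].
  - by rewrite /= (proj1 fr 1%N).
  - by rewrite /= (proj1 fr 2%N).
  - by [].
  - by [].
  - by rewrite /= (proj1 fr 16%N).
  - by [].
  - by [].
  have kz : (k.*2.+1 < z)%N by rewrite /nkinds; lia.
  have kz' : (k.*2 < z)%N by rewrite /nkinds; lia.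
  exists t'; split=> //; last by rewrite e15'; lia.
  split.
  - by apply: regs_frame_trans fr fr' _ _ _ _.
  - rewrite me; case: sm => [hm1 hm2]; split=> //= a na; rewrite /upd.
    case: eqP => [e|_]; first by move: na; rewrite e scratch_cum.
    case: eqP => [e|_]; first by move: na; rewrite e scratch_start.
    exact: hm2.
  - by rewrite e15' e18'.
  - by rewrite e15'; move: tm tm' => /=; lia.
  - exists (upd lo (wreg t 15) lo') => j'; rewrite e15' ltnS => j'le; rewrite me /= /upd.
    rewrite !cell_inj// !eqxx !andbT; have [->|ne] := eqVneq j' (wreg t 15).
      by rewrite (_ : k.*2.+1 == k.*2 = false) //=; lia.
    by rewrite /=; apply: hlo; lia.
have I0 : I (sexec c0 s).
  split=> //.
  - by apply: regs_frame_sub (sexec_frame d S W (Some x0) c0 s) _ _.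
  - by rewrite /= /upd/= mod0n /cum big_ord0; split.
  - by rewrite /= /upd/= mod0n; lia.
  - by exists (fun=> 0%N) => j'; rewrite /= /upd/= mod0n.
have [t [r [fr sm [le e18] tm [lo hlo]] gf]] := runs_while step I0 (leq_subr _ _).
have e15 : wreg t 15 = L by move: gf; rewrite /= (proj1 fr 3%N)// s3; lia.
exists (tick 4 t); split=> //.
- apply: runs_seq; first rst.
  by apply: runs_seq; [rst|exact: r].
- by move: tm; rewrite e15 /= mulnDl [in X in _ -> X]mulnDl !mulnS; lia.
- by rewrite /= e18 e15.
- by exists lo; rewrite /= -e15.
Qed.

Lemma erase_buckets_spec : exists N, forall s, same_but_scratch (st_mem s) -> wreg s 3 = L ->
  exists s', [/\ runs N (erase_buckets k) s s', regs_frame [:: 15%N] [::] s s',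
     (st_time s' <= st_time s + 50 * L.+1)%N & st_mem s' = m0].
Proof.
have [bW1 bW2 bW3 bW4] := small_lt.
eexists => s [hm wm] s3.
pose b : bexp R := WLt R (WReg 15) (WReg 3).
pose I s1 := [/\ regs_frame [:: 15%N] [::] s s1, hashes (st_mem s1) = hashes m0,
   (wreg s1 15 <= L)%N,
   (st_time s1 <= st_time s + 5 + 50 * wreg s1 15)%N
 & forall a, ~~ scratch a || (a %/ z < wreg s1 15)%N -> words (st_mem s1) a = words m0 a].
have step t : I t -> beval t b -> exists t',
    [/\ runs (csize (erase (R:=R) k)) (erase k) (tick 4 t) t', I t' & (L - wreg t' 15 < L - wreg t 15)%N].
  move=> [fr hh le tm hw]; rewrite /= (proj1 fr 3%N)// s3 => lt.
  have jz : (wreg t 15 * z + z < W)%N by apply: cell_lt; lia.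
  have kz : (k.*2.+1 < z)%N by rewrite /nkinds; lia.
  have kz' : (k.*2 < z)%N by rewrite /nkinds; lia.
  have e15 : wreg (sexec (erase k) (tick 4 t)) 15 = (wreg t 15).+1.
    by rewrite /= /upd/=; nomod; lia.
  have me : words (st_mem (sexec (erase k) (tick 4 t))) =
      upd (upd (words (st_mem t)) (wreg t 15 * z + k.*2.+1) 0) (wreg t 15 * z + k.*2) 0.
    by rewrite /= mod0n; nomod.
  exists (sexec (erase k) (tick 4 t)); split; [rst| |by rewrite e15; lia].
  split=> //.
  - by apply: regs_frame_trans fr (sexec_frame d S W (Some x0) (erase k) (tick 4 t)) _ _ _ _.
  - by rewrite e15; lia.
  - by have := sexec_time d S W (Some x0) (erase k) (tick 4 t); rewrite e15; set X := st_time _; rewrite /=; lia.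
  - move=> a; rewrite e15 me ltnS => h; rewrite /upd.
    case: eqP => [->|na]; first by rewrite scratch0// scratch_cum.
    case: eqP => [->|nb]; first by rewrite scratch0// scratch_start.
    apply: hw; case/orP: h => [->//|]; rewrite leq_eqVlt => /orP[/eqP e|->]; last by rewrite orbT.
    apply/orP; left; apply/negP => /scratchP[j jL [ae|ae]].
      by apply: na; rewrite -e ae; have [|_ ->] := @cell_mod j k.*2.
    by apply: nb; rewrite -e ae; have [|_ ->] := @cell_mod j k.*2.+1.
pose c0 := SetW R 15 (WLit 0).
have I0 : I (sexec c0 s).
  split=> //.
  - exact: (sexec_frame d S W (Some x0) c0 s).
  - by rewrite /= /upd/= mod0n.
  - by rewrite /= /upd/= mod0n; lia.
  - by move=> a; rewrite /= /upd/= mod0n orbF; exact: wm.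
have [t [r [fr hh le tm hw] gf]] := runs_while step I0 (leq_subr _ _).
have e15 : wreg t 15 = L by move: gf; rewrite /= (proj1 fr 3%N)// s3; lia.
exists (tick 4 t); split=> //.
- by apply: runs_seq; [rst|exact: r].
- by move: tm; rewrite e15 /=; lia.
- rewrite /=; case: (st_mem t) hh hw => w h /= -> hw; case: m0 hw scratch0 => w0 h0 /= hw z0.
  congr (Memory _ _); apply/funext => a; apply: hw; rewrite e15.
  by case: (boolP (scratch a)) => // /andP[_ ->]; rewrite orbT.
Qed.

Let kz : (k.*2.+1 < z)%N. Proof. by rewrite /nkinds; lia. Qed.
Let kz' : (k.*2 < z)%N. Proof. by rewrite /nkinds; lia. Qed.
Variable rr : R.

Lemma cumS j0 j : cum j0 j.+1 = (cum j0 j + bucket_size (j0 + j))%N.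
Proof. by rewrite /cum big_ord_recr. Qed.

Lemma cum_mono j0 j j' : (j <= j')%N -> (cum j0 j <= cum j0 j')%N.
Proof.
move=> /subnK <-; elim: (j' - j)%N => // t IH.
by rewrite addSn cumS; apply: leq_trans IH (leq_addr _ _).
Qed.

(** A position [u] in the concatenation of the [L] buckets, read as a table and an entry of its
    bucket: a uniform [u] picks every colliding pair with the same probability. *)
Definition located (j0 : nat) (lo : nat -> nat) (u j : nat) (p : 'I_n) : Prop :=
  [/\ (j < L)%N, (cum j0 j <= u < cum j0 j.+1)%N
    & exists y : 'I_n, (y = lo j + (u - cum j0 j) :> nat)%N /\ p = pi (j0 + j) y].

Lemma pick_point_spec : exists N, forall s j0 lo, same_but_scratch (st_mem s) ->
    buckets_stored j0 L lo (st_mem s) ->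
    wreg s 1 = n -> wreg s 3 = L -> wreg s 16 = j0 -> (j0 + L <= A * L)%N ->
    (wreg s 19 < cum j0 L)%N ->
  exists s' j p, [/\ runs N (pick_point k i) s s',
     regs_frame [:: 9%N; 11%N; 12%N; 13%N; 14%N; 15%N; 21%N; 22%N] [::] s s',
     memtop s' = memtop s, (st_time s' <= st_time s + 100 * (lg L).+1)%N
   & [/\ located j0 lo (wreg s 19) j p, wreg s' 15 = j, wreg s' 11 = p,
       wreg s' 21 = 0%N & wreg s' 22 = 0%N]].
Proof.
have [bW1 bW2 bW3 bW4] := small_lt.
pose cond : bexp R := BNot (WLt R (WReg 19) (WGet (cum_cell k (WReg 14)))).
have [//|//|//|//|//|N HN] := @bsearch_spec R M d lsh n S W (Some x0) 1 [::] [::] 1 20 L 3 Skip cond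
  _ _ _ _ bW3 _.
rewrite /pick_point -/cond; set c2 := Seq (SetW R 15 _) _.
exists (maxn N (csize c2)).+1 => s j0 lo sm st s1 s3 s16 j0L uT.
set u := wreg s 19 in uT *.
have [//|||s' [r fr mt tm [le hz]]] := HN s (fun j => cum j0 j <= u)%N.
- by move=> x y xy yL; apply: leq_trans; exact: cum_mono.
- move=> s2 x fr mt e14 xL; exists (tick 1 s2); split=> //.
    by case.
  have xz : (x * z + z < W)%N by apply: cell_lt; lia.
  have [_ hc _] := st _ xL.
  rewrite /= e14 (proj1 fr 19%N)// (memtop_mem mt); nomod.
  by rewrite hc -leqNgt.
(* Index 0 always passes the test, its cumulated size being 0. The last passing index is the table
   sought, hence the predecessor. *)
have z0 : (0 < wreg s' 12)%N by rewrite -hz// /cum big_ord0.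
set j := (wreg s' 12).-1.
have e12 : wreg s' 12 = j.+1 by rewrite /j prednK.
have jL : (j < L)%N by rewrite -e12.
have ju : (cum j0 j <= u < cum j0 j.+1)%N.
  rewrite (hz j jL) e12 leqnn /=.
  have [jl|jl] := leqP L j.+1; first by apply: leq_trans uT (cum_mono _ _); lia.
  by rewrite ltnNge hz// e12 ltnn.
have [b1 b2 [b3 b4]] := st _ jL.
have yn : (lo j + (u - cum j0 j) < n)%N by move: ju; rewrite cumS; lia.
have hJ : (j0 + j < A * L)%N by lia.
have [f1 f2 f3] := table_index_lt hJ yn.
have jz : (j * z + z < W)%N by apply: cell_lt; lia.
have iz : (i.*2.+1 < z)%N by rewrite /nkinds; lia.
exists (sexec c2 s'), j, (pi (j0 + j)%N (Ordinal yn)); split.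
- by apply: runs_seq; [exact: r|rst].
- by apply: regs_frame_trans fr (sexec_frame d S W (Some x0) c2 s') _ _ _ _.
- by rewrite sexec_memtop.
- have := sexec_time d S W (Some x0) c2 s'; move: tm; set X := st_time (sexec _ _).
  by rewrite /=; lia.
- have m1 := memtop_mem mt.
  have e15 : wreg (sexec c2 s') 15 = j by rewrite /= /upd/= e12; nomod; rewrite subn1.
  split=> //.
  + by split=> //; exists (Ordinal yn).
  + rewrite /= /upd/= e12 (proj1 fr 16%N)// s16 (proj1 fr 1%N)// s1 (proj1 fr 19%N)// m1.
    rewrite (_ : 1 %% W = 1)%N; last by rewrite modn_small; lia.
    rewrite subn1 /=; rewrite (@modn_small j W); last lia.
    nomod; rewrite b1 b2 -/u; nomod.
    exact: (table_same (Ordinal yn) sm hJ).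
  + by rewrite /= /upd/= mod0n.
  + by rewrite /= /upd/= mod0n.
Qed.

Definition back (j0 j t : nat) : nat := (j0 + (j + L - t) %% L)%N.

Definition accepts (j0 j : nat) (p : 'I_n) (U : nat) : bool :=
  [forall t : 'I_L, (0 < t <= U)%N ==> ~~ coll (back j0 j t) p].

Definition near_pt (p : 'I_n) : bool := mdist (S p) x0 <= rr.

Definition trial_time : nat := (2 * hash_time d K + 100 * (lg L).+1 + d + 200)%N.

(** The last table scanned is the only one that may collide, hence the strict bound in the final
    conjunct; this is the form that [accepts_prefix] takes. *)
Lemma scan_spec : exists N, forall s j0 j (p : 'I_n) U, same_but_scratch (st_mem s) ->
    wreg s 2 = K -> wreg s 3 = L -> wreg s 16 = j0 -> (j0 + L <= A * L)%N ->
    wreg s 15 = j -> (j < L)%N -> wreg s 11 = p -> wreg s 20 = U -> (U < L)%N ->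
    wreg s 21 = 0%N -> wreg s 22 = 0%N ->
  exists s', [/\ runs N (While (scan_guard (R:=R)) (scan_step k i)) s s',
     regs_frame [:: 9%N; 10%N; 21%N; 22%N] [:: 0%N; 1%N] s s', memtop s' = memtop s,
     (st_time s' <= st_time s + (2 * hash_time d K + 60) * wreg s' 21 + 20)%N
   & [/\ (wreg s' 21 <= U)%N, wreg s' 22 = ~~ accepts j0 j p U :> nat
       & forall t, (0 < t < wreg s' 21)%N -> ~~ coll (back j0 j t) p]].
Proof.
have [bW1 bW2 bW3 bW4] := small_lt.
have [|N1 H1] := @eval_hash_spec R M d lsh n S W (Some x0) k i K Query K_gt0 ik zW.
  by left.
have [|N2 H2] := @eval_hash_spec R M d lsh n S W (Some x0) k i K (Data (WReg 11)) K_gt0 ik zW.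
  by right.
rewrite /scan_step; set c1 := Seq (incr 21) _; set c3 := SetR 1 _; set c5 := If _ _ _.
eexists => s j0 j p U sm s2 s3 s16 j0L s15 jL s11 s20 UL s21 s22.
set ws := [:: 9%N; 10%N; 21%N; 22%N]; set rs := [:: 0%N; 1%N].
pose I s1 := [/\ regs_frame ws rs s s1, memtop s1 = memtop s, (wreg s1 21 <= U)%N,
   (st_time s1 <= st_time s + (2 * hash_time d K + 60) * wreg s1 21)%N
 & (forall t, (0 < t < wreg s1 21)%N -> ~~ coll (back j0 j t) p) /\
   wreg s1 22 = (if wreg s1 21 == 0%N then false else coll (back j0 j (wreg s1 21)) p) :> nat].
have step t : I t -> beval t (scan_guard (R:=R)) -> exists t',
    [/\ runs (maxn (csize c1) (maxn N1 (maxn 1 (maxn N2 (csize c5)).+1).+1).+1).+1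
         (Seq c1 (Seq (eval_hash k i Query) (Seq c3 (Seq (eval_hash k i (Data (WReg 11))) c5))))
         (tick (bcost (scan_guard (R:=R))).+1 t) t', I t' & (U - wreg t' 21 < U - wreg t 21)%N].
  move=> [fr mt le tm [hn e22]] /andP[]; rewrite /= (proj1 fr 20%N)// s20 => lt.
  rewrite modn_small; last lia; rewrite ltnS leqn0 => /eqP f22.
  (* The guard holds with register 22 equal to 0, so the table scanned last did not collide
     either. *)
  have hn' t' : (0 < t' < (wreg t 21).+1)%N -> ~~ coll (back j0 j t') p.
    move=> /andP[t0]; rewrite ltnS leq_eqVlt => /orP[/eqP e|lt']; last by apply: hn; rewrite t0.
    by move: e22; rewrite f22 -e; move: t0; case: (t') => //= t'' _; case: coll.
  set t0 := tick _ t.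
  have fr1 := sexec_frame d S W (Some x0) c1 t0.
  have tm1 := sexec_time d S W (Some x0) c1 t0.
  have mt1 : memtop (sexec c1 t0) = memtop s by rewrite sexec_memtop.
  have e21 : wreg (sexec c1 t0) 21 = (wreg t 21).+1.
    by rewrite /= /upd/=; nomod; lia.
  have e9 : wreg (sexec c1 t0) 9 = back j0 j (wreg t 21).+1.
    have bl : ((j + L - (wreg t 21).+1) %% L < L)%N by rewrite ltn_mod.
    rewrite /= /upd/= (proj1 fr 16%N)// (proj1 fr 15%N)// (proj1 fr 3%N)// s16 s15 s3.
    rewrite (@modn_small 1 W); last lia.
    rewrite addn1 (@modn_small (wreg t 21).+1 W); last lia.
    rewrite (@modn_small (j + L) W); last lia.
    rewrite (@modn_small (j + L - _) W); last lia.
    rewrite (@modn_small (_ %% L) W); last lia.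
    by rewrite modn_small//; lia.
  have fr1' : regs_frame ws rs s (sexec c1 t0) by apply: regs_frame_trans fr fr1 _ _ _ _.
  have hJ : (back j0 j (wreg t 21).+1 < A * L)%N.
    have bl : ((j + L - (wreg t 21).+1) %% L < L)%N by rewrite ltn_mod.
    by rewrite /back; lia.
  have r1 : runs (csize c1) c1 t0 (sexec c1 t0) by rst.
  have w22 : wreg (sexec c1 t0) 22 = 0%N by rewrite (proj1 fr1 22%N).
  move: (sexec c1 t0) fr1' tm1 mt1 e21 e9 r1 w22 => t1 {}fr1 tm1 mt1 e21 e9 r1 w22.
  have [||||t2 [r2 fr2 mt2 tm2 rv2]] := H1 t1 (back j0 j (wreg t 21).+1) x0.
  - by rewrite (proj1 fr1 2%N).
  - by [].
  - exact: hash_index_lt.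
  - by [].
  have fr3 := sexec_frame d S W (Some x0) c3 t2.
  have tm3 := sexec_time d S W (Some x0) c3 t2.
  have mt3 : memtop (sexec c3 t2) = memtop t2 by [].
  have rv3 : rreg (sexec c3 t2) 1 = th (back j0 j (wreg t 21).+1) x0.
    by rewrite /= /upd/= rv2 (memtop_mem mt1) (table_hash_same sm).
  have r3 : runs 1 c3 t2 (sexec c3 t2) by rst.
  move: (sexec c3 t2) fr3 tm3 mt3 rv3 r3 => t3 fr3 tm3 mt3 rv3 r3.
  have mt3s : memtop t3 = memtop s by rewrite mt3 mt2 mt1.
  have [||||t4 [r4 fr4 mt4 tm4 rv4]] := H2 t3 (back j0 j (wreg t 21).+1) (S p).
  - by rewrite (proj1 fr3 2%N)// (proj1 fr2 2%N)// (proj1 fr1 2%N).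
  - by rewrite (proj1 fr3 9%N)// (proj1 fr2 9%N).
  - exact: hash_index_lt.
  - apply: peval_data; by rewrite (proj1 fr3 11%N)// (proj1 fr2 11%N)// (proj1 fr1 11%N).
  have g4 : regs_frame ws rs s t4.
    have g2 : regs_frame ws rs s t2 by apply: regs_frame_trans fr1 fr2 _ _ _ _.
    have g3 : regs_frame ws rs s t3 by apply: regs_frame_trans g2 fr3 _ _ _ _.
    by apply: regs_frame_trans g3 fr4 _ _ _ _.
  have h21 : wreg t4 21 = (wreg t 21).+1.
    by rewrite (proj1 fr4 21%N)// (proj1 fr3 21%N)// (proj1 fr2 21%N).
  have h22 : wreg t4 22 = 0%N.
    by rewrite (proj1 fr4 22%N)// (proj1 fr3 22%N)// (proj1 fr2 22%N).
  have hc : (rreg t4 0 <= rreg t4 1) && (rreg t4 1 <= rreg t4 0) = coll (back j0 j (wreg t 21).+1) p.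
    by rewrite rv4 (proj2 fr4 1%N)// rv3 (memtop_mem mt3s) (table_hash_same sm) /coll -eq_le.
  have i21 : wreg (sexec c5 t4) 21 = (wreg t 21).+1 by rewrite /=; case: ifP => _ /=; rewrite /upd.
  exists (sexec c5 t4); split.
  - apply: runs_seq; first exact: r1.
    apply: runs_seq; first exact: r2.
    apply: runs_seq; first exact: r3.
    by apply: runs_seq; [exact: r4|rst].
  - split.
    + by apply: regs_frame_trans g4 (sexec_frame d S W (Some x0) c5 t4) _ _ _ _.
    + by rewrite sexec_memtop// mt4.
    + by rewrite i21.
    + have := sexec_time d S W (Some x0) c5 t4; rewrite i21; set X := st_time (sexec _ _).
      by move: tm tm1 tm2 tm3 tm4; rewrite /t0 /= mulnS; lia.
    + rewrite i21; split; first exact: hn'.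
      by rewrite /= hc; case: coll => /=; rewrite /upd/= ?modn_small//; lia.
  - by rewrite i21; lia.
have I0 : I s by split=> //; rewrite ?s21 ?s22 ?muln0 ?addn0//; split=> // t; lia.
have V0 : (U - wreg s 21 <= L)%N by lia.
have [t [r [fr mt le tm [hn e22]] gf]] := runs_while step I0 V0.
exists (tick (bcost (scan_guard (R:=R))).+1 t); split=> //.
- exact: r.
- by move: tm => /=; lia.
split=> //.
move: gf; rewrite /= (proj1 fr 20%N)// s20 negb_and -!leqNgt (@modn_small 1 W); last lia.
case: (posnP (wreg t 21)) => [t0|tgt0].
  rewrite e22 t0 /= orbF leqn0 => /eqP U0.
  suff -> : accepts j0 j p U by [].
  by apply/forallP => t1; apply/implyP; rewrite U0; lia.
rewrite e22 (gtn_eqF tgt0); case: (boolP (coll _ p)) => cl /= gd.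
  suff -> : accepts j0 j p U = false by [].
  apply/negbTE/forallPn; have tL : (wreg t 21 < L)%N by lia.
  by exists (Ordinal tL) => /=; rewrite tgt0 le /= cl.
suff -> : accepts j0 j p U by [].
have eU : wreg t 21 = U by move: gd; rewrite orbF; lia.
apply/forallP => t1; apply/implyP => /andP[t10]; rewrite leq_eqVlt => /orP[/eqP e|lt].
  by rewrite e -eU.
by apply: hn; rewrite t10 eU.
Qed.



Lemma settle_spec : exists N, forall s j0 j (p : 'I_n) U, same_but_scratch (st_mem s) ->
    wreg s 2 = K -> wreg s 3 = L -> wreg s 16 = j0 -> (j0 + L <= A * L)%N ->
    wreg s 15 = j -> (j < L)%N -> wreg s 11 = p -> wreg s 20 = U -> (U < L)%N ->
    wreg s 21 = 0%N -> wreg s 22 = 0%N -> wreg s 0 = 0%N -> (wreg s 24 < W)%N ->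
  exists s' t, [/\ runs N (settle k i rr) s s',
     regs_frame [:: 0%N; 9%N; 10%N; 21%N; 22%N; 24%N] [:: 0%N; 1%N] s s', memtop s' = memtop s,
     (st_time s' <= st_time s + (2 * hash_time d K + 60) * t + d + 100)%N
   & [/\ wreg s' 0 = (if near_pt p && accepts j0 j p U then p.+1 else 0%N),
       wreg s' 24 = (wreg s 24 - t.+1)%N /\ wreg s' 21 = t, (t <= U)%N, (0 < t)%N -> near_pt p
       & forall t', (0 < t' < t)%N -> ~~ coll (back j0 j t') p]].
Proof.
have [N HN] := scan_spec; have [bW1 bW2 bW3 bW4] := small_lt.
rewrite /settle; set c2 := If _ (SetW R 0 _) _; set c3 := SetW R 24 _; set b := RLe _ _.
eexists => s j0 j p U sm s2 s3 s16 j0L s15 jL s11 s20 UL s21 s22 s0 s24.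
have bE : beval s b = near_pt p by rewrite /= s11 valK.
have [np|nn] := boolP (near_pt p).
  set s1 := tick (bcost b).+1 s.
  have [//|//|//|//|//|//|//|//|//|//|//|//|s' [r fr mt tm [le e22 hn]]] := HN s1 j0 j p U.
  have p24 : wreg s' 24 = wreg s 24 by rewrite (proj1 fr 24%N).
  have pW : (p < n)%N by [].
  have q21 : wreg (sexec c2 s') 21 = wreg s' 21 by rewrite /=; case: ifP => _ /=; rewrite /upd.
  have q24 : wreg (sexec c2 s') 24 = wreg s' 24 by rewrite /=; case: ifP => _ /=; rewrite /upd.
  have q0 : wreg (sexec c2 s') 0 = if accepts j0 j p U then p.+1 else 0%N.
    rewrite /= e22 (@modn_small 1 W); last lia.
    case: accepts; rewrite /= /upd/=; last by rewrite (proj1 fr 0%N).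
    by rewrite (proj1 fr 11%N)//= s11; nomod; lia.
  have frA : regs_frame [:: 0%N; 9%N; 10%N; 21%N; 22%N] [:: 0%N; 1%N] s (sexec c2 s').
    by apply: regs_frame_trans fr (sexec_frame d S W (Some x0) c2 s') _ _ _ _.
  exists (sexec c3 (sexec c2 s')), (wreg s' 21); split.
  - apply: runs_seq; last rst.
    apply: (@runs_mono _ _ _ _ _ _ _ _ (maxn N (csize c2)).+2); last first.
      by apply: runs_if; rewrite bE np; apply: runs_seq; [exact: r|rst].
    exact: leq_addr 1 _.
  - by apply: regs_frame_trans frA (sexec_frame d S W (Some x0) c3 _) _ _ _ _.
  - by rewrite !sexec_memtop.
  - have := sexec_time d S W (Some x0) c3 (sexec c2 s').
    have := sexec_time d S W (Some x0) c2 s'.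
    move: tm; rewrite /s1; set X := st_time (sexec c3 _); set Y := st_time (sexec c2 _).
    by rewrite /=; lia.
  - split=> //; split=> //.
      rewrite -[LHS]/((wreg (sexec c2 s') 24 - ((wreg (sexec c2 s') 21 + 1 %% W) %% W)) %% W)%N.
      by rewrite q21 q24 p24; nomod; rewrite addn1.
exists (sexec c3 (tick (bcost b).+2 s)), 0%N; split.
- apply: runs_seq; last rst.
  apply: (@runs_mono _ _ _ _ _ _ _ _ 2); last first.
    apply: runs_if; rewrite bE (negbTE nn) => -[//|f] k0 _ /=.
    by congr (k0 _); rewrite /tick /= addnAC -addnA addn1.
  by [].
- by apply: regs_frame_sub (sexec_frame d S W (Some x0) c3 (tick (bcost b).+2 s)) _ _.
- by rewrite sexec_memtop.
- have := sexec_time d S W (Some x0) c3 (tick (bcost b).+2 s); set X := st_time (sexec c3 _).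
  by rewrite /=; lia.
- split=> //.
  + by split=> //; rewrite /= /upd/= s21; nomod.
  + by move=> t'; lia.
Qed.

Lemma trial_core_spec : exists N, forall s j0 lo U, same_but_scratch (st_mem s) ->
    buckets_stored j0 L lo (st_mem s) ->
    wreg s 1 = n -> wreg s 2 = K -> wreg s 3 = L -> wreg s 16 = j0 -> (j0 + L <= A * L)%N ->
    (wreg s 19 < cum j0 L)%N -> wreg s 20 = U -> (U < L)%N ->
    wreg s 0 = 0%N -> (wreg s 24 < W)%N ->
  exists s' j p t, [/\ runs N (Seq (pick_point k i) (settle k i rr)) s s',
     regs_frame [:: 0%N; 9%N; 10%N; 11%N; 12%N; 13%N; 14%N; 15%N; 21%N; 22%N; 24%N]
       [:: 0%N; 1%N] s s', memtop s' = memtop s,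
     (st_time s' <= st_time s + trial_time * t.+1)%N
   & [/\ located j0 lo (wreg s 19) j p,
       wreg s' 0 = (if near_pt p && accepts j0 j p U then p.+1 else 0%N),
       wreg s' 24 = (wreg s 24 - t.+1)%N /\ wreg s' 21 = t, (t <= U)%N /\ ((0 < t)%N -> near_pt p)
       & forall t', (0 < t' < t)%N -> ~~ coll (back j0 j t') p]].
Proof.
have [N1 H1] := pick_point_spec; have [N2 H2] := settle_spec.
eexists => s j0 lo U sm st s1 s2 s3 s16 j0L uT s20 UL s0 s24.
have [//|//|//|//|//|//|//|s' [j [p [r1 fr1 mt1 tm1 [loc e15 e11 e21 e22]]]]] := H1 s j0 lo.
have [jL _ _] := loc.
have [||||||||||||||s'' [t [r2 fr2 mt2 tm2 [h1 h2 h3 h4 h5]]]] := H2 s' j0 j p U.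
- by rewrite (memtop_mem mt1).
- by rewrite (proj1 fr1 2%N).
- by rewrite (proj1 fr1 3%N).
- by rewrite (proj1 fr1 16%N).
- by [].
- by [].
- by [].
- by [].
- by rewrite (proj1 fr1 20%N).
- by [].
- by [].
- by [].
- by rewrite (proj1 fr1 0%N).
- by rewrite (proj1 fr1 24%N).
exists s'', j, p, t; split=> //.
- by apply: runs_seq; [exact: r1|exact: r2].
- by apply: regs_frame_trans fr1 fr2 _ _ _ _.
- by rewrite mt2.
- have : ((2 * hash_time d K + 60) * t <= trial_time * t)%N.
    by rewrite leq_mul2r /trial_time; apply/orP; right; lia.
  by rewrite mulnS {2}/trial_time; lia.
- by split=> //; rewrite (proj1 h2) (proj1 fr1 24%N) ?(proj2 h2).
Qed.

End buckets.

(** * Law of a trial *)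

Lemma first_unique (L : nat) (D : 'I_L -> bool) : (exists x, D x) ->
  (\sum_(U < L) (D U && [forall x : 'I_L, (x < U)%N ==> ~~ D x]) = 1)%N.
Proof.
move=> [x0 Dx0]; case: (@arg_minnP _ x0 D (fun x : 'I_L => x : nat)) => // U DU minU.
rewrite (bigD1 U)//= big1 ?addn0 => [|V VU].
  rewrite DU; case: forallP => // -[] x; apply/implyP => xU; apply/negP => /minU.
  by rewrite leqNgt xU.
case: (boolP (D V)) => //= DV; case: forallP => // /(_ U) /implyP h.
have UV : (U < V)%N.
  by rewrite ltn_neqAle minU// andbT; apply: contraNneq VU => e; apply/eqP/val_inj.
by have := h UV; rewrite DU.
Qed.

(* The pair (j, U) is sent to the table j - U modulo L: each table sigma is the
   image of exactly one accepted pair, whose j is the first collision at or after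
   sigma in cyclic order. *)
Lemma accepts_count (L : nat) (C : nat -> bool) : (exists2 j, (j < L)%N & C j) ->
  (\sum_(j < L) \sum_(U < L)
     (C j && [forall t : 'I_L, (0 < t <= U)%N ==> ~~ C ((j + L - t) %% L)%N]) = L)%N.
Proof.
case: L => [[]//|L] [j0 j0L Cj0].
rewrite exchange_big/=.
under eq_bigr => U _ do rewrite (reindex_inj (addIr U))/=.
rewrite exchange_big/= -[RHS]card_ord -sum1_card; apply: eq_bigr => sg _.
pose D (x : 'I_L.+1) := C (val (sg + x)).
transitivity (\sum_(U < L.+1) (D U && [forall x : 'I_L.+1, (x < U)%N ==> ~~ D x]))%N.
  apply: eq_bigr => U _; congr (nat_of_bool (_ && _)).
  apply/forallP/forallP => h x; apply/implyP => hx.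
    have tP : (U - x < L.+1)%N by have := ltn_ord U; lia.
    have c : (0 < U - x <= U)%N by lia.
    have := implyP (h (Ordinal tP)) c; rewrite /D /=.
    suff -> : (((sg + U) %% L.+1 + L.+1 - (U - x)) %% L.+1 = (sg + x) %% L.+1)%N by [].
    rewrite -addnBA; last by have := ltn_ord U; lia.
    rewrite modnDml; apply/eqP; rewrite -(eqn_modDr (U - x)%N).
    rewrite -addnA subnK; last by have := ltn_ord U; lia.
    by rewrite modnDr -[X in _ == X %[mod _]]addnA subnKC// ltnW.
  have xU : (U - x < L.+1)%N by have := ltn_ord U; lia.
  have c : (U - x < U)%N by lia.
  have := implyP (h (Ordinal xU)) c; rewrite /D /=; suff -> : ((sg + (U - x)) %% L.+1 = ((sg + U) %% L.+1 + L.+1 - x) %% L.+1)%N by [].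
  rewrite -addnBA; last by have := ltn_ord x; lia.
  rewrite modnDml; apply/eqP; rewrite -(eqn_modDr x).
  rewrite -[X in _ == X %[mod _]]addnA subnK; last by have := ltn_ord x; lia.
  by rewrite -addnA subnK ?modnDr//; lia.
apply: first_unique; exists (Ordinal j0L - sg); rewrite /D.
by rewrite addrC subrK.
Qed.

(** Bounds the length [t] of a scan by the number of thresholds that accept the same pair. That
    number does not depend on the threshold [U] actually drawn, and [accepts_count] evaluates its
    sum over the tables where a point collides. *)
Lemma accepts_prefix (L : nat) (C : nat -> bool) (j U t : nat) : (t <= U)%N -> (U < L)%N ->
  (forall t', (0 < t' < t)%N -> ~~ C ((j + L - t') %% L)%N) ->
  (t <= \sum_(V < L) [forall t : 'I_L, (0 < t <= V)%N ==> ~~ C ((j + L - t) %% L)%N])%N.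
Proof.
move=> tU UL h.
rewrite -[leqLHS]card_ord -sum1_card (big_ord_widen L (fun=> 1%N)); last lia.
rewrite [leqRHS](bigID (fun V : 'I_L => (V < t)%N))/=; apply: leq_trans (leq_addr _ _).
apply: leq_sum => V Vt; suff -> : [forall t0 : 'I_L, (0 < t0 <= V)%N ==> ~~ C ((j + L - t0) %% L)%N] by [].
by apply/forallP => t0; apply/implyP => /andP[t00 t0V]; apply: h; lia.
Qed.

Section trial_law.
Context {R : realType} {M : metricType R}.
Variables (d : nat) (lsh : R -> R -> hash_family R M).
Variables (n : nat) (S : 'I_n -> M) (W : nat) (x0 : M).

Local Notation state := (state R M).
Local Notation runs := (runs d lsh S W (Some x0)).
Local Notation yields := (yields d lsh S W (Some x0)).

Variables (k i K L A : nat) (m0 : memory R M).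
Hypotheses (ik : (i < k)%N) (K_gt0 : (0 < K)%N) (L_gt0 : (0 < L)%N).
Hypotheses (A_gt0 : (0 < A)%N) (n_gt0 : (0 < n)%N).
Hypothesis HW : ((A * L * (K + n) + L + 3) * nkinds k < W)%N.
Variable pi : nat -> {perm 'I_n}.
Hypothesis tables : forall J, (J < A * L)%N -> table_sorted S k i K m0 J (pi J).
Variable rr : R.

Local Notation same_but_scratch := (same_but_scratch k L m0).
Local Notation coll := (coll S x0 k i K m0).
Local Notation cum := (cum S x0 k i K m0).
Local Notation bucket_size := (bucket_size S x0 k i K m0).
Local Notation bucket_at := (bucket_at S x0 k i K m0 pi).
Local Notation buckets_stored := (buckets_stored S x0 k i K m0 pi).
Local Notation located := (located S x0 k i K L m0 pi).
Local Notation accepts := (accepts S x0 k i K L m0).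
Local Notation near_pt := (near_pt S x0 rr).
Local Notation trial_time := (trial_time d K L).

Lemma located_inj j0 lo u j j' p p' : located j0 lo u j p -> located j0 lo u j' p' ->
  j = j' /\ p = p'.
Proof.
move=> [jL /andP[h1 h2] [y [hy ->]]] [jL' /andP[h1' h2'] [y' [hy' ->]]].
have jj' : j = j'.
  apply/eqP; rewrite eqn_leq; apply/andP; split; rewrite leqNgt; apply/negP => lt.
    by have := @cum_mono _ _ n S x0 k i K m0 j0 _ _ lt; lia.
  by have := @cum_mono _ _ n S x0 k i K m0 j0 _ _ lt; lia.
by rewrite -jj' in hy' *; split=> //; congr (pi _ _); apply: val_inj => /=; rewrite hy hy'.
Qed.

(** Change of variables from positions to pairs of a table and a colliding point. The inequality
    serves as it is for expected costs and, applied with both signs, for exact probabilities. *)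
Lemma sum_located_le j0 lo (m : memory R M) (F : nat -> R) (G : nat -> 'I_n -> R) :
  buckets_stored j0 L lo m ->
  (forall u, (u < cum j0 L)%N -> exists j p, located j0 lo u j p /\ F u <= G j p) ->
  \sum_(u < cum j0 L) F u <= \sum_(j < L) \sum_(p | coll (j0 + j) p) G j p.
Proof.
move=> st hF.
rewrite -(big_mkord xpredT F).
have split1 l : \sum_(0 <= u < cum j0 l) F u =
    \sum_(j < l) \sum_(y < bucket_size (j0 + j)) F (cum j0 j + y)%N.
  elim: l => [|l IH]; first by rewrite {1}/cum big_ord0 big_geq// big_ord0.
  rewrite (@big_cat_nat _ _ _ (cum j0 l))//=; last exact: cum_mono.
  rewrite IH big_ord_recr/=; congr (_ + _).
  by rewrite cumS -{1}[cum j0 l]add0n big_addn addKn big_mkord; apply: eq_bigr => y _; rewrite addnC.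
rewrite split1; apply: ler_sum => j _.
have [_ _ [hn hb]] := st j (ltn_ord j).
have -> : \sum_(p | coll (j0 + j) p) G j p =
    \sum_(y < bucket_size (j0 + j)) G j (pi (j0 + j)%N (insubd (Ordinal n_gt0) (lo j + y)%N)).
  rewrite (reindex_inj (@perm_inj _ (pi (j0 + j)%N)))/=.
  under eq_bigl => y do rewrite -hb.
  pose H y := G j (pi (j0 + j)%N (insubd (Ordinal n_gt0) y)).
  rewrite (eq_bigr (fun y : 'I_n => H y)); last by move=> y _; rewrite /H; congr (G j (pi _ _)); rewrite valKd.
  rewrite -(big_mkord (fun y => (lo j <= y < lo j + bucket_size (j0 + j))%N) H).
  rewrite (@big_cat_nat _ _ _ (lo j + bucket_size (j0 + j)) 0 n)//=.
  rewrite (@big_cat_nat _ _ _ (lo j) 0 (lo j + _))//= ?leq_addr//.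
  rewrite big_nat_cond big_pred0 ?add0r; last by move=> y; lia.
  rewrite [X in _ + X](_ : _ = 0) ?addr0; last by rewrite big_nat_cond big_pred0// => y; lia.
  rewrite big_nat_cond (eq_bigl (fun y => (lo j <= y < lo j + bucket_size (j0 + j))%N && true)); last by move=> y; lia.
  rewrite -big_nat_cond -{1}[lo j]add0n big_addn addKn big_mkord.
  by apply: eq_bigr => y _; rewrite addnC.
apply: ler_sum => y _.
have uT : (cum j0 j + y < cum j0 L)%N.
  apply: (@leq_trans (cum j0 j.+1)); last exact: cum_mono.
  by rewrite cumS ltn_add2l.
have yn : (lo j + y < n)%N by have := ltn_ord y; lia.
have [j' [p' [loc le]]] := hF _ uT.
have loc2 : located j0 lo (cum j0 j + y) j (pi (j0 + j)%N (Ordinal yn)).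
  split=> //; first by rewrite cumS leq_addr ltn_add2l /=.
  by exists (Ordinal yn); rewrite /= addKn.
have [jj' pp'] := located_inj loc loc2; rewrite jj' pp' in le.
apply: le_trans le _; rewrite le_eqVlt; apply/orP; left; apply/eqP; congr (G j (pi _ _)).
by apply: val_inj; rewrite val_insubd /= yn.
Qed.

Lemma sum_located j0 lo (m : memory R M) (F : nat -> R) (G : nat -> 'I_n -> R) :
  buckets_stored j0 L lo m ->
  (forall u, (u < cum j0 L)%N -> exists j p, located j0 lo u j p /\ F u = G j p) ->
  \sum_(u < cum j0 L) F u = \sum_(j < L) \sum_(p | coll (j0 + j) p) G j p.
Proof.
move=> st hF; apply/eqP; rewrite eq_le; apply/andP; split.
  apply: sum_located_le st _ => u /hF[j [p [loc ->]]]; by exists j, p.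
rewrite -lerN2 -!sumrN; under [leRHS]eq_bigr do rewrite -sumrN.
apply: (@sum_located_le _ _ _ (fun u => - F u) (fun j p => - G j p) st) => u /hF[j [p [loc ->]]].
by exists j, p.
Qed.

Definition trial_ws : seq nat :=
  [:: 0; 9; 10; 11; 12; 13; 14; 15; 19; 20; 21; 22; 24]%N.

(** The time is charged to the same number of units as the budget, so that the budget controls the
    running time. *)
Definition trial_post (s s' : state) : Prop :=
  [/\ regs_frame trial_ws [:: 0%N; 1%N] s s', memtop s' = memtop s,
      (st_time s' <= st_time s + (trial_time + 4) * (wreg s' 21).+1)%N,
      (wreg s' 21 < L)%N /\ wreg s' 24 = (wreg s 24 - (wreg s' 21).+1)%N
    & wreg s' 0 = 0%N \/ exists2 p : 'I_n, near_pt p & wreg s' 0 = p.+1].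

Definition covered (j0 : nat) : Prop :=
  forall p, near_pt p -> exists2 j, (j < L)%N & coll (j0 + j) p.

Definition near_count : nat := #|[set p | near_pt p]%SET|.

(** Of the [T * L] equally likely pairs of draws exactly [L] return a given near point, by
    [accepts_count]: hence the probability 1 / T, the same for all points. For the expected cost,
    [accepts_prefix] replaces scan lengths by numbers of accepting thresholds, which again sum to
    [L] for each near point. *)
Lemma trial_spec : exists N, forall s j0 lo, same_but_scratch (st_mem s) ->
    buckets_stored j0 L lo (st_mem s) ->
    wreg s 1 = n -> wreg s 2 = K -> wreg s 3 = L -> wreg s 16 = j0 -> (j0 + L <= A * L)%N ->
    wreg s 18 = cum j0 L -> (0 < cum j0 L)%N -> wreg s 0 = 0%N -> (wreg s 24 < W)%N ->
  exists mu, [/\ yields N (trial k i rr) s mu, supported (trial_post s) mu,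
     forall o, (forall p : 'I_n, near_pt p -> o != p.+1) -> o != 0%N ->
       wsum mu (fun s' => (wreg s' 0 == o)%:R) = 0,
     covered j0 -> forall p, near_pt p ->
       wsum mu (fun s' => (wreg s' 0 == p.+1)%:R) = (cum j0 L)%:R^-1
   & covered j0 ->
       wsum mu (fun s' => (wreg s' 0 == 0%N)%:R) = 1 - near_count%:R / (cum j0 L)%:R /\
       wsum mu (fun s' => (wreg s' 21).+1%:R) <= 1 + near_count%:R * L%:R / (cum j0 L)%:R].
Proof.
have [N HN] := trial_core_spec d lsh x0 ik K_gt0 L_gt0 A_gt0 n_gt0 HW tables rr.
exists N.+4 => s j0 lo sm st s1 s2 s3 s16 j0L s18 T0 s0 s24.
set T := cum j0 L in s18 T0 *.
pose su u U := set_wreg 20 U (tick 2 (set_wreg 19 u (tick 2 s))).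
pose P (x : nat * nat) s' := (x.1 < T)%N -> (x.2 < L)%N -> exists j p,
  [/\ runs N (Seq (pick_point k i) (settle k i rr)) (su x.1 x.2) s', trial_post s s',
      located j0 lo x.1 j p,
      wreg s' 0 = (if near_pt p && accepts j0 j p x.2 then p.+1 else 0%N)
    & (wreg s' 21 <= x.2)%N /\
      ((0 < wreg s' 21)%N -> near_pt p) /\
      forall t', (0 < t' < wreg s' 21)%N -> ~~ coll (back L j0 j t') p].
(* Once both draws are fixed the trial is deterministic, so its final state can be chosen as a
   function of the pair. *)
have /boolp.choice[F HF] : forall x, exists s', P x s'.
  move=> [u U]; have [uT|uT] := ltnP u T; last by exists s; rewrite /P /= ltnNge uT.
  have [UL|UL] := ltnP U L; last by exists s => _; rewrite /= ltnNge UL.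
  have [//|//|//|//|//|//|//|//|//|//|//|//|s' [j [p [t [r fr mt tm [loc a0 [a24 a21] [tU np] hn]]]]]] := HN (su u U) j0 lo U.
  exists s' => _ _ /=; exists j, p; rewrite a21; split=> //.
  split=> //.
  - have fr0 : regs_frame [:: 19%N; 20%N] [::] s (su u U).
      split=> // x; rewrite !inE negb_or => /andP[/negbTE e1 /negbTE e2].
      by rewrite /su /= /upd e2 e1.
    by apply: regs_frame_trans fr0 fr _ _ _ _.
  - by apply: leq_trans tm _; rewrite a21 /= mulnDl; lia.
  - by rewrite a21; split=> //; lia.
  - by rewrite a0; case: ifP => [/andP[np' _]|_]; [right; exists p|left].
exists (duniform T (fun u => duniform L (fun U => [:: (1, F (u, U))]))).
have fsum f : wsum (duniform T (fun u => duniform L (fun U => [:: (1, F (u, U))]))) f =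
    (T%:R * L%:R)^-1 * \sum_(U < L) \sum_(u < T) f (F (u : nat, U : nat)).
  rewrite wsum_duniform exchange_big/= invfM -mulrA; congr (_ * _).
  rewrite mulr_sumr; apply: eq_bigr => u _; rewrite wsum_duniform; congr (_ * _).
  by apply: eq_bigr => U _; rewrite wsum_cons wsum_nil addr0 mul1r.
have TR : (T%:R : R) != 0 by rewrite pnatr_eq0 -lt0n.
have LR : (L%:R : R) != 0 by rewrite pnatr_eq0 -lt0n.
set mu := duniform T _ in fsum *.
have sup : supported (trial_post s) mu.
  apply: supported_duniform => // u uT; apply: supported_duniform => // U UL; apply: supported1.
    by have [j [p [_ hp _ _ _]]] := HF (u, U) uT UL.
have law : covered j0 -> forall p, near_pt p ->
    wsum mu (fun s' => (wreg s' 0 == p.+1)%:R) = T%:R^-1.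
  move=> cov p np; rewrite fsum.
    pose G (U : nat) (j : nat) (p' : 'I_n) : R := (near_pt p' && accepts j0 j p' U && (p' == p))%:R.
    under eq_bigr => U _.
      rewrite (@sum_located j0 lo (st_mem s) (fun u => (wreg (F (u, val U)) 0 == p.+1)%:R) (G U) st); last first.
        move=> u uT; have [j [p' [_ _ loc -> _]]] := HF (u, val U) uT (ltn_ord U).
        exists j, p'; split=> //; rewrite /G /=.
        by case: (near_pt p' && accepts j0 j p' U).
      over.
    rewrite exchange_big/=.
    have -> : \sum_(j < L) \sum_(U < L) \sum_(p' | coll (j0 + j) p') G U j p' =
        (\sum_(j < L) \sum_(U < L) (coll (j0 + j) p && accepts j0 j p U))%N%:R.
      rewrite natr_sum; apply: eq_bigr => j _; rewrite natr_sum; apply: eq_bigr => U _.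
      have [cp|ncp] := boolP (coll (j0 + j) p).
        rewrite (bigD1 p)//= big1 ?addr0 => [|p' /andP[_ pp']]; last by rewrite /G (negbTE pp') andbF.
        by rewrite /G np eqxx andbT.
      rewrite big1// => p' cp'; rewrite /G; case: eqP => [e|]; rewrite ?andbF//.
      by move: cp'; rewrite e (negbTE ncp).
    rewrite (@accepts_count L (fun j => coll (j0 + j) p)); last exact: cov.
    by rewrite invfM -mulrA mulVf// mulr1.
split=> //.
- rewrite /mu -s18; apply: (@yields_rand _ _ _ _ _ _ _ _ N.+2 19 (WReg 18) _ s
    (fun u => duniform L (fun U => [:: (1, F (u, U))])) (trial_post s)) => [|u].
    by rewrite /= s18.
  rewrite /= s18 => uT; rewrite -{1}s3; split; last first.
    apply: supported_duniform => // U UL; apply: supported1.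
    by have [j [p [_ hp _ _ _]]] := HF (u, U) uT UL.
  apply: (@yields_rand _ _ _ _ _ _ _ _ N 20 (WReg 3) _ (set_wreg 19 u (tick 2 s))
    (fun U => [:: (1, F (u, U))]) (trial_post s)) => [|U]; first by rewrite /= /upd/= s3.
  rewrite /= /upd/= s3 => UL.
  have [j [p [r hp _ _ _]]] := HF (u, U) uT UL.
  by split; [exact: runs_yields r|exact: supported1].
- move=> o ho o0; rewrite fsum big1 ?mulr0// => U _; rewrite big1// => u _.
  have [j [p [_ _ _ -> _]]] := HF (val u, val U) (ltn_ord u) (ltn_ord U).
  case: ifP => [/andP[np _]|_]; first by rewrite eq_sym (negbTE (ho p np)).
  by rewrite eq_sym (negbTE o0).
- move=> cov; split.
    have : wsum mu (fun s' => (wreg s' 0 == 0%N)%:R + \sum_(p in [set p | near_pt p]%SET) (wreg s' 0 == p.+1)%:R) = 1.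
      transitivity (wsum mu (fun=> 1)); last exact: (proj2 sup).
      apply: supported_eq (sup) _ => s' [_ _ _ _ [->|[p np ->]]].
        by rewrite eqxx big1 ?addr0.
      rewrite (bigD1 p) ?inE//= eqxx big1 ?addr0 ?add0r// => p' /andP[_ pp'].
      by rewrite eqSS; case: eqP => // e; case/eqP: pp'; apply: val_inj.
    rewrite wsumD wsum_sum.
    rewrite (eq_bigr (fun=> T%:R^-1)); last by move=> p; rewrite inE => np; exact: law.
    rewrite sumr_const -[T%:R^-1 *+ _]mulr_natl -/near_count => h.
    by apply: (@addIr _ (near_count%:R / T%:R)); rewrite subrK.
  rewrite fsum.
    (* This bound on the cost is the same for every drawn [U], so the average over [U]
       disappears. *)
    pose G (j : nat) (p : 'I_n) : R := 1 + (near_pt p)%:R * (\sum_(V < L) accepts j0 j p V)%N%:R.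
    apply: (@le_trans _ _ ((T%:R * L%:R)^-1 *
       \sum_(U < L) \sum_(j < L) \sum_(p | coll (j0 + j) p) G j p)).
      rewrite ler_wpM2l ?invr_ge0 ?mulr_ge0//; apply: ler_sum => U _.
      apply: (@sum_located_le j0 lo (st_mem s) (fun u => (wreg (F (u, val U)) 21).+1%:R) G st) => u uT.
      have [j [p [_ _ loc _ [tU [tn hn]]]]] := HF (u, val U) uT (ltn_ord U).
      exists j, p; split=> //; rewrite /G -natr1 addrC lerD2l.
      case: (posnP (wreg (F (u, val U)) 21)) => [->|t0]; first by rewrite mulr_ge0.
      rewrite (tn t0) mul1r ler_nat; apply: (@accepts_prefix L (fun J => coll (j0 + J) p) j (val U) _ tU (ltn_ord U)) => t' ht'.
      exact: hn.
    rewrite sumr_const card_ord -[X in _ * X]mulr_natr.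
    have -> : \sum_(j < L) \sum_(p | coll (j0 + j) p) G j p = T%:R + near_count%:R * L%:R.
      rewrite /G; under eq_bigr do rewrite big_split/=.
      rewrite big_split/=; congr (_ + _).
        rewrite /T /cum natr_sum; apply: eq_bigr => j _; rewrite /bucket_size -sum1_card natr_sum.
        by apply: eq_bigl => p; rewrite inE.
      rewrite (eq_bigr (fun j : 'I_L => \sum_p (near_pt p)%:R * (\sum_(V < L) (coll (j0 + j) p && accepts j0 j p V))%N%:R)); last first.
        move=> j _; rewrite big_mkcond/=; apply: eq_bigr => p _.
        by case: ifP => // _; rewrite big1 ?mulr0// => V _.
      rewrite exchange_big/= /near_count -sum1_card natr_sum mulr_suml big_mkcond/=.
      rewrite [RHS]big_mkcond/=; apply: eq_bigr => p _; rewrite inE; case: ifP => np.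
        rewrite -mulr_sumr !mul1r -natr_sum; congr (_%:R).
        by rewrite (@accepts_count L (fun j => coll (j0 + j) p)); last exact: cov.
      by rewrite -mulr_sumr mul0r.
    rewrite le_eqVlt; apply/orP; left; apply/eqP.
    by move: (near_count%:R : R) => nc; field; rewrite TR LR.
Qed.

End trial_law.

(** * Mixtures of uniform laws on balls *)

Section mixtures.
Context {R : realType} {M : metricType R}.
Variables (n : nat) (S : 'I_n -> M) (x0 : M).
Variables (k : nat) (rad : nat -> R).

Local Notation state := (state R M).

Definition ball_at (i : nat) : {set 'I_n} := [set p | near_pt S x0 (rad i) p]%SET.

Definition answer_prob (mu : seq (R * state)) (o : nat) : R :=
  wsum mu (fun s => (wreg s 0 == o)%:R).

(** Empty balls get weight 0: their quotient would be 0 / 0 = 0, and the mass put on them would be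
    missing from the answers. *)
Definition mixture (mu : seq (R * state)) (wt : 'I_k -> R) : Prop :=
  [/\ forall i, 0 <= wt i /\ (ball_at i = finset.set0 -> wt i = 0),
      forall p : 'I_n, answer_prob mu p.+1 =
        \sum_i wt i * ((p \in ball_at i)%:R / #|ball_at i|%:R),
      answer_prob mu 0 = 1 - \sum_i wt i
    & forall o, (n < o)%N -> answer_prob mu o = 0].

(* An answer that has already been found is kept. *)
Definition fair_law (mu : seq (R * state)) (o : nat) : Prop :=
  if o == 0%N then exists wt, mixture mu wt
  else supported (fun s => wreg s 0 = o) mu.

Lemma fair_law1 s : fair_law [:: (1, s)] (wreg s 0).
Proof.
rewrite /fair_law; case: eqP => [s0|_]; last exact: supported1.
have ap o : answer_prob [:: (1, s)] o = (o == 0%N)%:R.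
  by rewrite /answer_prob wsum_cons wsum_nil addr0 mul1r s0 eq_sym.
exists (fun=> 0); split=> //.
- by move=> p; rewrite ap big1// => i _; rewrite mul0r.
- by rewrite ap big1 ?subr0.
- by case=> // o _; rewrite ap.
Qed.

Lemma answer_prob_dbind mu g o :
  answer_prob (dbind mu g) o = wsum mu (fun s => answer_prob (g s) o).
Proof. exact: wsum_dbind. Qed.

Lemma wsum_ge0 (Q : state -> Prop) mu (f : state -> R) : supported Q mu ->
  (forall s, Q s -> 0 <= f s) -> 0 <= wsum mu f.
Proof.
case=> + _ f0; elim=> [|x m [x0' Qx] _ IH]; first by rewrite wsum_nil.
by rewrite wsum_cons addr_ge0// mulr_ge0// f0.
Qed.

Lemma supported_and (P Q : state -> Prop) mu : supported P mu -> supported Q mu ->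
  supported (fun s => P s /\ Q s) mu.
Proof.
move=> [hP e] [hQ _]; split=> // {e}; elim: hP hQ => [|x m [x0' Px] _ IH] hQ.
  exact: List.Forall_nil.
by inversion hQ as [|? ? [? ?] hQ']; constructor; [split|exact: IH].
Qed.

(** Whatever the unanswered state in which the continuation starts, its answer is again a mixture
    over the same balls. Only the weights vary with the state, so averaging preserves the form: the
    new weight is the old one plus the mean of the later ones over unanswered states. *)
Lemma fair_law_dbind (Q : state -> Prop) mu g o : supported Q mu -> fair_law mu o ->
  (forall s, Q s -> fair_law (g s) (wreg s 0)) -> fair_law (dbind mu g) o.
Proof.
rewrite {1 3}/fair_law => sm; case: eqP => [_|o0] h hg; last first.
  apply: (supported_dbind (supported_and sm h)) => s [Qs e].
  by have := hg _ Qs; rewrite /fair_law e (introF eqP o0).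
case: h => wt [wt0 hp h0 hn].
have /boolp.choice[wf Hwf] : forall s, exists w : 'I_k -> R, Q s -> wreg s 0 = 0%N -> mixture (g s) w.
  move=> s; have [[Qs s0]|ns] := pselect (Q s /\ wreg s 0 = 0%N).
    by have := hg _ Qs; rewrite /fair_law s0 eqxx => -[w hw]; exists w.
  by exists wt => Qs s0; case: ns.
have gs s o' : Q s -> answer_prob (g s) o' = if wreg s 0 == 0%N then answer_prob (g s) o' else (wreg s 0 == o')%:R.
  move=> Qs; case: eqP => // s0; have := hg _ Qs; rewrite /fair_law (introF eqP s0) => sg.
  rewrite /answer_prob; transitivity (wsum (g s) (fun=> (wreg s 0 == o')%:R * 1)).
    by apply: supported_eq sg _ => s' ->; rewrite mulr1.
  by rewrite wsumZ (proj2 sg) mulr1.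
pose z (s : state) : R := (wreg s 0 == 0%N)%:R.
exists (fun i => wt i + wsum mu (fun s => z s * wf s i)); split.
- move=> i; have [w0 we] := wt0 i.
  have wf0 s : Q s -> 0 <= z s * wf s i /\ (ball_at i = finset.set0 -> z s * wf s i = 0).
    move=> Qs; rewrite /z; case: eqP => s0; last by rewrite mul0r.
    have [h _ _ _] := Hwf _ Qs s0; have [h1 h2] := h i.
    by rewrite mul1r.
  split.
    by rewrite addr_ge0//; apply: (wsum_ge0 sm) => s Qs; case: (wf0 s Qs).
  move=> bi; rewrite we// add0r; transitivity (wsum mu (fun=> 0 * 1)).
    by apply: supported_eq sm _ => s Qs; rewrite mul0r; case: (wf0 s Qs) => _; apply.
  by rewrite wsumZ mul0r.
- move=> p; rewrite answer_prob_dbind.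
  under [RHS]eq_bigr do rewrite mulrDl.
  rewrite big_split/= -hp.
  transitivity (wsum mu (fun s => (wreg s 0 == p.+1)%:R +
     \sum_i z s * wf s i * ((p \in ball_at i)%:R / #|ball_at i|%:R))).
    apply: supported_eq sm _ => s Qs; rewrite gs// /z; case: eqP => s0.
      have [_ -> _ _] := Hwf _ Qs s0; rewrite s0 add0r.
      by apply: eq_bigr => i _; rewrite mul1r.
    by rewrite big1 ?addr0// => i _; rewrite !mul0r.
  rewrite wsumD wsum_sum; congr (_ + _); apply: eq_bigr => i _.
  by rewrite wsumZr.
- rewrite answer_prob_dbind big_split/= opprD addrA -h0.
  transitivity (wsum mu (fun s => (wreg s 0 == 0%N)%:R + (-1) * \sum_i z s * wf s i)).
    apply: supported_eq sm _ => s Qs; rewrite gs// /z; case: eqP => s0.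
      have [_ _ -> _] := Hwf _ Qs s0; rewrite mulN1r; congr (1 - _).
      by apply: eq_bigr => i _; rewrite mul1r.
    by rewrite big1 ?mulr0 ?addr0// => i _; rewrite mul0r.
  by rewrite wsumD wsumZ wsum_sum mulN1r.
- move=> o' ho'; rewrite answer_prob_dbind.
  transitivity (wsum mu (fun s => (wreg s 0 == o')%:R)); last exact: hn.
  apply: supported_eq sm _ => s Qs; rewrite gs//; case: eqP => // s0.
  by have [_ _ _ ->] := Hwf _ Qs s0 => //; rewrite s0; case: (o') ho'.
Qed.

End mixtures.

(** * Composition of fair executions *)

Section fair_triples.
Context {R : realType} {M : metricType R}.
Variables (d : nat) (lsh : R -> R -> hash_family R M).
Variables (n : nat) (S : 'I_n -> M) (W : nat) (x0 : M).
Variables (k : nat) (rad : nat -> R) (cov : Prop).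

Local Notation state := (state R M).
Local Notation runs := (runs d lsh S W (Some x0)).
Local Notation yields := (yields d lsh S W (Some x0)).
Local Notation beval := (beval S W (Some x0)).
Local Notation bcost := (@bcost R d).
Local Notation fair_law := (fair_law S x0 k rad).

Definition unanswered (s : state) : R := (wreg s 0 == 0%N)%:R.

(** Fairness is claimed under [cov], which will mean that near points collide in every copy, whereas
    termination and the postcondition hold on any sorted tables; a false [cov] gives the
    unconditional guarantees. The factor [eps] bounds the probability of remaining unanswered. *)
Definition fair_run (N : nat) (c : cmd R) (s : state) (Q : state -> Prop) (eps : R) : Prop :=
  exists mu, [/\ yields N c s mu, supported Q mu, cov -> fair_law mu (wreg s 0)
    & wsum mu unanswered <= unanswered s * eps].

Lemma fair_run_det N c s s' (Q : state -> Prop) eps : runs N c s s' -> Q s' -> wreg s' 0 = wreg s 0 ->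
  (wreg s 0 = 0%N -> 1 <= eps) -> fair_run N c s Q eps.
Proof.
move=> r Qs' e h; exists [:: (1, s')]; split.
- exact: runs_yields.
- exact: supported1.
- by move=> _; rewrite -e; exact: fair_law1.
- rewrite wsum_cons wsum_nil addr0 mul1r /unanswered e; case: eqP => [/h|_]; last by rewrite mul0r.
  by rewrite mul1r.
Qed.

Lemma fair_run_mono N N' c s (Q Q' : state -> Prop) eps eps' : (N <= N')%N ->
  (forall s, Q s -> Q' s) -> eps <= eps' ->
  fair_run N c s Q eps -> fair_run N' c s Q' eps'.
Proof.
move=> NN' QQ' ee' [mu [y sm f b]]; exists mu; split=> //.
- exact: yields_mono y.
- exact: supported_mono sm.
- by apply: le_trans b _; rewrite ler_wpM2l.
Qed.

(** Common core of sequences and loops. The factor [eps2] depends on the intermediate state because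
    the budget left after a trial is random; [s1] accounts for the cost of a loop guard. *)
Lemma fair_run_bind N1 N2 c2 c (s s1 : state) mu (Q1 Q2 : state -> Prop) (eps2 : state -> R) :
  (forall g, (forall s', Q1 s' -> yields N2 c2 s' (g s') /\ exists Q', supported Q' (g s')) ->
     yields (maxn N1 N2).+1 c s (dbind mu g)) ->
  wreg s1 0 = wreg s 0 -> supported Q1 mu -> (cov -> fair_law mu (wreg s1 0)) ->
  (forall s', Q1 s' -> fair_run N2 c2 s' Q2 (eps2 s')) ->
  exists nu, [/\ yields (maxn N1 N2).+1 c s nu, supported Q2 nu, cov -> fair_law nu (wreg s 0)
    & wsum nu unanswered <= wsum mu (fun s' => unanswered s' * eps2 s')].
Proof.
move=> hy e0 sm fl h.
have /boolp.choice[g Hg] : forall s', exists nu, Q1 s' ->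
    [/\ yields N2 c2 s' nu, supported Q2 nu, cov -> fair_law nu (wreg s' 0)
      & wsum nu unanswered <= unanswered s' * eps2 s'].
  move=> s'; have [/h[nu hnu]|nQ] := pselect (Q1 s'); first by exists nu.
  by exists [::].
exists (dbind mu g); split.
- by apply: hy => s' /Hg[y sg _ _]; split=> //; exists Q2.
- by apply: supported_dbind sm _ => s' /Hg[].
- move=> cv; rewrite -e0; apply: fair_law_dbind sm (fl cv) _ => s' /Hg[_ _ + _]; exact.
- by rewrite wsum_dbind; apply: supported_le sm _ => s' /Hg[].
Qed.

Lemma fair_run_seq N1 N2 c1 c2 s (Q1 Q2 : state -> Prop) eps1 eps2 : 0 <= eps2 ->
  fair_run N1 c1 s Q1 eps1 -> (forall s', Q1 s' -> fair_run N2 c2 s' Q2 eps2) ->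
  fair_run (maxn N1 N2).+1 (Seq c1 c2) s Q2 (eps1 * eps2).
Proof.
move=> e20 [mu [y sm fl b]] h.
have [||nu [y2 s2 f2 b2]] := @fair_run_bind N1 N2 c2 (Seq c1 c2) s s mu Q1 Q2 (fun=> eps2) _ _ sm fl h.
- by move=> g hg; apply: yields_seq y sm hg.
- by [].
exists nu; split=> //; apply: le_trans b2 _.
by rewrite wsumZr mulrA ler_wpM2r.
Qed.

Lemma fair_run_after N1 N2 c1 c2 s s1 (Q : state -> Prop) eps : 0 <= eps ->
  runs N1 c1 s s1 -> wreg s1 0 = wreg s 0 -> fair_run N2 c2 s1 Q eps ->
  fair_run (maxn N1 N2).+1 (Seq c1 c2) s Q eps.
Proof.
move=> e0 r e h; rewrite -[eps]mul1r.
apply: (@fair_run_seq N1 N2 c1 c2 s (fun t => t = s1)) => // [|_ -> //].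
by apply: (@fair_run_det N1 c1 s s1).
Qed.

Lemma fair_run_while N1 N2 b c s (Q1 Q2 : state -> Prop) eps1 eps2 : beval s b -> 0 <= eps2 ->
  fair_run N1 c (tick (bcost b).+1 s) Q1 eps1 ->
  (forall s', Q1 s' -> fair_run N2 (While b c) s' Q2 eps2) ->
  fair_run (maxn N1 N2).+1 (While b c) s Q2 (eps1 * eps2).
Proof.
move=> bs e20 [mu [y sm fl b1]] h.
have [||nu [y2 s2 f2 b2]] := @fair_run_bind N1 N2 (While b c) (While b c) s (tick (bcost b).+1 s) mu Q1 Q2 (fun=> eps2) _ _ sm fl h.
- by move=> g hg; apply: yields_while y sm hg.
- by [].
exists nu; split=> //; apply: le_trans b2 _.
by rewrite wsumZr mulrA ler_wpM2r.
Qed.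

End fair_triples.

(** * Sampling from one level *)

Section level_code.
Context {R : realType}.
Variables (k i : nat) (rr : R).

Definition trial_guard : bexp R :=
  BAnd (WLt R (WLit 0) (WReg 24))
    (BAnd (WLt R (WReg 0) (WLit 1)) (WLt R (WLit 0) (WReg 18))).

Definition trials : cmd R := While trial_guard (trial k i rr).

Definition search_copy : cmd R :=
  Seq (SetW R 16 (WBin Mul (WReg 17) (WReg 3)))
    (Seq (find_buckets k i)
      (Seq (SetW R 24 (WReg 6))
        (Seq trials (Seq (erase_buckets k) (incr 17))))).

Definition copy_guard : bexp R :=
  BAnd (WLt R (WReg 17) (WReg 4)) (WLt R (WReg 0) (WLit 1)).

Definition search_copies : cmd R :=
  Seq (SetW R 17 (WLit 0)) (While copy_guard search_copy).

End level_code.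

Section level_law.
Context {R : realType} {M : metricType R}.
Variables (d : nat) (lsh : R -> R -> hash_family R M).
Variables (n : nat) (S : 'I_n -> M) (W : nat) (x0 : M).

Local Notation state := (state R M).
Local Notation runs := (runs d lsh S W (Some x0)).
Local Notation sexec := (sexec d S W (Some x0)).
Local Notation beval := (beval S W (Some x0)).
Local Notation bcost := (@bcost R d).

Variables (k i K L A Bud : nat) (m0 : memory R M).
Hypotheses (ik : (i < k)%N) (K_gt0 : (0 < K)%N) (L_gt0 : (0 < L)%N).
Hypotheses (A_gt0 : (0 < A)%N) (n_gt0 : (0 < n)%N).
Hypothesis HW : ((A * L * (K + n) + L + 3) * nkinds k < W)%N.
Hypothesis BudW : (Bud < W)%N.
Variable pi : nat -> {perm 'I_n}.
Hypothesis tables : forall J, (J < A * L)%N -> table_sorted S k i K m0 J (pi J).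
Hypothesis scratch0 : forall a, scratch k L a -> words m0 a = 0%N.
Variables (rad : nat -> R) (cov : Prop).

Local Notation same_but_scratch := (same_but_scratch k L m0).
Local Notation cum := (cum S x0 k i K m0).
Local Notation buckets_stored := (buckets_stored S x0 k i K m0 pi).
Local Notation near_pt := (near_pt S x0 (rad i)).
Local Notation near_count := (near_count S x0 (rad i)).
Local Notation covered := (covered S x0 k i K L m0 (rad i)).
Local Notation trial_time := (trial_time d K L).
Local Notation fair_law := (fair_law S x0 k rad).
Local Notation fair_run := (fair_run d lsh S W x0 k rad cov).

(* [lam] is a rate at which the failure probability of a copy decays with its
   budget; [lam = 0] is always allowed. *)
Definition decay_rate (lam : R) (j0 : nat) : Prop :=
  lam = 0 \/ [/\ 0 <= lam, (0 < cum j0 L)%N, covered j0, 2 * lam * L%:R <= 1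
    & 2 * lam * ((cum j0 L)%:R + near_count%:R * L%:R) <= near_count%:R].

Lemma decay_rate_ge0 lam j0 : decay_rate lam j0 -> 0 <= lam.
Proof. by case=> [->|[]]. Qed.

(** Follows from [1 - t <= expR (- t)] and from [(1 + 2 * t) * (1 - t) >= 1], valid up to one
    half. *)
Lemma expR_le_affine (t : R) : 0 <= t <= 2^-1 -> expR t <= 1 + 2 * t.
Proof.
move=> /andP[t0 t1]; have := expR_ge1Dx (- t); rewrite expRN => h.
have e0 := expR_gt0 t.
have h2 : (1 - t) * expR t <= 1.
  by have := ler_wpM2r (ltW e0) h; rewrite mulVf// gt_eqF.
have h3 : 1 <= (1 + 2 * t) * (1 - t) by nra.
have h4 : 0 < 1 - t by lra.
rewrite -(ler_pM2l h4); apply: le_trans h2 _; by rewrite mulrC.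
Qed.

(** A successful trial is uniform on the ball of level [i], so all of its success probability,
    [near_count] over the total bucket size, goes to that radius. *)
Lemma trial_mixture j0 (mu : seq (R * state)) : (0 < cum j0 L)%N ->
  (forall o, (forall p : 'I_n, near_pt p -> o != p.+1) -> o != 0%N ->
     wsum mu (fun s' => (wreg s' 0 == o)%:R) = 0) ->
  (forall p, near_pt p -> wsum mu (fun s' => (wreg s' 0 == p.+1)%:R) = (cum j0 L)%:R^-1) ->
  wsum mu (fun s' => (wreg s' 0 == 0%N)%:R) = 1 - near_count%:R / (cum j0 L)%:R ->
  fair_law mu 0%N.
Proof.
move=> T0 h1 h2 h3; rewrite /fair_law eqxx.
exists (fun i' => if i' == Ordinal ik then near_count%:R / (cum j0 L)%:R else 0).
have sumd (f : 'I_k -> R) : \sum_i' (if i' == Ordinal ik then near_count%:R / (cum j0 L)%:R else 0) * f i' =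
    near_count%:R / (cum j0 L)%:R * f (Ordinal ik).
  by rewrite (bigD1 (Ordinal ik))//= eqxx big1 ?addr0// => i' /negbTE ->; rewrite mul0r.
split.
- move=> i'; case: eqP => [->|_]; last by [].
  split; first by rewrite divr_ge0.
  by rewrite /near_count -/(ball_at S x0 rad i) => ->; rewrite cards0 mul0r.
- move=> p; rewrite sumd /= inE /answer_prob; case: (boolP (near_pt p)) => np.
    rewrite h2// mul1r mulrAC mulfV ?mul1r// pnatr_eq0 -lt0n.
    by apply/card_gt0P; exists p; rewrite inE.
  rewrite mul0r mulr0 h1// => p' np'; rewrite eqSS; apply: contraNneq np => e.
  by rewrite (_ : p = p')//; exact: val_inj.
- rewrite /answer_prob h3; congr (1 - _).
  by rewrite -[LHS]mulr1 -(sumd (fun=> 1)); apply: eq_bigr => i' _; rewrite mulr1.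
- move=> o no; apply: h1; last by case: (o) no.
  by move=> p _; apply: contraTneq no => ->; rewrite -leqNgt.
Qed.

Definition trials_pre (s : state) (j0 : nat) (lo : nat -> nat) : Prop :=
  [/\ same_but_scratch (st_mem s), buckets_stored j0 L lo (st_mem s),
      [/\ wreg s 1 = n, wreg s 2 = K & wreg s 3 = L], wreg s 16 = j0 /\ (j0 + L <= A * L)%N
    & wreg s 18 = cum j0 L /\ (wreg s 24 < W)%N].

(** The last trial may overrun the budget, by less than [L] units, hence the added [L]. With no
    budget left only the final test is paid, which keeps the bound inductive. *)
Definition trials_post (s s' : state) : Prop :=
  [/\ regs_frame trial_ws [:: 0%N; 1%N] s s', memtop s' = memtop s
    & (st_time s' <= st_time s +
         (if wreg s 24 == 0%N then 0 else (trial_time + 20) * (wreg s 24 + L)) + 20)%N].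

(** A supermartingale argument: the indicator of failure times the exponential of minus [lam] times
    the remaining budget does not increase on average. Induction on a bound [b] of the budget, since
    every trial spends at least one unit. *)
Lemma trials_spec b : exists N, forall lam j0 lo s, trials_pre s j0 lo -> (wreg s 24 <= b)%N ->
  (cov -> covered j0) -> decay_rate lam j0 ->
  fair_run N (trials k i (rad i)) s (trials_post s) (expR (- (lam * (wreg s 24)%:R))).
Proof.
have [Nt Ht] := trial_spec d lsh x0 ik K_gt0 L_gt0 A_gt0 n_gt0 HW tables (rad i).
have W1 : (1 < W)%N by apply: leq_ltn_trans HW; rewrite /nkinds; nia.
have gE s : beval s (trial_guard (R:=R)) = [&& (0 < wreg s 24)%N, wreg s 0 == 0%N & (0 < wreg s 18)%N].
  by rewrite /= mod0n modn_small// ltnS leqn0.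
have stop lam j0 lo s : trials_pre s j0 lo -> decay_rate lam j0 -> ~~ beval s (trial_guard (R:=R)) ->
    fair_run 1 (trials k i (rad i)) s (trials_post s) (expR (- (lam * (wreg s 24)%:R))).
  move=> [_ _ _ _ [s18 _]] hl; rewrite gE s18 => gf; apply: fair_run_det.
  - by apply: runs_while_false; rewrite gE s18.
  - by split=> //=; case: ifP => _; lia.
  - by [].
  (* An exhausted budget makes the claimed factor 1; an empty union of buckets is compatible only
     with rate 0. *)
  - move=> s0; move: gf; rewrite s0 eqxx /= negb_and -!leqNgt !leqn0 => /orP[/eqP->|T0].
      by rewrite mulr0 oppr0 expR0.
    case: hl => [->|[_ + _ _ _]]; first by rewrite mul0r oppr0 expR0.
    by rewrite (eqP T0).
elim: b => [|b [N IH]].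
  exists 1%N => lam j0 lo s pre; rewrite leqn0 => /eqP s24 hc hl.
  by apply: stop pre hl _; rewrite gE s24.
exists (maxn Nt (maxn 1 N)).+1 => lam j0 lo s pre sb hc hl.
have [gt|gf] := boolP (beval s (trial_guard (R:=R))); last first.
  by apply: fair_run_mono (stop _ _ _ _ pre hl gf).
have [sm st [s1 s2 s3] [s16 j0L] [s18 s24]] := pre.
move: (gt); rewrite gE s18 => /and3P[b0 /eqP s0 T0].
pose tk := (bcost (trial_guard (R:=R))).+1.
have [//|//|//|//|//|//|//|//|//|//|//|mu [y sup oth law fl]] := Ht (tick tk s) j0 lo.
have lam0 := decay_rate_ge0 hl.
have hpost s' : trial_post d S x0 K L (rad i) (tick tk s) s' ->
    fair_run (maxn 1 N) (trials k i (rad i)) s' (trials_post s) (expR (- (lam * (wreg s' 24)%:R))).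
  move=> [fr mt tm [tL e24] _].
  have pre' : trials_pre s' j0 lo.
    split.
    - by rewrite (memtop_mem mt).
    - by rewrite (memtop_mem mt).
    - by rewrite (proj1 fr 1%N)// (proj1 fr 2%N)// (proj1 fr 3%N).
    - by rewrite (proj1 fr 16%N).
    - by rewrite (proj1 fr 18%N)// e24 /=; split=> //; lia.
  apply: (@fair_run_mono _ _ _ _ _ _ _ _ _ _ _ N _ _ _ (trials_post s')) (IH _ _ _ _ pre' _ hc hl) => //.
  - exact: leq_maxr.
  - move=> s'' [fr' mt' tm']; split.
    + by apply: regs_frame_trans (regs_frame_tickl fr) fr' _ _ _ _.
    + by rewrite mt' mt.
    + move: tm tm'; rewrite e24 [st_time (tick _ _)]/= [wreg (tick _ _) 24]/= (gtn_eqF b0).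
      move: (wreg s 24) (wreg s' 21) b0 tL (trial_time) => be t be0 tL' tt.
      have [le|lt] := leqP be t.+1.
        move: (le); rewrite -subn_eq0 => /eqP -> /=.
        have h1 : ((tt + 4) * t.+1 + 16 * t.+1 <= (tt + 20) * L)%N by rewrite -mulnDl leq_mul//; lia.
        have h2 : ((tt + 20) * L <= (tt + 20) * (be + L))%N by rewrite leq_mul2l; apply/orP; right; lia.
        rewrite /tk /=; lia.
      rewrite (gtn_eqF (_ : 0 < be - t.+1)%N) ?subn_gt0//.
      have h1 : ((tt + 20) * (be + L) = (tt + 20) * (be - t.+1 + L) + (tt + 4) * t.+1 + 16 * t.+1)%N.
        by rewrite -addnA -mulnDl -addnA -mulnDr; congr (_ * _)%N; lia.
      rewrite /tk /=; lia.
  - by rewrite e24 /=; lia.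
have [|||nu [y2 s2' f2 b2]] := @fair_run_bind _ _ d lsh n S W x0 k rad cov Nt (maxn 1 N) (trials k i (rad i))
  (trials k i (rad i)) s (tick tk s) mu (trial_post d S x0 K L (rad i) (tick tk s)) (trials_post s)
  (fun s' => expR (- (lam * (wreg s' 24)%:R))) _ _ sup _ hpost.
- by move=> g hg; apply: yields_while y sup hg.
- by [].
- move=> cv; rewrite /= s0; apply: (@trial_mixture j0) => //.
    by apply: law; exact: hc.
  by case: (fl (hc cv)).
exists nu; split=> //; apply: le_trans b2 _.
rewrite /unanswered s0 eqxx mul1r.
case: hl => [->|[_ _ hcv hL hT]].
  rewrite mul0r oppr0 expR0; apply: (@le_trans _ _ (wsum mu (fun=> 1))); last by rewrite (proj2 sup).
  by apply: supported_le sup _ => s' _; rewrite mul0r oppr0 expR0 mulr1; case: eqP.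
have [f0 fE] := fl hcv.
(* On failure a trial of cost x loses the factor exp (lam x), at most 1 + 2 lam x because x <= L and
   2 lam L <= 1. Dropping failure from the second term leaves the failure probability plus 2 lam
   times the expected cost, at most 1 by the last condition of [decay_rate]. *)
apply: (@le_trans _ _ (wsum mu (fun s' => expR (- (lam * (wreg s 24)%:R)) *
    ((wreg s' 0 == 0%N)%:R + 2 * lam * (wreg s' 21).+1%:R)))).
  apply: supported_le sup _ => s' [_ _ _ [tL e24] _].
  have cL : (wreg s' 21).+1%:R <= L%:R :> R by rewrite ler_nat.
  have c0 : 0 <= (wreg s' 21).+1%:R :> R by [].
  case: eqP => _; last by rewrite mul0r mulr_ge0 ?expR_ge0// add0r !mulr_ge0.
  rewrite mul1r.
  apply: (@le_trans _ _ (expR (- (lam * (wreg s 24)%:R)) * expR (lam * (wreg s' 21).+1%:R))).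
    rewrite -expRD ler_expR e24 /=.
    have : (wreg s 24)%:R <= (wreg s 24 - (wreg s' 21).+1)%N%:R + (wreg s' 21).+1%:R :> R.
      by rewrite -natrD ler_nat; lia.
    move=> h; have := ler_wpM2l lam0 h; lra.
  rewrite ler_wpM2l ?expR_ge0//; apply: le_trans (expR_le_affine _) _.
    rewrite mulr_ge0//=; have := ler_wpM2l lam0 cL; lra.
  by rewrite mulrA.
rewrite wsumZ -[leRHS]mulr1 ler_wpM2l ?expR_ge0// wsumD f0 wsumZ.
have T0R : 0 < (cum j0 L)%:R :> R by rewrite ltr0n.
apply: (@le_trans _ _ (1 - near_count%:R / (cum j0 L)%:R + 2 * lam * (1 + near_count%:R * L%:R / (cum j0 L)%:R))).
  by rewrite lerD2l ler_wpM2l// mulr_ge0.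
have -> : 2 * lam * (1 + near_count%:R * L%:R / (cum j0 L)%:R) =
    2 * lam * ((cum j0 L)%:R + near_count%:R * L%:R) / (cum j0 L)%:R.
  by field; rewrite gt_eqF.
rewrite -lerBrDl opprB addrCA subrr addr0 ler_pM2r ?invr_gt0//.
Qed.


Definition copy_ws : seq nat := trial_ws ++ [:: 16; 17; 18; 23]%N.

Definition copy_time : nat :=
  ((3 * probe_time d n K + 60) * L.+1 + (trial_time + 20) * (Bud + L) + 60)%N.

Definition copy_pre (s : state) : Prop :=
  [/\ st_mem s = m0, wreg s 1 = n, wreg s 2 = K, wreg s 3 = L
    & wreg s 4 = A /\ wreg s 6 = Bud].

Definition copy_post (s s' : state) : Prop :=
  [/\ regs_frame copy_ws [:: 0%N; 1%N] s s', st_mem s' = m0, wreg s' 17 = (wreg s 17).+1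
    & (st_time s' <= st_time s + copy_time)%N].

Lemma search_copy_spec : exists N, forall s lam, copy_pre s -> (wreg s 17 < A)%N ->
  (cov -> covered (wreg s 17 * L)) -> decay_rate lam (wreg s 17 * L) ->
  fair_run N (search_copy k i (rad i)) s (copy_post s) (expR (- (lam * Bud%:R))).
Proof.
have [N1 H1] := find_buckets_spec d lsh x0 ik K_gt0 L_gt0 A_gt0 n_gt0 HW tables.
have [N2 H2] := trials_spec Bud.
have [N3 H3] := erase_buckets_spec d lsh S x0 ik K_gt0 L_gt0 A_gt0 n_gt0 HW scratch0.
have [bW1 bW2 bW3 bW4] := small_lt ik K_gt0 L_gt0 A_gt0 n_gt0 HW.
eexists => s lam [sm s1 s2 s3 [s4 s6]] cA hc hl.
set c := wreg s 17 in cA hc hl *.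
have cL : (c * L + L <= A * L)%N by rewrite -mulSnr leq_mul2r cA orbT.
pose c1 := SetW R 16 (WBin Mul (WReg 17) (WReg 3)).
have fr1 := sexec_frame d S W (Some x0) c1 s.
have tm1 := sexec_time d S W (Some x0) c1 s.
have e16 : wreg (sexec c1 s) 16 = (c * L)%N by rewrite /= /upd/= s3 -/c; nomod.
have r1 : runs 1 c1 s (sexec c1 s) by rst.
have m1 : st_mem (sexec c1 s) = m0 by rewrite -sm.
move: (sexec c1 s) fr1 tm1 e16 r1 m1 => t1 fr1 tm1 e16 r1 m1.
have [||||||t2 [r2 fr2 tm2 [e18 sm2] [lo st2]]] := H1 t1 (c * L)%N.
- by rewrite m1; split.
- by rewrite (proj1 fr1 1%N).
- by rewrite (proj1 fr1 2%N).
- by rewrite (proj1 fr1 3%N).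
- by [].
- by [].
pose c3 := SetW R 24 (WReg 6).
have fr3 := sexec_frame d S W (Some x0) c3 t2.
have tm3 := sexec_time d S W (Some x0) c3 t2.
have e24 : wreg (sexec c3 t2) 24 = Bud.
  by rewrite /= /upd/= (proj1 fr2 6%N)// (proj1 fr1 6%N).
have r3 : runs 1 c3 t2 (sexec c3 t2) by rst.
have m3 : st_mem (sexec c3 t2) = st_mem t2 by [].
move: (sexec c3 t2) fr3 tm3 e24 r3 m3 => t3 fr3 tm3 e24 r3 m3.
have f13 : regs_frame copy_ws [:: 0%N; 1%N] s t3.
  have f12 : regs_frame copy_ws [:: 0%N; 1%N] s t2 by apply: regs_frame_trans fr1 fr2 _ _ _ _.
  by apply: regs_frame_trans f12 fr3 _ _ _ _.
have g0 : wreg t1 0 = wreg s 0 by rewrite (proj1 fr1 0%N).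
have g0' : wreg t2 0 = wreg t1 0 by rewrite (proj1 fr2 0%N).
have g0'' : wreg t3 0 = wreg t2 0 by rewrite (proj1 fr3 0%N).
have pre3 : trials_pre t3 (c * L) lo.
  split; rewrite ?m3//.
  - by rewrite (proj1 fr3 1%N)// (proj1 fr3 2%N)// (proj1 fr3 3%N)// (proj1 fr2 1%N)// (proj1 fr2 2%N)//
      (proj1 fr2 3%N)// (proj1 fr1 1%N)// (proj1 fr1 2%N)// (proj1 fr1 3%N).
  - by rewrite (proj1 fr3 16%N)// (proj1 fr2 16%N).
  - by rewrite (proj1 fr3 18%N)// e24.
have e17 : wreg t3 17 = c by rewrite (proj1 fr3 17%N)// (proj1 fr2 17%N)// (proj1 fr1 17%N).
apply: (fair_run_after _ r1 g0); first exact: expR_ge0.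
apply: (fair_run_after _ r2 g0'); first exact: expR_ge0.
apply: (fair_run_after _ r3 g0''); first exact: expR_ge0.
rewrite -[expR _]mulr1; apply: fair_run_seq; [by []| |].
  have := H2 lam (c * L)%N lo t3 pre3 _ hc hl; rewrite e24; apply; exact: leqnn.
move=> t4 [fr4 mt4 tm4].
have s4mem : same_but_scratch (st_mem t4) by rewrite (memtop_mem mt4) m3.
have [|t5 [r5 fr5 tm5 m5]] := H3 t4 s4mem.
  by rewrite (proj1 fr4 3%N)// (proj1 f13 3%N).
have e17' : wreg t5 17 = c by rewrite (proj1 fr5 17%N)// (proj1 fr4 17%N).
have f15 : regs_frame copy_ws [:: 0%N; 1%N] s t5.
  have f14 : regs_frame copy_ws [:: 0%N; 1%N] s t4 by apply: regs_frame_trans f13 fr4 _ _ _ _.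
  by apply: regs_frame_trans f14 fr5 _ _ _ _.
have fr6 := sexec_frame d S W (Some x0) (incr 17) t5.
have tm6 := sexec_time d S W (Some x0) (incr 17) t5.
apply: (@fair_run_det _ _ _ _ _ _ _ _ _ _ _ _ _ _ (sexec (incr 17) t5)).
- by apply: runs_seq; [exact: r5|rst].
- split.
  + by apply: regs_frame_trans f15 fr6 _ _ _ _.
  + by rewrite -m5.
  + have cW : (c.+1 < W)%N by have := leq_pmulr A L_gt0; lia.
    by rewrite /= /upd/= e17'; nomod; rewrite addn1.
  + move: tm1 tm2 tm3 tm4 tm5 tm6; set X := st_time (sexec _ _); rewrite e24 /copy_time.
    have : ((if Bud == 0%N then 0 else (trial_time + 20) * (Bud + L)) <= (trial_time + 20) * (Bud + L))%N.
      by case: ifP.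
    by move: (if _ then _ else _) => Y; rewrite /= !mulnDl; lia.
- by rewrite (proj1 fr6 0%N)// (proj1 fr5 0%N).
- by [].
Qed.

Definition copies_post (s s' : state) : Prop :=
  [/\ regs_frame copy_ws [:: 0%N; 1%N] s s', st_mem s' = m0
    & (st_time s' <= st_time s + (copy_time + 20) * A.+1)%N].

(** Each copy has its own rate: the analysis will give a positive one to a single good copy, unknown
    to the algorithm, and 0 to the others. *)
Lemma search_copies_spec : exists N, forall s (rate : nat -> R), copy_pre s ->
  (forall c, (c < A)%N -> cov -> covered (c * L)) ->
  (forall c, (c < A)%N -> decay_rate (rate c) (c * L)) ->
  fair_run N (search_copies k i (rad i)) s (copies_post s)
    (\prod_(c < A) expR (- (rate c * Bud%:R))).
Proof.
have [N1 H1] := search_copy_spec.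
have [bW1 bW2 bW3 bW4] := small_lt ik K_gt0 L_gt0 A_gt0 n_gt0 HW.
have gE s : beval s (copy_guard (R:=R)) = (wreg s 17 < wreg s 4)%N && (wreg s 0 == 0%N).
  by rewrite /= (@modn_small 1 W) ?ltnS ?leqn0//; lia.
pose post (s s' : state) := [/\ regs_frame copy_ws [:: 0%N; 1%N] s s', st_mem s' = m0
  & (st_time s' <= st_time s + (copy_time + 15) * (A - wreg s 17) + 15)%N].
have exp0 (rate : nat -> R) c : 0 <= \prod_(c <= c' < A) expR (- (rate c' * Bud%:R)).
  by apply: prodr_ge0 => c' _; exact: expR_ge0.
have loop m : exists N, forall s (rate : nat -> R), copy_pre s -> (wreg s 17 <= A)%N -> (A - wreg s 17 <= m)%N ->
    (forall c, (c < A)%N -> cov -> covered (c * L)) ->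
    (forall c, (c < A)%N -> decay_rate (rate c) (c * L)) ->
    fair_run N (While (copy_guard (R:=R)) (search_copy k i (rad i))) s (post s)
      (\prod_(wreg s 17 <= c < A) expR (- (rate c * Bud%:R))).
  elim: m => [|m [N IH]].
    exists 1%N => s rate [sm s1 s2 s3 [s4 s6]] le le0 hc hl.
    have eA : wreg s 17 = A by lia.
    apply: fair_run_det.
    - by apply: runs_while_false; rewrite gE s4 eA ltnn.
    - by split=> //=; lia.
    - by [].
    - by move=> _; rewrite eA big_geq.
  exists (maxn N1 (maxn 1 N)).+1 => s rate pre le le0 hc hl.
  have [sm s1 s2 s3 [s4 s6]] := pre.
  have [gt|gf] := boolP (beval s (copy_guard (R:=R))); last first.
    apply: fair_run_det.
    - by apply: (@runs_mono _ _ _ _ _ _ _ _ 1); [|exact: runs_while_false].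
    - by split=> //; rewrite /= -addnA leq_add2l; apply: leq_trans (leq_addl _ _).
    - by [].
    - move=> s0; move: gf; rewrite gE s0 eqxx andbT s4 -leqNgt => ge.
      by rewrite big_geq.
  move: (gt); rewrite gE s4 => /andP[cA /eqP s0].
  rewrite big_ltn//; apply: fair_run_while; [exact: gt|exact: exp0| |].
    exact: (H1 (tick _ s) (rate (wreg s 17)) pre cA (hc _ cA) (hl _ cA)).
  move=> s' [fr' m' e17 tm'].
  have e17' : wreg s' 17 = (wreg s 17).+1 by [].
  rewrite -e17'.
  apply: (@fair_run_mono _ _ _ _ _ _ _ _ _ _ _ N _ _ _ (post s')) (IH s' rate _ _ _ hc hl) => //.
  - exact: leq_maxr.
  - move=> s'' [fr'' m'' tm'']; split=> //.
      by apply: regs_frame_trans (regs_frame_tickl fr') fr'' _ _ _ _.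
    have -> : (A - wreg s 17 = (A - (wreg s 17).+1).+1)%N by lia.
    move: tm' tm''; rewrite e17' mulnS [st_time (tick _ _)]/=; lia.
  - by split=> //; rewrite ?(proj1 fr' 1%N)// ?(proj1 fr' 2%N)// ?(proj1 fr' 3%N)// ?(proj1 fr' 4%N)// ?(proj1 fr' 6%N).
  - by rewrite e17'.
  - by rewrite e17'; lia.
have [N2 H2] := loop A.
eexists => s rate pre hc hl.
have [sm s1 s2 s3 [s4 s6]] := pre.
pose c0 := SetW R 17 (WLit 0).
have e17 : wreg (sexec c0 s) 17 = 0%N by rewrite /= /upd/= mod0n.
have fr0 := sexec_frame d S W (Some x0) c0 s.
have r0 : runs 1 c0 s (sexec c0 s) by rst.
apply: (fair_run_after _ r0) => //; first by apply: prodr_ge0 => c _; exact: expR_ge0.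
have := H2 (sexec c0 s) rate _ _ _ hc hl.
rewrite e17 big_mkord => H.
apply: fair_run_mono (H _ _ _) => //.
- move=> s' [fr' m' tm']; split=> //.
    by apply: regs_frame_trans fr0 fr' _ _ _ _.
  move: tm'; rewrite e17 subn0 mulnS mulnDl [st_time (sexec _ _)]/=; lia.
- by rewrite subn0.
Qed.

End level_law.

(** * Parameters, and the query program *)

Section query_code.
Context {R : realType}.
Variable k : nat.

(** Powers are formed among the reals, where nothing is reduced modulo [W]. *)
Fixpoint rpow (e : rexp R) (m : nat) : rexp R :=
  if m is m'.+1 then RBin RMul e (rpow e m') else RLit 1.

Definition hashes_guard : bexp R :=
  BNot (RLe (RBin RMul (ROfW R (WReg 1)) (RReg R 0)) (RLit 1)).
Definition tables_guard : bexp R :=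
  BNot (RLe (ROfW R (WReg 4)) (RBin RMul (ROfW R (WReg 3)) (RReg R 1))).
Definition root_guard : bexp R :=
  BNot (RLe (ROfW R (WReg 1)) (rpow (ROfW R (WReg 5)) k)).

Definition init_params : cmd R :=
  Seq (SetW R 2 (WLit 0)) (Seq (SetR 0 (RLit 1)) (SetR 1 (RLit 1))).
Definition hashes_step (p1 p2 : R) : cmd R :=
  Seq (SetR 0 (RBin RMul (RReg R 0) (RLit p2)))
    (Seq (SetR 1 (RBin RMul (RReg R 1) (RLit p1))) (incr 2)).
Definition copies_param (c0 : nat) : cmd R :=
  Seq (SetW R 4 (WBin Mul (WLit c0) (WReg 2))) (SetW R 3 (WLit 0)).
Definition derived_params : cmd R :=
  Seq (SetW R 6 (WBin Mul (WBin Mul (WLit 6) (WReg 4))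
         (WBin Add (WBin Mul (WLit 3) (WReg 3))
                   (WBin Mul (WBin Add (WReg 4) (WLit 2)) (WReg 5)))))
    (Seq (SetW R 7 (WBin Mul (WBin Mul (WReg 1) (WReg 3)) (WReg 2)))
         (SetW R 8 (WBin Mul (WReg 4) (WReg 3)))).

(** Registers do not survive from one run to the next and a real cannot be rounded to a word, so
    every run recomputes its parameters by counting upwards. This costs O(K + L + k N) steps, within
    the query time. *)
Definition params (p1 p2 : R) (c0 : nat) : cmd R :=
  Seq init_params
    (Seq (While hashes_guard (hashes_step p1 p2))
      (Seq (copies_param c0)
        (Seq (While tables_guard (incr 3))
          (Seq (SetW R 5 (WLit 0))
            (Seq (While root_guard (incr 5)) derived_params))))).

Variables (P1 P2 rad : nat -> R) (c0 : nat -> nat).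

Definition search_level (i : nat) : cmd R :=
  Seq (params (P1 i) (P2 i) (c0 i)) (search_copies k i (rad i)).

Definition seq_of (c : nat -> cmd R) (l : seq nat) : cmd R :=
  foldr (fun i r => Seq (c i) r) Skip l.

Definition query_prog : cmd R :=
  Seq (Seq (SetW R 1 (WReg 0)) (SetW R 0 (WLit 0))) (seq_of search_level (iota 0 k)).

End query_code.

Section params_spec.
Context {R : realType} {M : metricType R}.
Variables (d : nat) (lsh : R -> R -> hash_family R M).
Variables (n : nat) (S : 'I_n -> M) (W : nat) (q : option M).

Local Notation state := (state R M).
Local Notation runs := (runs d lsh S W q).
Local Notation sexec := (sexec d S W q).
Local Notation beval := (beval S W q).
Local Notation bcost := (@bcost R d).

(** This is 6 A times [load_scale], a bound on the expected total bucket size per near point. At the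
    rate 1 / (6 [load_scale]) of a good copy, running out of it has probability at most exp (-
    A). *)
Definition budget (L A N : nat) : nat := (6 * A * (3 * L + (A + 2) * N))%N.

(** Least solutions, as a linear search finds them; minimality also bounds the parameters from
    above. *)
Definition is_params (k : nat) (p1 p2 : R) (K L A N : nat) : Prop :=
  [/\ n%:R * p2 ^+ K <= 1 /\ (forall j, (j < K)%N -> 1 < n%:R * p2 ^+ j),
      A%:R <= L%:R * p1 ^+ K /\ (forall j, (j < L)%N -> j%:R * p1 ^+ K < A%:R)
    & n%:R <= (N%:R : R) ^+ k /\ (forall j, (j < N)%N -> (j%:R : R) ^+ k < n%:R)].

Definition params_time (k K L N : nat) : nat := (40 * (K + L + k.+1 * N + 10))%N.

Lemma reval_rpow s e m : reval S W q s (rpow e m) = reval S W q s e ^+ m.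
Proof. by elim: m => //= m ->; rewrite exprS. Qed.

Lemma rcost_rpow (e : rexp R) m : rcost d (rpow e m) = (m * (rcost d e).+1 + 1)%N :> nat.
Proof. by elim: m => //= m ->; rewrite mulSn; lia. Qed.

Lemma params_spec k p1 p2 c0 K L N : is_params k p1 p2 K L (c0 * K) N ->
  (6 + c0 < W)%N -> (K.+1 < W)%N -> (L.+1 < W)%N -> (N.+1 < W)%N ->
  (budget L (c0 * K) N < W)%N -> (n * L * K < W)%N -> (c0 * K * L < W)%N ->
  (0 < c0)%N -> (0 < K)%N -> (0 < L)%N -> (0 < N)%N ->
  exists NN, forall s, wreg s 1 = n -> exists s',
    [/\ runs NN (params k p1 p2 c0) s s',
      regs_frame [:: 2; 3; 4; 5; 6; 7; 8]%N [:: 0; 1]%N s s', memtop s' = memtop s,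
      (st_time s' <= st_time s + params_time k K L N)%N
    & [/\ wreg s' 2 = K, wreg s' 3 = L, wreg s' 4 = (c0 * K)%N,
        wreg s' 6 = budget L (c0 * K) N
        & wreg s' 7 = (n * L * K)%N /\ wreg s' 8 = (c0 * K * L)%N]].
Proof.
move=> [[hK hK'] [hL hL'] [hN hN']] cW KW LW NW BW mW GW C0 K0 L0 N0.
set ws := [:: 2; 3; 4; 5; 6; 7; 8]%N; set rs := [:: 0; 1]%N.
eexists => s s1.
pose t0 := sexec init_params s.
have fr0 : regs_frame ws rs s t0.
  by apply: regs_frame_sub (sexec_frame d S W q init_params s) _ _.
pose g1c := (bcost (hashes_guard (R:=R))).+1.
have g1E : (g1c <= 12)%N by [].
pose It1 t := [/\ regs_frame ws rs s t, memtop t = memtop s, (wreg t 2 <= K)%N,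
        rreg t 0 = p2 ^+ wreg t 2 /\ rreg t 1 = p1 ^+ wreg t 2
        & (st_time t <= st_time s + 20 + 40 * wreg t 2)%N].
have stept1 t : It1 t -> beval t (hashes_guard (R:=R)) -> exists t',
    [/\ runs (csize (hashes_step p1 p2)) (hashes_step p1 p2) (tick g1c t) t', It1 t' & (K - wreg t' 2 < K - wreg t 2)%N].
  move=> [fr mt le [e0 e1] tm].
    rewrite /= (proj1 fr 1%N)// s1 e0 -ltNge => gt.
    have lt : (wreg t 2 < K)%N.
      rewrite ltn_neqAle le andbT; apply/eqP => e; move: gt; rewrite e => gt.
      by have := lt_le_trans gt hK; rewrite ltxx.
    set t' := sexec (hashes_step p1 p2) (tick g1c t).
    have e2 : wreg t' 2 = (wreg t 2).+1 by rewrite /= /upd/=; nomod; rewrite addn1.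
    exists t'; split; [rst| |by rewrite e2; lia].
    split; rewrite ?e2.
    + by apply: regs_frame_trans fr (sexec_frame d S W q (hashes_step p1 p2) (tick g1c t)) _ _ _ _.
    + by rewrite sexec_memtop.
    + by [].
    + by rewrite !exprSr -e0 -e1.
    + have := sexec_time d S W q (hashes_step p1 p2) (tick g1c t); rewrite -/t'.
      by move: (st_time t') => X /=; lia.
have initt1 : It1 t0.
  split=> //.
    + by rewrite /= /upd/= mod0n.
    + by rewrite /= /upd/= mod0n !expr0.
    + by rewrite /= /upd/= mod0n; lia.
have vart1 : (K - wreg t0 2 <= K)%N by rewrite /= /upd/= mod0n subn0.
have [t1 [r1 [fr1 mt1 le1 [e0 e1] tm1] g1]] := runs_while stept1 initt1 vart1.
have k1 : wreg t1 2 = K.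
  apply/eqP; rewrite eqn_leq le1 /= leqNgt; apply/negP => lt.
  by move: g1; rewrite /= (proj1 fr1 1%N)// s1 e0 -ltNge hK'.
rewrite k1 in e0 e1 tm1 => {le1 g1}.
pose t2 := sexec (copies_param c0) (tick g1c t1).
have fr2 : regs_frame ws rs s t2.
  by apply: regs_frame_trans fr1 (sexec_frame d S W q (copies_param c0) (tick g1c t1)) _ _ _ _.
have AW : (c0 * K < W)%N by apply: leq_ltn_trans GW; exact: leq_pmulr.
have a4 : wreg t2 4 = (c0 * K)%N by rewrite /= /upd/= k1; nomod.
pose g3c := (bcost (tables_guard (R:=R))).+1.
have g3E : (g3c <= 12)%N by [].
pose It3 t := [/\ regs_frame ws rs s t, memtop t = memtop s, (wreg t 3 <= L)%N,
        rreg t 1 = p1 ^+ K /\ wreg t 4 = (c0 * K)%N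
        & (st_time t <= st_time s + 50 + 40 * K + 40 * wreg t 3)%N /\ wreg t 2 = K].
have stept3 t : It3 t -> beval t (tables_guard (R:=R)) -> exists t',
    [/\ runs (csize (incr (R:=R) 3)) (incr (R:=R) 3) (tick g3c t) t', It3 t' & (L - wreg t' 3 < L - wreg t 3)%N].
  move=> [fr mt le [e4 a5] [tm k3]].
    rewrite /= a5 e4 -ltNge => gt.
    have lt : (wreg t 3 < L)%N.
      rewrite ltn_neqAle le andbT; apply/eqP => e; move: gt; rewrite e => gt.
      by have := lt_le_trans gt hL; rewrite ltxx.
    set t' := sexec (incr 3) (tick g3c t).
    have e2 : wreg t' 3 = (wreg t 3).+1 by rewrite /= /upd/=; nomod; rewrite addn1.
    exists t'; split; [rst| |by rewrite e2; lia].
    split; rewrite ?e2//.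
    + by apply: regs_frame_trans fr (sexec_frame d S W q (incr 3) (tick g3c t)) _ _ _ _.
    + split=> //; have := sexec_time d S W q (incr 3) (tick g3c t); rewrite -/t'.
      by move: (st_time t') => X /=; lia.
have initt3 : It3 t2.
  split=> //.
    + by rewrite /= /upd/= mod0n.
    + by split=> //; rewrite /= /upd/= ?mod0n; move: tm1 => /=; lia.
have vart3 : (L - wreg t2 3 <= L)%N by rewrite /= /upd/= mod0n subn0.
have [t3 [r3 [fr3 mt3 le3 e3 [tm3 k3]] g3]] := runs_while stept3 initt3 vart3.
have k3' : wreg t3 3 = L.
  apply/eqP; rewrite eqn_leq le3 /= leqNgt; apply/negP => lt.
  by case: e3 => e3 a5; move: g3; rewrite /= a5 e3 -ltNge hL'.
pose t4 := sexec (SetW R 5 (WLit 0)) (tick g3c t3).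
have fr4 : regs_frame ws rs s t4.
  by apply: regs_frame_trans fr3 (sexec_frame d S W q (SetW R 5 (WLit 0)) (tick g3c t3)) _ _ _ _.
pose gc := (bcost (root_guard (R:=R) k)).+1.
have gcE : (gc <= 3 * k + 7)%N by rewrite /gc /= rcost_rpow /=; lia.
pose It5 t := [/\ regs_frame ws rs s t, memtop t = memtop s, (wreg t 5 <= N)%N,
        [/\ wreg t 2 = K, wreg t 3 = L & wreg t 4 = (c0 * K)%N]
        & (st_time t <= st_time s + 70 + 40 * K + 40 * L + (gc + 5) * wreg t 5)%N].
have stept5 t : It5 t -> beval t (root_guard (R:=R) k) -> exists t',
    [/\ runs (csize (incr (R:=R) 5)) (incr (R:=R) 5) (tick gc t) t', It5 t' & (N - wreg t' 5 < N - wreg t 5)%N].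
  move=> [fr mt le h tm].
    rewrite [beval _ _]/= reval_rpow /= (proj1 fr 1%N)// s1 -ltNge => gt.
    have lt : (wreg t 5 < N)%N.
      rewrite ltn_neqAle le andbT; apply/eqP => e; move: gt; rewrite e => gt.
      by have := lt_le_trans gt hN; rewrite ltxx.
    set t' := sexec (incr 5) (tick gc t).
    have e2 : wreg t' 5 = (wreg t 5).+1 by rewrite /= /upd/=; nomod; rewrite addn1.
    exists t'; split; [rst| |by rewrite e2; lia].
    split; rewrite ?e2//.
    + by apply: regs_frame_trans fr (sexec_frame d S W q (incr 5) (tick gc t)) _ _ _ _.
    + have := sexec_time d S W q (incr 5) (tick gc t); rewrite -/t' mulnS.
      by move: (st_time t') => X /=; lia.
have initt5 : It5 t4.
  split=> //.
    + by rewrite /= /upd/= mod0n.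
    + by rewrite /= /upd/=; split=> //; case: e3.
    + by rewrite /= /upd/= mod0n; move: tm3; rewrite k3' => /=; lia.
have vart5 : (N - wreg t4 5 <= N)%N by rewrite /= /upd/= mod0n subn0.
have [t5 [r5 [fr5 mt5 le5 [h2 h3 h4] tm5] g5]] := runs_while stept5 initt5 vart5.
have k5 : wreg t5 5 = N.
  apply/eqP; rewrite eqn_leq le5 /= leqNgt; apply/negP => lt.
  by move: g5; rewrite [beval _ _]/= reval_rpow /= (proj1 fr5 1%N)// s1 -ltNge hN'.
pose t6 := sexec (derived_params (R:=R)) (tick gc t5).
exists t6; split.
- apply: runs_seq; first rst.
  apply: runs_seq; first exact: r1.
  apply: runs_seq; first rst.
  apply: runs_seq; first exact: r3.
  apply: runs_seq; first rst.
  by apply: runs_seq; [exact: r5|rst].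
- by apply: regs_frame_trans fr5 (sexec_frame d S W q (derived_params (R:=R)) (tick gc t5)) _ _ _ _.
- by rewrite sexec_memtop.
- have := sexec_time d S W q (derived_params (R:=R)) (tick gc t5); rewrite -/t6.
  have : ((gc + 5) * N + gc * N <= 40 * (k.+1 * N))%N.
    by rewrite -mulnDl mulnA leq_mul2r; apply/orP; right; lia.
  have : (gc <= gc * N)%N by exact: leq_pmulr.
  move: (st_time t6) tm5 => X; rewrite k5 /params_time /=; lia.
- have nL : (n * L < W)%N by apply: leq_ltn_trans mW; exact: leq_pmulr.
  have e6 : wreg t6 6 = budget L (c0 * K) N.
    have A2 : (c0 * K + 2 < W)%N.
      apply: leq_ltn_trans BW; rewrite /budget.
      apply: (@leq_trans ((c0 * K + 2) * N)); first exact: leq_pmulr.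
      apply: (@leq_trans (3 * L + (c0 * K + 2) * N)); first exact: leq_addl.
      by apply: leq_pmull; rewrite !muln_gt0 C0 K0.
    rewrite /t6 /= /upd/= h3 h4 k5 (@modn_small 6 W); last lia.
    rewrite (@modn_small 2 W) ?(@modn_small 3 W); [|lia|lia].
    rewrite (modn_small A2) modnDml modnDmr modnMml modnMmr.
    by rewrite modn_small.
  have e7 : wreg t6 7 = (n * L * K)%N.
    by rewrite /t6 /= /upd/= h2 h3 (proj1 fr5 1%N)// s1 ?(modnMml, modnMmr) modn_small.
  have e8 : wreg t6 8 = (c0 * K * L)%N by rewrite /t6 /= /upd/= h3 h4 modn_small.
  by split.
Qed.

End params_spec.

Section query_spec.
Context {R : realType} {M : metricType R}.
Variables (d : nat) (lsh : R -> R -> hash_family R M).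
Variables (n : nat) (S : 'I_n -> M) (W : nat) (x0 : M).

Local Notation state := (state R M).

Variables (k : nat) (P1 P2 rad : nat -> R) (c0 Kf Lf Nf : nat -> nat).
Variables (m0 : memory R M) (pi : nat -> nat -> {perm 'I_n}) (cov : Prop).

Definition copies (i : nat) : nat := (c0 i * Kf i)%N.

Definition level_budget (i : nat) : nat := budget (Lf i) (copies i) (Nf i).

Definition level_fits (i : nat) : Prop :=
  [/\ (6 + c0 i < W)%N,
      ((copies i * Lf i * (Kf i + n) + Lf i + 3) * nkinds k < W)%N,
      ((Nf i).+1 < W)%N, (level_budget i < W)%N
    & (n * Lf i * Kf i < W)%N].

Definition level_positive (i : nat) : Prop :=
  [/\ (0 < c0 i)%N, (0 < Kf i)%N, (0 < Lf i)%N & (0 < Nf i)%N].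

Hypothesis n_gt0 : (0 < n)%N.
Hypothesis is_par : forall i, (i < k)%N -> is_params n k (P1 i) (P2 i) (Kf i) (Lf i) (copies i) (Nf i).
Hypothesis fits : forall i, (i < k)%N -> level_fits i.
Hypothesis pos : forall i, (i < k)%N -> level_positive i.
Hypothesis tables : forall i J, (i < k)%N -> (J < copies i * Lf i)%N ->
  table_sorted S k i (Kf i) m0 J (pi i J).
Hypothesis scratch0 : forall a, (k.*2 <= a %% nkinds k)%N -> words m0 a = 0%N.

Local Notation fair_run := (fair_run d lsh S W x0 k rad cov).

Definition level_rates (i : nat) (rate : nat -> R) : Prop :=
  forall c, (c < copies i)%N -> decay_rate S x0 k i (Kf i) (Lf i) m0 rad (rate c) (c * Lf i).

Definition level_covered (i : nat) : Prop :=
  forall c, (c < copies i)%N -> covered S x0 k i (Kf i) (Lf i) m0 (rad i) (c * Lf i).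

Definition level_time (i : nat) : nat :=
  (params_time k (Kf i) (Lf i) (Nf i) +
   (copy_time d n (Kf i) (Lf i) (level_budget i) + 20) * (copies i).+1)%N.

Definition level_eps (i : nat) (rate : nat -> R) : R :=
  \prod_(c < copies i) expR (- (rate c * (level_budget i)%:R)).

Lemma level_eps_ge0 i rate : 0 <= level_eps i rate.
Proof. by apply: prodr_ge0 => c _; exact: expR_ge0. Qed.

Lemma params_level i (q : option M) : (i < k)%N ->
  exists NN, forall s : state, wreg s 1 = n -> exists s',
    [/\ runs d lsh S W q NN (params k (P1 i) (P2 i) (c0 i)) s s',
      regs_frame [:: 2; 3; 4; 5; 6; 7; 8]%N [:: 0; 1]%N s s', memtop s' = memtop s,
      (st_time s' <= st_time s + params_time k (Kf i) (Lf i) (Nf i))%N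
    & [/\ wreg s' 2 = Kf i, wreg s' 3 = Lf i, wreg s' 4 = copies i,
        wreg s' 6 = level_budget i
        & wreg s' 7 = (n * Lf i * Kf i)%N /\ wreg s' 8 = (copies i * Lf i)%N]].
Proof.
move=> ik; have [f1 f2 f3 f4 f5] := fits ik; have [p1 p2 p3 p4] := pos ik.
have A0 : (0 < copies i)%N by rewrite /copies muln_gt0 p1.
have [b1 b2 b3 b4] := small_lt ik p2 p3 A0 n_gt0 f2.
apply: (@params_spec R M d lsh n S W q k (P1 i) (P2 i) (c0 i) (Kf i) (Lf i) (Nf i) (is_par ik)) => //; rewrite -/(copies i); [|lia|lia].
rewrite /copies in b1 *; have : (Kf i <= n * Lf i * Kf i)%N.
  by apply: leq_pmull; rewrite muln_gt0 n_gt0.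
have : (Kf i <= copies i * Lf i)%N.
  by rewrite /copies mulnAC; apply: leq_pmull; rewrite muln_gt0 p1.
rewrite /copies; lia.
Qed.

Lemma search_level_spec i : (i < k)%N -> exists N, forall s rate,
  st_mem s = m0 -> wreg s 1 = n -> (cov -> level_covered i) -> level_rates i rate ->
  fair_run N (search_level k P1 P2 rad c0 i) s
    (fun s' => [/\ st_mem s' = m0, wreg s' 1 = n & (st_time s' <= st_time s + level_time i)%N])
    (level_eps i rate).
Proof.
move=> ik; have [f1 f2 f3 f4 f5] := fits ik; have [p1 p2 p3 p4] := pos ik.
have A0 : (0 < copies i)%N by rewrite /copies muln_gt0 p1.
have [N1 H1] := params_level (Some x0) ik.
have sc0 a : scratch k (Lf i) a -> words m0 a = 0%N by case/andP => h _; exact: scratch0.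
have [N2 H2] := @search_copies_spec R M d lsh n S W x0 k i (Kf i) (Lf i) (copies i) (level_budget i) m0
  ik p2 p3 A0 n_gt0 f2 f4 (pi i) (fun J => @tables i J ik) sc0 rad cov.
exists (maxn N1 N2).+1 => s rate sm s1 hc hl.
have [s' [r fr mt tm [e2 e3 e4 e6 [e7 e8]]]] := H1 s s1.
apply: (fair_run_after _ r); [exact: level_eps_ge0|by rewrite (proj1 fr 0%N)|].
apply: fair_run_mono (H2 s' rate _ _ _) => //.
- move=> t [fr' mt' tm']; split=> //; first by rewrite (proj1 fr' 1%N)// (proj1 fr 1%N).
  by rewrite /level_time; lia.
- by split=> //; [rewrite (memtop_mem mt)|rewrite (proj1 fr 1%N)].
- by move=> c cA cv; exact: hc.
Qed.

Definition query_time : nat := (\sum_(i < k) level_time i + 10)%N.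

(** A level entered with an answer keeps it, so the failure factors of the levels multiply and one
    good level suffices. *)
Lemma query_spec (rate : nat -> nat -> R) :
  (forall i, (i < k)%N -> cov -> level_covered i) ->
  (forall i, (i < k)%N -> level_rates i (rate i)) ->
  exists N mu, [/\ yields d lsh S W (Some x0) N (query_prog k P1 P2 rad c0) (boot n m0) mu,
     supported (fun s' => st_mem s' = m0 /\ (st_time s' <= query_time)%N) mu,
     cov -> exists wt : 'I_k -> R, mixture S x0 rad mu wt
   & wsum mu unanswered <= \prod_(i < k) level_eps i (rate i)].
Proof.
move=> hc hl.
have seqs l : (forall i, i \in l -> (i < k)%N) -> exists N, forall s,
    st_mem s = m0 -> wreg s 1 = n ->
    fair_run N (seq_of (search_level k P1 P2 rad c0) l) s
      (fun s' => st_mem s' = m0 /\ (st_time s' <= st_time s + \sum_(i <- l) level_time i + 1)%N)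
      (\prod_(i <- l) level_eps i (rate i)).
  elim: l => [|i l IH] lk.
    exists 1%N => s sm s1; rewrite !big_nil.
    by apply: (@fair_run_det _ _ _ _ _ _ _ _ _ _ _ _ _ s (tick 1 s)); [case|rewrite /= addn0| |].
  have [|N1 H1] := IH; first by move=> j jl; apply: lk; rewrite inE jl orbT.
  have ik : (i < k)%N by apply: lk; exact: mem_head.
  have [N2 H2] := search_level_spec ik.
  exists (maxn N2 N1).+1 => s sm s1; rewrite !big_cons.
  apply: fair_run_seq (H2 s (rate i) sm s1 (hc _ ik) (hl _ ik)) _.
    by rewrite big_seq; apply: prodr_ge0 => j _; exact: level_eps_ge0.
  move=> s' [sm' s1' tm']; apply: fair_run_mono (H1 s' sm' s1') => // t [tm tt]; split=> //.
  lia.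
have [|N HN] := seqs (iota 0 k); first by move=> i; rewrite mem_iota.
pose c1 : cmd R := Seq (SetW R 1 (WReg 0)) (SetW R 0 (WLit 0)).
pose b := boot n m0.
have r1 : runs d lsh S W (Some x0) (csize c1) c1 b (sexec d S W (Some x0) c1 b) by rst.
have e0 : wreg (sexec d S W (Some x0) c1 b) 0 = 0%N by rewrite /= /upd/= mod0n.
have [mu [y sm fl un]] := HN (sexec d S W (Some x0) c1 b) (erefl _) (erefl _).
exists (maxn (csize c1) N).+1, (dbind [:: (1, sexec d S W (Some x0) c1 b)] (fun=> mu)).
have -> : dbind [:: (1, sexec d S W (Some x0) c1 b)] (fun=> mu) = mu.
  rewrite /dbind /= cats0 -[RHS]map_id; apply: eq_map => -[a t] /=; by rewrite mul1r.
split.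
- have -> : mu = dbind [:: (1, sexec d S W (Some x0) c1 b)] (fun=> mu).
    rewrite /dbind /= cats0 -[LHS]map_id; apply: eq_map => -[a t] /=; by rewrite mul1r.
  apply: (yields_seq (runs_yields r1) (supported1 (Q := fun s => s = _) (erefl _))).
  by move=> _ ->; split=> //; eexists; exact: sm.
- apply: supported_mono sm => t [-> tm]; split=> //; apply: leq_trans tm _.
  by rewrite /query_time -(big_mkord xpredT level_time) /index_iota subn0 /=; lia.
- by move=> cv; have := fl cv; rewrite e0 /fair_law eqxx.
- apply: le_trans un _; rewrite /unanswered e0 eqxx mul1r.
  by rewrite -(big_mkord xpredT (fun i => level_eps i (rate i))) /index_iota subn0.
Qed.

End query_spec.

(** * Preprocessing *)

Section preprocessing_code.
Context {R : realType}.
Variables (k i : nat).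

Definition draw_sample (cc rr : R) : cmd R :=
  Seq (DrawHash (hash_cell k i (WReg 15)) cc rr)
    (Seq (Rand R 19 (WReg 7))
      (Seq (Put R (coef_cell k i (WReg 15)) (WReg 19)) (incr 15))).

Definition draw_samples (cc rr : R) : cmd R :=
  Seq (Seq (SetW R 15 (WLit 0)) (SetW R 23 (WBin Mul (WReg 8) (WReg 2))))
    (While (WLt R (WReg 15) (WReg 23)) (draw_sample cc rr)).

(** Lexicographic order on fingerprint and index: breaking ties by the index makes the ranks
    distinct. *)
Definition precedes : bexp R :=
  BAnd (RLe (RReg R 0) (RReg R 1))
    (BNot (BAnd (RLe (RReg R 1) (RReg R 0)) (BNot (WLt R (WReg 24) (WReg 15))))).

Definition rank_step : cmd R :=
  Seq (SetW R 11 (WReg 24)) (Seq (eval_hash k i (Data (WReg 11)))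
    (Seq (If precedes (incr 23) Skip) (incr 24))).

(** Each point is written directly at its rank, counted by comparing it with all points. This is
    quadratic, but it keeps only two fingerprints at a time, in registers, as reals cannot be stored
    in memory. *)
Definition place_point : cmd R :=
  Seq (SetW R 11 (WReg 15)) (Seq (eval_hash k i (Data (WReg 11)))
    (Seq (Seq (SetR 1 (RReg R 0)) (Seq (SetW R 23 (WLit 0)) (SetW R 24 (WLit 0))))
      (Seq (While (WLt R (WReg 24) (WReg 1)) rank_step)
        (Seq (Put R (table_cell k i (WBin Add (WBin Mul (WReg 9) (WReg 1)) (WReg 23))) (WReg 15))
          (incr 15))))).

Definition build_table : cmd R :=
  Seq (SetW R 15 (WLit 0))
    (Seq (While (WLt R (WReg 15) (WReg 1)) place_point) (incr 9)).

Definition build_tables : cmd R :=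
  Seq (SetW R 9 (WLit 0)) (While (WLt R (WReg 9) (WReg 8)) build_table).

End preprocessing_code.

(** * Ranks, and the permutation that sorts a table *)

Section rank.
Context {R : realType} {n : nat}.
Variable v : 'I_n -> R.

Definition before (y p : 'I_n) : bool := (v y <= v p) && ~~ ((v p <= v y) && ~~ (y < p)%N).

Lemma beforeE y p : before y p = (v y < v p) || (v y == v p) && (y < p)%N.
Proof. by rewrite /before; case: (ltgtP (v y) (v p)) => //= _; rewrite negbK. Qed.

Lemma before_trans : transitive before.
Proof.
move=> y x z; rewrite !beforeE.
move=> /orP[xy|/andP[/eqP-> xy]] /orP[yz|/andP[/eqP yz yz']].
- by rewrite (lt_trans xy yz).
- by rewrite -yz xy.
- by rewrite yz.
- by rewrite yz eqxx (ltn_trans xy yz') orbT.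
Qed.

Lemma before_irr x : before x x = false.
Proof. by rewrite beforeE ltxx ltnn andbF. Qed.

Definition rank_upto (t : nat) (p : 'I_n) : nat := (\sum_(y < n | (y < t)%N) before y p)%N.

Definition rank (p : 'I_n) : nat := rank_upto n p.

Lemma rankE p : rank p = #|[set y | before y p]%SET|.
Proof.
rewrite /rank /rank_upto -sum1_card big_mkcond [RHS]big_mkcond/=.
by apply: eq_bigr => y _; rewrite inE ltn_ord; case: before.
Qed.

Lemma rank_uptoS t p (tn : (t < n)%N) :
  rank_upto t.+1 p = (rank_upto t p + before (Ordinal tn) p)%N.
Proof.
rewrite /rank_upto (bigD1 (Ordinal tn)) ?ltnSn//= addnC; congr (_ + _)%N.
apply: eq_bigl => y; rewrite ltnS -val_eqE /=; lia.
Qed.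

Lemma rank_upto0 p : rank_upto 0 p = 0%N.
Proof. by rewrite /rank_upto big_pred0. Qed.

Lemma rank_lt p : (rank p < n)%N.
Proof.
rewrite rankE -[X in (_ < X)%N]card_ord -cardsT; apply: proper_card.
by apply/properP; split; [exact: finset.subsetT|exists p; rewrite !inE ?before_irr].
Qed.

Lemma rank_before x y : before x y -> (rank x < rank y)%N.
Proof.
move=> xy; rewrite !rankE; apply: proper_card; apply/properP; split.
  by apply/fintype.subsetP => u; rewrite !inE => ux; exact: before_trans xy.
by exists x; rewrite !inE ?before_irr.
Qed.

Lemma rank_inj : injective (fun p => Ordinal (rank_lt p)).
Proof.
move=> x y /(congr1 val) /= h; apply/eqP; apply: contraT => xy.
have : before x y || before y x.
  rewrite !beforeE; case: ltgtP => //= _.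
  by case: (ltngtP x y) => //= e; case/negP: xy; apply/eqP/val_inj.
by case/orP => /rank_before; rewrite h ltnn.
Qed.

(** The inverse of the ranking: position x of a table holds the point of rank x. *)
Definition rank_perm : {perm 'I_n} := ((perm rank_inj)^-1)%g.

Lemma rank_rank_perm x : rank (rank_perm x) = x.
Proof.
by have := permKV (perm rank_inj) x; rewrite permE => /(congr1 val).
Qed.

Lemma rank_perm_sorted (x y : 'I_n) : (x <= y)%N -> v (rank_perm x) <= v (rank_perm y).
Proof.
move=> xy; rewrite leNgt; apply/negP => lt.
have /rank_before : before (rank_perm y) (rank_perm x) by rewrite beforeE lt.
by rewrite !rank_rank_perm; lia.
Qed.

End rank.

(** * Drawing the samples of a level under a pessimistic estimator *)

Section draws.
Context {R : realType} {M : metricType R}.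
Variables (d : nat) (lsh : R -> R -> hash_family R M).
Variables (n : nat) (S : 'I_n -> M) (W : nat) (q : option M).
Variables (k i : nat) (cc rr : R).

Local Notation state := (state R M).
Local Notation exec := (exec d lsh S W q).
Local Notation sexec := (sexec d S W q).
Local Notation z := (nkinds k).
Local Notation F := (lsh cc rr).

Lemma exec_while fu b c Q s : exec fu.+1 (While b c) Q s =
  if beval S W q s b then exec fu c (exec fu (While b c) Q) (tick (bcost d b).+1 s)
  else Q (tick (bcost d b).+1 s).
Proof. by []. Qed.

Lemma exec_seq fu c1 c2 Q s : exec fu.+1 (Seq c1 c2) Q s = exec fu c1 (exec fu c2 Q) s.
Proof. by []. Qed.

Lemma exec_draw fu e c' r Q s : exec fu.+1 (DrawHash e c' r) Q s =
  (\int[hf_law (lsh c' r)]_w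
     Q (tick (d + wcost e).+1%N (set_hash (weval W s e) (hf_eval w) s)))%E.
Proof. by []. Qed.

Lemma exec_rand fu j e Q s : exec fu.+1 (Rand R j e) Q s =
  if weval W s e == 0%N then Q (set_wreg j 0%N (tick (wcost e).+1 s))
  else ((weval W s e)%:R^-1%:E * \sum_(v < weval W s e)
          Q (set_wreg j v (tick (wcost e).+1 s)))%E.
Proof. by []. Qed.

Definition level_frame (U : nat) (s s' : state) : Prop :=
  [/\ forall a, (a %% k != i)%N -> hashes (st_mem s') a = hashes (st_mem s) a,
      forall a, (a %% z != i.*2)%N -> (a %% z != i.*2.+1)%N ->
        words (st_mem s') a = words (st_mem s) a,
      (wtop s' <= maxn (wtop s) U)%N & (htop s' <= maxn (htop s) U)%N].

Lemma level_frame_refl U s : level_frame U s s.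
Proof. by split=> //; lia. Qed.

Lemma level_frame_trans U s1 s2 s3 :
  level_frame U s1 s2 -> level_frame U s2 s3 -> level_frame U s1 s3.
Proof.
move=> [a1 b1 c1 d1] [a2 b2 c2 d2]; split; [| |lia|lia].
  by move=> a h; rewrite a2// a1.
by move=> a h h'; rewrite b2// b1.
Qed.

Lemma level_frame_memtop U s s' : memtop s' = memtop s -> level_frame U s s'.
Proof. by case: s s' => ? ? ? ? ? ? [? ? ? ? ? ?] [-> -> ->]; exact: level_frame_refl. Qed.

(** The samples already stored, continued by hypothetical future ones. *)
Definition splice (t : nat) (ys xs : nat -> (M -> R) * nat) : nat -> (M -> R) * nat :=
  fun u => if (u < t)%N then ys u else xs (u - t)%N.

Hypothesis ik : (i < k)%N.
Variables (m T U : nat).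
Hypotheses (m_gt0 : (0 < m)%N) (TU : (T * z + z <= U)%N) (UW : (U < W)%N).

Definition drawn (s s' : state) : Prop :=
  regs_frame [:: 15; 19; 23]%N [::] s s' /\ level_frame U s s'.

(** The estimator bears on the samples still to be drawn, those in memory being fixed. One iteration
    unfolds one level of [pessim]: its function [g] bounds the failure once the new hash function
    and coefficient are known, and [mean_lower_bound] averages it without measurability of the
    continuation. *)
Lemma draw_loop r t s f b fuel (Q : state -> \bar R) :
  wreg s 15 = t -> wreg s 23 = T -> wreg s 7 = m -> (t + r)%N = T ->
  pessim F m r (fun xs => f (splice t (samples k i (st_mem s)) xs)) b ->
  (r + 6 <= fuel)%N -> (forall s', 0 <= Q s')%E ->
  (forall s', drawn s s' -> (1 - f (samples k i (st_mem s')))%:E <= Q s')%E ->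
  ((1 - b)%:E <= exec fuel (While (WLt R (WReg 15) (WReg 23)) (draw_sample k i cc rr)) Q s)%E.
Proof.
elim: r t s f b fuel Q => [|r IH] t s f b fuel Q s15 s23 s7 tr ps lf Q0 HQ.
  case: fuel lf => // fuel _; rewrite /= s15 s23 -tr addn0 ltnn.
  apply: le_trans (HQ _ _); last by split; [by []|exact: level_frame_refl].
  rewrite lee_fin lerD2l lerN2; apply: le_trans (ps (sshift t (samples k i (st_mem s)))).
  rewrite le_eqVlt; apply/orP; left; apply/eqP; congr f; apply: funext => u.
  by rewrite /splice /sshift; case: ltnP => // ut; rewrite subnKC.
have [g [g0 mg hg ib]] := ps.
have [fu efu] : exists fu, fuel = fu.+4.+1 by exists (fuel - 5)%N; lia.
rewrite {}efu in lf *.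
have tT : (t < T)%N by lia.
have tU : (t * z + z <= U)%N.
  by apply: leq_trans TU; rewrite leq_add2r leq_mul2r (ltnW tT) orbT.
have kz : (k < z)%N by rewrite /nkinds; lia.
have i2z : (i.*2 < z)%N by rewrite /nkinds; lia.
have tk : (t * k <= t * z)%N by rewrite leq_mul2l (ltnW kz) orbT.
have tt : (t <= t * k)%N by apply: leq_pmulr; lia.
rewrite exec_while [Defs.beval _ _ _ _ _]/= s15 s23 tT [Defs.bcost _ _]/=.
set Q' := exec fu.+4 (While _ _) Q.
pose s1 (w : hf_seed F) := tick (d + wcost (hash_cell k i (WReg 15))).+1%N
     (set_hash (t * k + i)%N (hf_eval w) (tick 4 s)).
pose s2 (w : hf_seed F) v := sexec (Seq (Put R (coef_cell k i (WReg 15)) (WReg 19)) (incr 15))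
     (set_wreg 19 v (tick 2 (s1 w))).
have -> : exec fu.+4 (draw_sample k i cc rr) Q' (tick 4 s) =
   (\int[hf_law F]_w (m%:R^-1%:E * (\sum_(v < m) Q' (s2 w v)))%E)%E.
  rewrite /draw_sample exec_seq exec_draw.
  apply: eq_integral => w _.
  have -> : weval W (tick 4 s) (hash_cell k i (WReg 15)) = (t * k + i)%N.
    by rewrite /= s15; nomod.
  rewrite -/(s1 w).
  by rewrite exec_seq exec_rand [weval _ _ _]/= s7 gtn_eqF//; congr (_ * _)%E.
have hs2 w v : (v < m)%N -> [/\ drawn s (s2 w v), wreg (s2 w v) 15 = t.+1 &
    samples k i (st_mem (s2 w v)) =
    upd (samples k i (st_mem s)) t (hf_eval w, v)].
  move=> vm; split.
  - split; first split.
    + by move=> x; rewrite !inE /s2 /= /upd/= => /norP[/negbTE -> /norP[/negbTE -> _]].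
    + by [].
    split.
    + move=> a ai; rewrite /s2 /s1 /= /upd; case: eqP => // e.
      by move: ai; rewrite e modnMDl modn_small// eqxx.
    + move=> a ai _; rewrite /s2 /= /upd/= s15; nomod; case: eqP => // e.
      by move: ai; rewrite e modnMDl modn_small// eqxx.
    + by rewrite /s2 /= /upd/= s15; nomod; lia.
    + by rewrite /s2 /s1 /=; lia.
  - by rewrite /s2 /= /upd/= s15; nomod; lia.
  - apply: funext => u; rewrite /samples /s2 /s1 /= /upd/= s15; nomod.
    have -> : (u * k + i == t * k + i)%N = (u == t).
      by rewrite eqn_add2r eqn_mul2r; case: eqP => // ?; lia.
    have -> : (u * z + i.*2 == t * z + i.*2)%N = (u == t).
      by rewrite eqn_add2r eqn_mul2r; case: eqP => // ?; lia.
    by case: eqP.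
apply: (@mean_lower_bound _ _ F m m_gt0 g (fun w v => Q' (s2 w v)) b g0 mg ib).
  by move=> w v; apply: exec_ge0.
move=> w v vm; have [dr e15 es] := hs2 w v vm; have [fr lfr] := dr.
apply: (IH t.+1 (s2 w v) f) => //; try by rewrite (proj1 fr).
- by lia.
- apply: pessim_le (hg w v) => // xs; rewrite le_eqVlt; apply/orP; left; apply/eqP; congr f.
  apply: funext => u; rewrite es /splice /upd ltnS; case: (ltngtP u t) => ut //.
  + have -> : (u - t = (u - t.+1).+1)%N by lia.
    by [].
  + by rewrite ut subnn.
- move=> s' [fr' lfr']; apply: HQ; split; last exact: level_frame_trans lfr'.
  by apply: regs_frame_trans fr fr' _ _ _ _.
Qed.

Lemma draw_samples_spec s f b fuel (Q : state -> \bar R) G K :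
  wreg s 8 = G -> wreg s 2 = K -> (G * K)%N = T -> wreg s 7 = m ->
  pessim F m T f b ->
  (T + 8 <= fuel)%N -> (forall s', 0 <= Q s')%E ->
  (forall s', drawn s s' -> (1 - f (samples k i (st_mem s')))%:E <= Q s')%E ->
  ((1 - b)%:E <= exec fuel (draw_samples k i cc rr) Q s)%E.
Proof.
move=> s8 s2 GK s7 ps lf Q0 HQ.
have [fu efu] : exists fu, fuel = fu.+3 by exists (fuel - 3)%N; lia.
rewrite {}efu in lf *.
rewrite /draw_samples; set c := Seq (SetW R 15 (WLit 0)) _.
have r : runs d lsh S W q 2 c s (sexec c s) by rst.
rewrite exec_seq r//; have TW : (T < W)%N.
  apply: leq_ltn_trans UW; apply: leq_trans TU; apply: leq_trans (leq_addr _ _).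
  by apply: leq_pmulr; rewrite /nkinds; lia.
apply: (@draw_loop T 0 (sexec c s) f b) => //.
- by rewrite /= /upd/= mod0n.
- by rewrite /= /upd/= s8 s2 GK modn_small.
- by apply: pessim_le ps => // xs; rewrite /splice; under eq_fun do rewrite subn0.
- by lia.
move=> s' [fr lfr]; apply: HQ; split.
  by apply: regs_frame_trans (sexec_frame d S W q c s) fr _ _ _ _.
by apply: level_frame_trans lfr; exact: level_frame_memtop.
Qed.

End draws.

(** * Building the sorted tables *)

Section tables.
Context {R : realType} {M : metricType R}.
Variables (d : nat) (lsh : R -> R -> hash_family R M).
Variables (n : nat) (S : 'I_n -> M) (W : nat) (q : option M).

Local Notation state := (state R M).
Local Notation runs := (runs d lsh S W q).
Local Notation sexec := (sexec d S W q).
Local Notation beval := (beval S W q).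
Local Notation bcost := (@bcost R d).

Variables (k i K L A : nat).
Hypotheses (ik : (i < k)%N) (K_gt0 : (0 < K)%N) (L_gt0 : (0 < L)%N).
Hypotheses (A_gt0 : (0 < A)%N) (n_gt0 : (0 < n)%N).
Local Notation z := (nkinds k).
Hypothesis HW : ((A * L * (K + n) + L + 3) * z < W)%N.

Let z_gt1 : (1 < z)%N.
Proof. by rewrite /nkinds; lia. Qed.

Let i2z : (i.*2.+1 < z)%N. Proof. by rewrite /nkinds; lia. Qed.

Let zW : (z < W)%N.
Proof. by have := cell_lt ik K_gt0 L_gt0 A_gt0 n_gt0 HW (leq0n _); rewrite mul0n. Qed.

Let zmod x := cell_mod ik K_gt0 L_gt0 A_gt0 n_gt0 HW x.

Let nW : (n.+1 < W)%N.
Proof.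
apply: leq_ltn_trans HW; apply: leq_trans (leq_pmulr _ _); last lia.
have : (n <= A * L * (K + n))%N by apply: leq_trans (leq_pmull _ _); lia.
by lia.
Qed.

Local Notation th m J p := (table_hash k i K m J (S p)).

Lemma hash_point_spec : exists N, forall (s : state) J (p : 'I_n),
  wreg s 2 = K -> wreg s 9 = J -> (J < A * L)%N -> wreg s 11 = p -> exists s',
  [/\ runs N (eval_hash k i (Data (WReg 11))) s s',
    regs_frame [:: 10%N] [:: 0%N] s s', memtop s' = memtop s
    & rreg s' 0 = th (st_mem s) J p].
Proof.
have [N HN] := @eval_hash_spec R M d lsh n S W q k i K (Data (WReg 11)) K_gt0 ik zW (or_intror (erefl _)).
exists N => s J p s2 s9 JA s11.
have [||s' [r fr mt _ v]] := HN s J (S p) s2 s9; last by exists s'.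
- exact: (hash_index_lt ik K_gt0 L_gt0 A_gt0 n_gt0 HW).
- exact: peval_data.
Qed.

Lemma rank_loop : exists N, forall (s : state) J (p : 'I_n),
  wreg s 1 = n -> wreg s 2 = K -> wreg s 9 = J -> (J < A * L)%N -> wreg s 15 = p ->
  wreg s 23 = 0%N -> wreg s 24 = 0%N -> rreg s 1 = th (st_mem s) J p -> exists s',
  [/\ runs N (While (WLt R (WReg 24) (WReg 1)) (rank_step k i)) s s',
    regs_frame [:: 10; 11; 23; 24]%N [:: 0%N] s s', memtop s' = memtop s
    & wreg s' 23 = rank (fun p => th (st_mem s) J p) p].
Proof.
have [N HN] := hash_point_spec.
eexists => s J p s1 s2 s9 JA s15 s23 s24 r1.
set v := fun p => th (st_mem s) J p.
pose I t := [/\ regs_frame [:: 10; 11; 23; 24]%N [:: 0%N] s t, memtop t = memtop s,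
  (wreg t 24 <= n)%N & wreg t 23 = rank_upto v (wreg t 24) p].
have rle x y : (rank_upto v x y <= n)%N.
  rewrite /rank_upto (@leq_trans (\sum_(u < n | u < x) 1)%N)//.
    by apply: leq_sum => u _; case: before.
  by rewrite sum1_card (leq_trans (max_card _))// card_ord.
have step t : I t -> beval t (WLt R (WReg 24) (WReg 1)) -> exists t',
    [/\ runs (maxn 1 (maxn N (maxn 2 1).+1).+1).+1 (rank_step k i) (tick 4 t) t', I t' & (n - wreg t' 24 < n - wreg t 24)%N].
  move=> [fr mt le e23]; rewrite /= (proj1 fr 1%N)// s1 => lt.
  pose t1 := sexec (SetW R 11 (WReg 24)) (tick 4 t).
  have [||||t2 [ru fr2 mt2 v2]] := HN t1 J (Ordinal lt) => //.
  - by rewrite /= /upd/= (proj1 fr 2%N).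
  - by rewrite /= /upd/= (proj1 fr 9%N).
  rewrite (memtop_mem mt) in v2.
  have fr1 : regs_frame [:: 10; 11; 23; 24]%N [:: 0%N] s t2.
    have fr1 : regs_frame [:: 10; 11; 23; 24]%N [:: 0%N] s t1.
      by apply: regs_frame_trans fr (sexec_frame d S W q (SetW R 11 (WReg 24)) (tick 4 t)) _ _ _ _.
    by apply: regs_frame_trans fr1 fr2 _ _ _ _.
  pose c3 : cmd R := If (precedes (R:=R)) (incr 23) Skip.
  pose t3 := sexec c3 t2.
  pose t4 := sexec (incr 24) t3.
  have u24 : wreg t2 24 = wreg t 24 by rewrite (proj1 fr2 24%N).
  have u23 : wreg t2 23 = wreg t 23 by rewrite (proj1 fr2 23%N).
  have u15 : wreg t2 15 = p by rewrite (proj1 fr1 15%N).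
  have pr : beval t2 (precedes (R:=R)) = before v (Ordinal lt) p.
    by rewrite /= v2 (proj2 fr1 1%N)// r1 u24 u15.
  have e3 : wreg t3 23 = (rank_upto v (wreg t 24).+1 p)%N /\ wreg t3 24 = wreg t 24.
    have -> : t3 = if beval t2 (precedes (R:=R)) then sexec (incr 23) (tick (bcost (precedes (R:=R))).+1 t2)
                   else sexec Skip (tick (bcost (precedes (R:=R))).+1 t2) by [].
    rewrite pr (rank_uptoS _ _ lt) -e23.
    case: ifP => _; rewrite /= /upd/= u23 u24; split=> //; last by rewrite addn0.
    have := rle (wreg t 24).+1 p; rewrite (rank_uptoS _ _ lt) -e23 => h.
    by nomod.
  have f24 : wreg t4 24 = (wreg t 24).+1 by rewrite /= /upd/= (proj2 e3); nomod; rewrite addn1.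
  exists t4; split.
  - apply: runs_seq; first rst.
    apply: runs_seq; first exact: ru.
    by apply: runs_seq; rst.
  - split.
    + apply: regs_frame_trans fr1 (sexec_frame d S W q (Seq c3 (incr 24)) t2) _ _ _ _ => //.
    + by rewrite /t4 /t3 !sexec_memtop// mt2.
    + by rewrite f24.
    + by rewrite f24 -(proj1 e3).
  - by rewrite f24; lia.
have I0 : I s by split=> //; rewrite ?s24 ?s23 ?rank_upto0.
have V0 : (n - wreg s 24 <= n)%N by lia.
have [t [r [fr mt le e23] gf]] := runs_while step I0 V0.
have e24 : wreg t 24 = n.
  by move: gf; rewrite /= (proj1 fr 1%N)// s1; lia.
exists (tick 4 t); split; [exact: r|by []|by []|by rewrite /= e23 e24].
Qed.

(** Writes are confined to table [J] of level [i]. Coefficients are thus untouched, and the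
    fingerprints computed while sorting agree with those read later. *)
Definition placed (J t : nat) (s s' : state) : Prop :=
  [/\ hashes (st_mem s') = hashes (st_mem s),
      forall a, ~~ ((a %% z == i.*2.+1) && (J * n <= a %/ z < J.+1 * n))%N ->
        words (st_mem s') a = words (st_mem s) a,
      forall p : 'I_n, (p < t)%N ->
        words (st_mem s') ((J * n + rank (fun p => th (st_mem s) J p) p) * z + i.*2.+1)%N = p
    & (wtop s' <= maxn (wtop s) (A * L * n * z))%N /\ htop s' = htop s].

Lemma samples_frame (m m' : memory R M) : hashes m' = hashes m ->
  (forall a, (a %% z != i.*2.+1)%N -> words m' a = words m a) ->
  samples k i m' = samples k i m.
Proof.
move=> hh hw; apply: funext => u; rewrite /samples hh hw//.
rewrite (proj1 (@zmod u i.*2 _)) ?neq_ltn ?ltnSn//; lia.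
Qed.

Lemma placed_samples J t s s' : placed J t s s' ->
  samples k i (st_mem s') = samples k i (st_mem s).
Proof. by case=> h1 h2 _ _; apply: samples_frame => // a an; apply: h2; rewrite negb_and an. Qed.

Lemma build_table_spec : exists N, forall (s : state) J,
  wreg s 1 = n -> wreg s 2 = K -> wreg s 9 = J -> (J < A * L)%N -> exists s',
  [/\ runs N (build_table k i) s s',
    regs_frame [:: 9; 10; 11; 15; 23; 24]%N [:: 0; 1]%N s s', wreg s' 9 = J.+1
    & placed J n s s'].
Proof.
have [N1 H1] := hash_point_spec; have [N2 H2] := rank_loop.
set ws := [:: 10; 11; 15; 23; 24]%N.
eexists => s J s1 s2 s9 JA.
set v := fun p => th (st_mem s) J p.
pose I t := [/\ regs_frame ws [:: 0; 1]%N s t, (wreg t 15 <= n)%N & placed J (wreg t 15) s t].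
pose c1 : cmd R := SetW R 11 (WReg 15).
pose c3 : cmd R := Seq (SetR 1 (RReg R 0)) (Seq (SetW R 23 (WLit 0)) (SetW R 24 (WLit 0))).
pose c5 : cmd R := Seq (Put R (table_cell k i (WBin Add (WBin Mul (WReg 9) (WReg 1)) (WReg 23))) (WReg 15)) (incr 15).
have tW (x : 'I_n) : ((J * n + x) * z + z < W)%N by have [] := table_index_lt ik K_gt0 L_gt0 A_gt0 n_gt0 HW JA (ltn_ord x).
have step t : I t -> beval t (WLt R (WReg 15) (WReg 1)) -> exists t',
    [/\ runs (maxn (csize c1) (maxn N1 (maxn (csize c3) (maxn N2 (csize c5)).+1).+1).+1).+1
          (place_point k i) (tick 4 t) t', I t' & (n - wreg t' 15 < n - wreg t 15)%N].
  move=> [fr le pl]; rewrite /= (proj1 fr 1%N)// s1 => lt.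
  set p := Ordinal lt.
  pose t1 := sexec c1 (tick 4 t).
  have es := placed_samples pl.
  have [||||t2 [ru2 fr2 mt2 v2]] := H1 t1 J p => //.
  - by rewrite /= /upd/= (proj1 fr 2%N).
  - by rewrite /= /upd/= (proj1 fr 9%N).
  have fr02 : regs_frame ws [:: 0; 1]%N s t2.
    have fr01 : regs_frame ws [:: 0; 1]%N s t1.
      by apply: regs_frame_trans fr (sexec_frame d S W q c1 (tick 4 t)) _ _ _ _.
    by apply: regs_frame_trans fr01 fr2 _ _ _ _.
  pose t3 := sexec c3 t2.
  have fr03 : regs_frame ws [:: 0; 1]%N s t3.
    by apply: regs_frame_trans fr02 (sexec_frame d S W q c3 t2) _ _ _ _.
  have th3 x : th (st_mem t2) J x = v x.
    by rewrite /table_hash (memtop_mem mt2) /v /table_hash -es.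
  have u15 : wreg t3 15 = p by rewrite /= /upd/= (proj1 fr2 15%N).
  have [||||||||t4 [ru4 fr4 mt4 e4]] := H2 t3 J p => //.
  - by rewrite (proj1 fr03 1%N).
  - by rewrite (proj1 fr03 2%N).
  - by rewrite (proj1 fr03 9%N).
  - by rewrite /= /upd/= mod0n.
  - by rewrite /= /upd/= mod0n.
  - by rewrite /= /upd/= v2 (memtop_mem mt2).
  have {}e4 : wreg t4 23 = rank v p.
    by rewrite e4; congr rank; apply: funext => x; rewrite -th3.
  pose t5 := sexec c5 t4.
  have fr04 : regs_frame ws [:: 0; 1]%N s t4 by apply: regs_frame_trans fr03 fr4 _ _ _ _.
  have fr05 : regs_frame ws [:: 0; 1]%N s t5.
    by apply: regs_frame_trans fr04 (sexec_frame d S W q c5 t4) _ _ _ _.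
  have w15 : wreg t4 15 = p by rewrite (proj1 fr4 15%N).
  have m4 : memtop t4 = memtop t by rewrite mt4 sexec_memtop// mt2 sexec_memtop.
  have rn := rank_lt v p.
  have tp := tW (Ordinal rn); rewrite /= in tp.
  have Jn : (J * n + rank v p <= (J * n + rank v p) * z)%N by apply: leq_pmulr; lia.
  have e5 : wreg t5 15 = (wreg t 15).+1.
    by rewrite /= /upd/= w15 /=; nomod; rewrite addn1.
  have m5 : memtop t5 = (Memory (upd (words (st_mem t)) ((J * n + rank v p) * z + i.*2.+1)%N p)
       (hashes (st_mem t)), maxn (wtop t) ((J * n + rank v p) * z + i.*2.+1).+1, htop t).
    case: m4 => m4 m4' m4''; rewrite /memtop /t5 /= m4 m4' m4'' /upd/= e4 w15.
    by rewrite (proj1 fr04 9%N)// s9 (proj1 fr04 1%N)// s1; nomod.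
  exists t5; split.
  - apply: runs_seq; first rst.
    apply: runs_seq; first exact: ru2.
    apply: runs_seq; first rst.
    by apply: runs_seq; [exact: ru4|rst].
  - split=> //; first by rewrite e5.
    rewrite e5; have w5 : wtop t5 = _ := congr1 (fun x => x.1.2) m5; have h5 : htop t5 = _ := congr1 snd m5.
    have {}m5 : st_mem t5 = _ := congr1 (fun x => x.1.1) m5; case: (pl) => pl1 pl2 pl3 [pl4 pl5]; split.
    + by rewrite m5.
    + move=> a an; rewrite m5 /= /upd; case: eqP => [e|_]; last exact: pl2.
      move: an; rewrite e (proj1 (zmod _ i2z)) (proj2 (zmod _ i2z)) eqxx/= mulSn; lia.
    + move=> p' pt; rewrite m5 /= /upd (cell_inj ik K_gt0 L_gt0 A_gt0 n_gt0 HW)// eqxx andbT eqn_add2l.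
      have [e|ne] := eqVneq (rank v p') (rank v p).
        by rewrite (@rank_inj _ _ v p' p)//; exact: val_inj.
      apply: pl3; rewrite ltn_neqAle -ltnS pt andbT; apply: contra ne => /eqP e.
      by have -> : p' = p by exact: val_inj.
    + rewrite h5 w5 /=; split=> //.
      have : ((J * n + rank v p) * z + i.*2.+2 <= A * L * n * z)%N; last lia.
      apply: (@leq_trans ((J * n + rank v p) * z + z)); first by rewrite leq_add2l.
      rewrite -mulSnr leq_mul2r; apply/orP; right.
      apply: (@leq_trans (J.+1 * n)); first by rewrite mulSnr; lia.
      by rewrite leq_mul2r JA orbT.
  - by rewrite e5; lia.
pose t0 := sexec (SetW R 15 (WLit 0)) s.
have I0 : I t0.
  split=> //.
  - by apply: regs_frame_sub (sexec_frame d S W q (SetW R 15 (WLit 0)) s) _ _.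
  - by rewrite /= /upd/= mod0n.
  - by split=> //=; rewrite /upd/= ?mod0n //; split=> //; lia.
have V0 : (n - wreg t0 15 <= n)%N by lia.
have [t [r [fr le pl] gf]] := runs_while step I0 V0.
have e15 : wreg t 15 = n by move: gf; rewrite /= (proj1 fr 1%N)// s1; lia.
have JW : (J + 1 < W)%N.
  have := tW (Ordinal n_gt0); rewrite /= addn0 => h; apply: leq_ltn_trans h.
  rewrite -mulnA; have : (J <= J * (n * z))%N by apply: leq_pmulr; rewrite muln_gt0 n_gt0; lia.
  by lia.
have e9 : wreg t 9 = J by rewrite (proj1 fr 9%N).
exists (sexec (incr 9) (tick 4 t)); split.
- apply: runs_seq; first rst.
  by apply: runs_seq; [exact: r|rst].
- by apply: regs_frame_trans fr (sexec_frame d S W q (incr 9) (tick 4 t)) _ _ _ _.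
- by rewrite /= /upd/= e9; nomod; rewrite addn1.
- by move: pl; rewrite e15.
Qed.

Lemma placed_sorted J s s' : placed J n s s' ->
  table_sorted S k i K (st_mem s') J (rank_perm (fun p => th (st_mem s) J p)).
Proof.
move=> pl; have es := placed_samples pl; case: pl => _ _ h _.
set v := fun p => th (st_mem s) J p; split.
  by move=> x; rewrite -[in LHS](rank_rank_perm v x) h.
by move=> x y xy; rewrite /table_hash es; exact: (rank_perm_sorted v).
Qed.

Lemma build_tables_spec U : (A * L * n * z <= U)%N -> exists N, forall (s : state),
  wreg s 1 = n -> wreg s 2 = K -> wreg s 8 = (A * L)%N -> exists s',
  [/\ runs N (build_tables k i) s s',
    regs_frame [:: 9; 10; 11; 15; 23; 24]%N [:: 0; 1]%N s s',
    level_frame k i U s s', samples k i (st_mem s') = samples k i (st_mem s)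
    & forall J, (J < A * L)%N -> exists pi, table_sorted S k i K (st_mem s') J pi].
Proof.
move=> hU; have [N HN] := build_table_spec.
set ws := [:: 9; 10; 11; 15; 23; 24]%N.
eexists => s s1 s2 s8.
pose I t := [/\ regs_frame ws [:: 0; 1]%N s t, level_frame k i U s t,
  samples k i (st_mem t) = samples k i (st_mem s), (wreg t 9 <= A * L)%N &
  forall J, (J < wreg t 9)%N -> exists pi, table_sorted S k i K (st_mem t) J pi].
have step t : I t -> beval t (WLt R (WReg 9) (WReg 8)) -> exists t',
    [/\ runs N (build_table k i) (tick 4 t) t', I t' & (A * L - wreg t' 9 < A * L - wreg t 9)%N].
  move=> [fr lf es le so]; rewrite /= (proj1 fr 8%N)// s8 => lt.
  have [||t' [ru fr' e9 pl]] := HN (tick 4 t) (wreg t 9) _ _ (erefl _) lt.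
  - by rewrite /= (proj1 fr 1%N).
  - by rewrite /= (proj1 fr 2%N).
  exists t'; split=> //; last by rewrite e9; lia.
  have es' := placed_samples pl.
  have [p1 p2 p3 [p4 p5]] := pl.
  split=> //.
  - by apply: regs_frame_trans fr fr' _ _ _ _.
  - apply: level_frame_trans lf _; split.
    + by move=> a _; rewrite p1.
    + by move=> a a1 a2; rewrite p2// negb_and a2.
    + by move: p4 => /=; lia.
    + by rewrite p5 /=; lia.
  - by rewrite es' es.
  - by rewrite e9.
  - move=> J; rewrite e9 ltnS leq_eqVlt => /orP[/eqP -> | JJ].
      by eexists; exact: (placed_sorted pl).
    have [pi [h1 h2]] := so J JJ; exists pi; split.
      move=> x; rewrite p2 ?h1//= (proj1 (zmod _ i2z)) (proj2 (zmod _ i2z)) eqxx/=.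
      have : (J.+1 * n <= wreg t 9 * n)%N by rewrite leq_mul2r JJ orbT.
      by rewrite mulSn; have := ltn_ord x; lia.
    by move=> x y xy; rewrite /table_hash es'; exact: h2.
pose t0 := sexec (SetW R 9 (WLit 0)) s.
have I0 : I t0.
  split=> //.
  - by apply: regs_frame_sub (sexec_frame d S W q (SetW R 9 (WLit 0)) s) _ _.
  - by apply: level_frame_memtop.
  - by rewrite /= /upd/= mod0n.
  - by move=> J; rewrite /= /upd/= mod0n.
have V0 : (A * L - wreg t0 9 <= A * L)%N by lia.
have [t [r [fr lf es le so] gf]] := runs_while step I0 V0.
have e9 : wreg t 9 = (A * L)%N by move: gf; rewrite /= (proj1 fr 8%N)// s8; lia.
exists (tick 4 t); split=> //.
- by apply: runs_seq; [rst|exact: r].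
- by move=> J JA; apply: so; rewrite e9.
Qed.

End tables.

Section preprocessing_prog.
Context {R : realType}.
Variables (k : nat) (cc : R) (P1 P2 rad : nat -> R) (c0 : nat -> nat).

Definition pre_level (i : nat) : cmd R :=
  Seq (params k (P1 i) (P2 i) (c0 i))
    (Seq (draw_samples k i cc (rad i)) (build_tables k i)).

Definition pre_prog : cmd R :=
  Seq (SetW R 1 (WReg 0)) (seq_of pre_level (iota 0 k)).

End preprocessing_prog.

Section preprocessing_spec.
Context {R : realType} {M : metricType R}.
Variables (d : nat) (lsh : R -> R -> hash_family R M).
Variables (n : nat) (S : 'I_n -> M) (W : nat).

Local Notation state := (state R M).
Local Notation exec := (exec d lsh S W None).
Local Notation sexec := (sexec d S W None).

Variables (k : nat) (cc : R) (P1 P2 rad : nat -> R) (c0 Kf Lf Nf : nat -> nat).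
Local Notation z := (nkinds k).
Local Notation copies := (copies c0 Kf).

Hypothesis n_gt0 : (0 < n)%N.
Hypothesis is_par : forall i, (i < k)%N -> is_params n k (P1 i) (P2 i) (Kf i) (Lf i) (copies i) (Nf i).
Hypothesis fits : forall i, (i < k)%N -> level_fits n W k c0 Kf Lf Nf i.
Hypothesis pos : forall i, (i < k)%N -> level_positive c0 Kf Lf Nf i.
Variable U : nat.
Hypothesis UW : (U < W)%N.
Hypothesis level_space : forall i, (i < k)%N ->
  ((copies i * Lf i * (Kf i + n) + 1) * z <= U)%N.

Definition level_ready (m : memory R M) (i : nat) : Prop :=
  forall J, (J < copies i * Lf i)%N -> exists pi, table_sorted S k i (Kf i) m J pi.

(** With coefficients below n L K, the false collisions of the K steps of a fingerprint amount to at
    most 1 / (n L). *)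
Definition level_estimator (i : nat) : ((nat -> (M -> R) * nat) -> R) -> R -> Prop :=
  pessim (lsh cc (rad i)) (n * Lf i * Kf i) (copies i * Lf i * Kf i).

Lemma pre_level_spec i : (i < k)%N -> exists N, forall (s : state) f b fuel (Q : state -> \bar R),
  wreg s 1 = n -> level_estimator i f b -> (N <= fuel)%N -> (forall s', 0 <= Q s')%E ->
  (forall s', wreg s' 1 = n -> level_frame k i U s s' -> level_ready (st_mem s') i ->
    (1 - f (samples k i (st_mem s')))%:E <= Q s')%E ->
  ((1 - b)%:E <= exec fuel (pre_level k cc P1 P2 rad c0 i) Q s)%E.
Proof.
move=> ik; have [f1 f2 f3 f4 f5] := fits ik; have [p1 p2 p3 p4] := pos ik.
have A0 : (0 < copies i)%N by rewrite /copies muln_gt0 p1.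
have [N1 H1] := params_level d lsh S n_gt0 is_par fits pos None ik.
have U1 : (copies i * Lf i * n * z <= U)%N.
  apply: leq_trans (level_space ik); rewrite leq_mul2r mulnDr; apply/orP; right; lia.
have U2 : (copies i * Lf i * Kf i * z + z <= U)%N.
  apply: leq_trans (level_space ik); rewrite -mulSnr leq_mul2r mulnDr; apply/orP; right; lia.
have m0 : (0 < n * Lf i * Kf i)%N by rewrite !muln_gt0 n_gt0 p3.
have [N2 H2] := build_tables_spec d lsh S None ik p2 p3 A0 n_gt0 f2 U1.
exists (maxn N1 (maxn (copies i * Lf i * Kf i + 8) N2).+1).+1 => s f b fuel Q s1 es.
case: fuel => // fuel; rewrite ltnS geq_max => /andP[l1]; case: fuel l1 => // fuel l1.
rewrite ltnS geq_max => /andP[l2 l3] Q0 HQ.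
have [s' [r fr mt _ [e2 e3 e4 e6 [e7 e8]]]] := H1 s s1.
rewrite /pre_level exec_seq r// exec_seq.
apply: (@draw_samples_spec R M d lsh n S W None k i cc (rad i) ik _ _ U m0 U2 UW
  s' f b fuel _ _ _ e8 e2 (erefl _) e7 es l2).
  by move=> t; exact: exec_ge0.
move=> t [frt lft].
have [|||t' [r' fr' lf' ss' so]] := H2 t.
- by rewrite (proj1 frt 1%N)// (proj1 fr 1%N).
- by rewrite (proj1 frt 2%N).
- by rewrite (proj1 frt 8%N).
rewrite r'// -ss'; apply: HQ.
- by rewrite (proj1 fr' 1%N)// (proj1 frt 1%N)// (proj1 fr 1%N).
- apply: level_frame_trans (level_frame_trans lft lf').
  exact: level_frame_memtop.
- exact: so.
Qed.

Definition levels_frame (l : seq nat) (s s' : state) : Prop :=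
  [/\ forall a, (a %% k)%N \notin l -> hashes (st_mem s') a = hashes (st_mem s) a,
      forall a, (a %% z)./2 \notin l -> words (st_mem s') a = words (st_mem s) a,
      (wtop s' <= maxn (wtop s) U)%N & (htop s' <= maxn (htop s) U)%N].

Lemma level_levels_frame i l s1 s2 s3 :
  level_frame k i U s1 s2 -> levels_frame l s2 s3 -> levels_frame (i :: l) s1 s3.
Proof.
move=> [a1 b1 c1 d1] [a2 b2 c2 d2]; split; [| |lia|lia].
  by move=> a; rewrite inE => /norP[h h']; rewrite a2// a1.
move=> a; rewrite inE => /norP[h h']; rewrite b2// b1//; apply: contra h => /eqP ->; lia.
Qed.

Lemma levels_frame_samples i l s s' : (i < k)%N -> i \notin l -> levels_frame l s s' ->
  samples k i (st_mem s') = samples k i (st_mem s).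
Proof.
move=> ik il [h1 h2 _ _]; apply: funext => u; rewrite /samples h1 ?h2//.
  by rewrite modnMDl modn_small ?doubleK// /nkinds; lia.
by rewrite modnMDl modn_small.
Qed.

Lemma levels_frame_ready i l s s' : (i < k)%N -> i \notin l -> levels_frame l s s' ->
  level_ready (st_mem s) i -> level_ready (st_mem s') i.
Proof.
move=> ik il lf h J JA; have [pi [h1 h2]] := h J JA; exists pi.
have es := levels_frame_samples ik il lf.
split; last by move=> x y xy; rewrite /table_hash es; exact: h2.
move=> x; case: lf => _ hw _ _; rewrite hw//.
rewrite modnMDl modn_small; last by rewrite /nkinds; lia.
by have -> : i.*2.+1./2 = i by lia.
Qed.

(** A union bound over levels sampled one after the other: while one level is drawn the later ones
    are represented by their constants [b], and the value it reaches is then frozen into [e]. No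
    joint law of the levels is involved. *)
Lemma pre_levels_spec l : uniq l -> (forall i, i \in l -> (i < k)%N) ->
  exists N, forall (s : state) f b e fuel (Q : state -> \bar R),
  wreg s 1 = n -> (N <= fuel)%N -> (forall s', 0 <= Q s')%E -> 0 <= e ->
  (forall i, i \in l -> level_estimator i (f i) (b i)) ->
  (forall i xs, 0 <= f i xs) -> (forall i, 0 <= b i) ->
  (forall s', levels_frame l s s' ->
     (forall i, i \in l -> level_ready (st_mem s') i) ->
    (1 - (e + \sum_(i <- l) f i (samples k i (st_mem s'))))%:E <= Q s')%E ->
  ((1 - (e + \sum_(i <- l) b i))%:E <=
    exec fuel (seq_of (pre_level k cc P1 P2 rad c0) l) Q s)%E.
Proof.
elim: l => [|i l IH] ul lk.
  exists 1%N => s f b e [//|fuel] Q s1 _ Q0 e0 _ _ _ HQ.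
  rewrite /= big_nil; apply: le_trans (HQ _ _ _) => //; first by rewrite big_nil.
  by split=> //=; lia.
move: ul => /= /andP[il ul].
have [//||N2 H2] := IH; first by move=> j jl; apply: lk; rewrite inE jl orbT.
have ik : (i < k)%N by apply: lk; exact: mem_head.
have [N1 H1] := pre_level_spec ik.
exists (maxn N1 N2).+1 => s f b e [//|fuel] Q s1; rewrite ltnS geq_max => /andP[l1 l2] Q0 e0 es f0 b0 HQ.
rewrite [seq_of _ _]/= exec_seq big_cons.
have B0 : 0 <= e + \sum_(j <- l) b j by rewrite addr_ge0// sumr_ge0.
rewrite addrCA addrC addrC.
apply: (H1 s (fun xs => f i xs + (e + \sum_(j <- l) b j)) _ fuel _ s1 _ l1).
- apply: pessimD; first by apply: es; exact: mem_head.
  apply: pessim_cst => //; rewrite !muln_gt0 n_gt0.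
  by have [p1 p2 p3 p4] := pos ik; rewrite p2 p3.
- by move=> t; exact: exec_ge0.
move=> t t1 lf rd; rewrite addrA.
apply: (H2 t f b _ fuel Q t1 l2 Q0) => //.
- by rewrite addr_ge0.
- by move=> j jl; apply: es; rewrite inE jl orbT.
move=> t' lf' rd'.
have := HQ t' (level_levels_frame lf lf').
rewrite big_cons (levels_frame_samples ik il lf') (addrC (f i _)) -addrA; apply.
move=> j; rewrite inE => /orP[/eqP ->|jl]; last exact: rd'.
exact: levels_frame_ready lf' rd.
Qed.

Lemma pre_spec (f : nat -> (nat -> (M -> R) * nat) -> R) (b : nat -> R) (Q : state -> \bar R) :
  (forall s', 0 <= Q s')%E ->
  (forall i, (i < k)%N -> level_estimator i (f i) (b i)) ->
  (forall i xs, 0 <= f i xs) -> (forall i, 0 <= b i) ->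
  (forall s', (wtop s' <= U)%N -> (htop s' <= U)%N ->
     (forall a, (k.*2 <= a %% z)%N -> words (st_mem s') a = 0%N) ->
     (forall i, (i < k)%N -> level_ready (st_mem s') i) ->
    (1 - \sum_(i < k) f i (samples k i (st_mem s')))%:E <= Q s')%E ->
  ((1 - \sum_(i < k) b i)%:E <=
    preprocess d lsh S W (pre_prog k cc P1 P2 rad c0) Q)%E.
Proof.
move=> Q0 es f0 b0 HQ.
have [||N HN] := @pre_levels_spec (iota 0 k); first exact: iota_uniq.
  by move=> i; rewrite mem_iota.
apply: le_trans (run_ge _ _ _ _ _ N.+2 _ _ _).
rewrite /pre_prog exec_seq.
set c1 : cmd R := SetW R 1 (WReg 0).
have r : runs d lsh S W None 1 c1 (boot n (zero_memory M)) (sexec c1 (boot n (zero_memory M))) by rst.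
rewrite r//.
have bigE (g : nat -> R) : \sum_(i < k) g i = 0 + \sum_(i <- iota 0 k) g i.
  by rewrite add0r -(big_mkord xpredT g) /index_iota subn0.
rewrite bigE; apply: (HN _ f b) => //.
  by move=> i; rewrite mem_iota => /andP[_ ik]; exact: es.
move=> s' [h1 h2 h3 h4] rd; rewrite -(bigE (fun i => f i (samples k i (st_mem s')))); apply: HQ.
- by move: h3 => /=; rewrite max0n.
- by move: h4 => /=; rewrite max0n.
- by move=> a ak; rewrite h2// mem_iota /=; lia.
- by move=> i ik; apply: rd; rewrite mem_iota.
Qed.

End preprocessing_spec.

(** * Quality of the sampled tables for one query *)

Section sample_quality.
Context {R : realType} {M : metricType R}.
Variables (lsh : R -> R -> hash_family R M).
Variables (n : nat) (S : 'I_n -> M) (x0 : M).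
Variables (k : nat) (cc : R) (rad : nat -> R) (c0 Kf Lf Nf : nat -> nat) (i : nat).

Local Notation K := (Kf i).
Local Notation L := (Lf i).
Local Notation N := (Nf i).
Local Notation A := (copies c0 Kf i).
Local Notation F := (lsh cc (rad i)).
Local Notation sample := ((M -> R) * nat)%type.

Definition collides (p : 'I_n) (xs : nat -> sample) : bool := hdiff (S p) x0 0 xs K == 0.

Definition copy_misses (p : 'I_n) (xs : nat -> sample) : R :=
  \prod_(j < L) (~~ collides p (sshift (j * K) xs))%:R.

Definition copy_load (xs : nat -> sample) : R :=
  \sum_(j < L) \sum_(p < n) (collides p (sshift (j * K) xs))%:R.

(** Bounds the expected total bucket size of a copy divided by the number of near points; see
    [pessim_load]. *)
Definition load_scale : R := (3 * L + (A + 2) * N)%:R.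

Definition near_size : nat := near_count S x0 (rad i).

Definition slow_growth : bool :=
  (0 < near_size)%N && (near_count S x0 (cc * rad i) <= N * near_size)%N.

(** The number of missed pairs of a copy and a near point, plus a product over the copies that is at
    least 1 when every load exceeds twice its bound. Below 1, nothing is missed and some copy is
    lightly loaded; being made of sums and products over independent blocks, it has an explicit
    estimator. *)
Definition level_failure (xs : nat -> sample) : R :=
  \sum_(c < A) \sum_(p | near_pt S x0 (rad i) p) copy_misses p (sshift (c * (L * K)) xs) +
  (if slow_growth then \prod_(c < A)
     ((2 * load_scale * near_size%:R)^-1 * copy_load (sshift (c * (L * K)) xs))
   else 0).

Lemma copy_misses_ge0 p xs : 0 <= copy_misses p xs.
Proof. by apply: prodr_ge0 => j _; rewrite ler0n. Qed.

Lemma copy_load_ge0 xs : 0 <= copy_load xs.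
Proof. by apply: sumr_ge0 => j _; apply: sumr_ge0 => p _; rewrite ler0n. Qed.

Lemma load_factor_ge0 : 0 <= (2 * load_scale * near_size%:R)^-1.
Proof. by rewrite invr_ge0 !mulr_ge0. Qed.

Lemma level_failure_ge0 xs : 0 <= level_failure xs.
Proof.
apply: addr_ge0.
  by apply: sumr_ge0 => c _; apply: sumr_ge0 => p _; exact: copy_misses_ge0.
case: ifP => // _; apply: prodr_ge0 => c _; apply: mulr_ge0; first exact: load_factor_ge0.
exact: copy_load_ge0.
Qed.

Section good_memory.
Variable m0 : memory R M.

Local Notation xs0 := (samples k i m0).

Lemma collidesE p J : collides p (sshift (J * K) xs0) = coll S x0 k i K m0 J p.
Proof. by rewrite /collides hdiffE subr_eq0. Qed.

Lemma sshiftD t u xs : sshift t (sshift u xs) = sshift (u + t) xs :> (nat -> sample).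
Proof. by apply: funext => v; rewrite /sshift addnA. Qed.

Lemma collides_copy p c j :
  collides p (sshift (j * K) (sshift (c * (L * K)) xs0)) = coll S x0 k i K m0 (c * L + j) p.
Proof. by rewrite sshiftD mulnA -mulnDl collidesE. Qed.

Lemma copy_loadE c : copy_load (sshift (c * (L * K)) xs0) = (cum S x0 k i K m0 (c * L) L)%:R.
Proof.
rewrite /copy_load /cum natr_sum; apply: eq_bigr => j _.
rewrite /bucket_size -sum1_card natr_sum [RHS]big_mkcond/=.
by apply: eq_bigr => p _; rewrite collides_copy inE; case: coll.
Qed.

(** The summands of the first part are 0 or 1, so a single missed near point brings the estimator to
    1. *)
Lemma failure_covered : level_failure xs0 < 1 -> level_covered S x0 k rad c0 Kf Lf m0 i.
Proof.
move=> lf c cA p np; apply: contrapT => h.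
have : copy_misses p (sshift (c * (L * K)) xs0) = 1.
  apply: big1 => j _; rewrite collides_copy; case: (boolP (coll _ _ _ _ _ _ _ _)) => // cl.
  by exfalso; apply: h; exists j.
move=> e; move: lf; rewrite ltNge => /negP; apply.
rewrite /level_failure (bigD1 (Ordinal cA))//= (bigD1 p)//= e -!addrA lerDl.
apply: addr_ge0; first by apply: sumr_ge0 => ? _; exact: copy_misses_ge0.
apply: addr_ge0.
  by apply: sumr_ge0 => c' _; apply: sumr_ge0 => p' _; exact: copy_misses_ge0.
case: ifP => // _; apply: prodr_ge0 => c' _; apply: mulr_ge0; first exact: load_factor_ge0.
exact: copy_load_ge0.
Qed.

Lemma zero_rates : level_rates S x0 k rad c0 Kf Lf m0 i (fun=> 0).
Proof. by move=> c _; left. Qed.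

Lemma level_eps0 : level_eps c0 Kf Lf Nf i (fun=> 0) = 1 :> R.
Proof. by rewrite /level_eps big1// => c _; rewrite mul0r oppr0 expR0. Qed.

Hypotheses (L_gt0 : (0 < L)%N).

(* The product over the copies is below 1, hence so is one of its factors. *)
Lemma failure_rates : level_failure xs0 < 1 -> slow_growth ->
  exists rate, level_rates S x0 k rad c0 Kf Lf m0 i rate /\
    level_eps c0 Kf Lf Nf i rate <= expR (- A%:R).
Proof.
move=> lf sg; have cv := failure_covered lf.
have E3 : (3 * L)%:R <= load_scale by rewrite ler_nat leq_addr.
have L0 : 0 < L%:R :> R by rewrite ltr0n.
have E0 : 0 < load_scale by apply: lt_le_trans E3; rewrite ltr0n muln_gt0.
have B0 : 0 < near_size%:R :> R by rewrite ltr0n; case/andP: sg.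
have [c hc] : exists c : 'I_A, copy_load (sshift (c * (L * K)) xs0) <= 2 * load_scale * near_size%:R.
  apply: contrapT => h; move: lf; rewrite ltNge => /negP; apply.
  rewrite /level_failure sg ler_wpDl//.
    by apply: sumr_ge0 => c _; apply: sumr_ge0 => p _; exact: copy_misses_ge0.
  apply: (@le_trans _ _ (\prod_(c < A) 1)); first by rewrite big1.
  apply: ler_prod => c _.
  rewrite ler01 /= mulrC ler_pdivlMr ?mul1r ?mulr_gt0//.
  by rewrite leNgt; apply/negP => hc; apply: h; exists c; exact: ltW.
(* Write b for the number of near points and T for the load, at most 2 b [load_scale]. Then 2 lam T
   <= 2 b / 3, and [load_scale >= 3 L] gives 2 lam b L <= b / 9, so the sum stays below b. *)
pose lam := (6 * load_scale)^-1.
have l0 : 0 <= lam by rewrite invr_ge0 mulr_ge0// ltW.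
have lE : 6 * (lam * load_scale) = 1.
  by rewrite /lam invfM mulrA mulrA mulfV// mul1r mulVf// gt_eqF.
exists (fun x : nat => if x == nat_of_ord c then lam else 0); split; last first.
  rewrite /level_eps (bigD1 c)//= eqxx big1 ?mulr1; last first.
    move=> x /negbTE; rewrite -val_eqE => ->.
    by rewrite mul0r oppr0 expR0.
  rewrite ler_expR lerN2 /level_budget /budget !natrM -/load_scale.
  by rewrite -mulrA mulrCA [lam * _]mulrCA mulrCA lE mulr1.
move=> x xA; case: eqP => [->|_]; last by left.
right; split=> //.
- have /card_gt0P[p] : (0 < near_size)%N by case/andP: sg.
  rewrite inE => np; have [//|j jL cl] := cv c _ p np.
  rewrite /cum (bigD1 (Ordinal jL))//= addn_gt0; apply/orP; left.
  by apply/card_gt0P; exists p; rewrite inE.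
- exact: cv.
- rewrite natrM in E3; nra.
- rewrite -copy_loadE -/near_size.
  have h1 : lam * copy_load (sshift (c * (L * K)) xs0) <= lam * (2 * load_scale * near_size%:R).
    exact: ler_wpM2l.
  have h2 : lam * (3 * L%:R) <= lam * load_scale by apply: ler_wpM2l => //; rewrite -natrM.
  have h3 : lam * (near_size%:R * L%:R) * 18 <= near_size%:R by nra.
  have h4 : lam * (2 * load_scale * near_size%:R) * 3 = near_size%:R.
    by transitivity (6 * (lam * load_scale) * near_size%:R); [ring|rewrite lE mul1r].
  lra.
Qed.

End good_memory.

(** * Expected misses and loads *)

Section expectation.
Variables (P1 P2 : R).
Hypothesis mF : forall x, measurable_fun setT (fun w : hf_seed F => hf_eval w x).
Hypotheses (P1_01 : 0 < P1 <= 1) (P2_01 : 0 <= P2 <= 1).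
Hypothesis near_coll : forall p, near_pt S x0 (rad i) p -> (P1%:E <= collision F (S p) x0)%E.
Hypothesis ring_coll : forall p, ~~ near_pt S x0 (rad i) p -> (collision F (S p) x0 <= P1%:E)%E.
Hypothesis far_coll : forall p, ~~ near_pt S x0 (cc * rad i) p -> (collision F (S p) x0 <= P2%:E)%E.
Hypotheses (n_gt0 : (0 < n)%N) (K_gt0 : (0 < K)%N) (L_gt0 : (0 < L)%N).
Hypothesis hK : n%:R * P2 ^+ K <= 1.
Hypothesis hL : A%:R <= L%:R * P1 ^+ K.
Hypothesis hL' : forall j, (j < L)%N -> j%:R * P1 ^+ K < A%:R.

Local Notation m := (n * L * K)%N.

Let m_gt0 : (0 < m)%N. Proof. by rewrite !muln_gt0 n_gt0 L_gt0. Qed.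

Let y := P1 ^+ K.

Let y01 : 0 < y <= 1.
Proof.
by case/andP: P1_01 => h0 h1; rewrite /y exprn_gt0//= exprn_ile1// ltW.
Qed.

(** All [L] tables miss with probability at most (1 - y)^L <= exp (- L y), and L y >= A by the
    choice of [L]. *)
Lemma pessim_misses p : near_pt S x0 (rad i) p ->
  pessim F m (L * K) (copy_misses p) (expR (- A%:R)).
Proof.
move=> np; have /andP[y0 y1] := y01; have /andP[p0 p1] := P1_01.
have h : pessim F m K (fun xs => (~~ collides p xs)%:R) (1 - y).
  have := pessim_no_collision m_gt0 mF K 0 _ (near_coll np); rewrite eqxx; apply.
  by rewrite ltW.
apply: pessim_le (pessim_prod L _ _ h) => //.
  apply: (@le_trans _ _ (expR (- y) ^+ L)).
    by apply: lerXn2r; rewrite ?nnegrE ?subr_ge0 ?expR_ge0//; exact: expR_ge1Dx.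
  by rewrite -expRM_natl ler_expR mulrN lerN2.
by rewrite subr_ge0.
Qed.

(** Three kinds of points: near ones are counted in full, those of the surrounding ring collide at
    most at the threshold rate, far ones at the rate [P2]. False collisions add K / m = 1 / (n L) to
    the last two. *)
Lemma pessim_load_term p (j : 'I_L) :
  pessim F m (L * K) (fun xs => (collides p (sshift (j * K) xs))%:R)
    (if near_pt S x0 (rad i) p then 1
     else (if near_pt S x0 (cc * rad i) p then y else P2 ^+ K) + (n * L)%:R^-1).
Proof.
have /andP[y0 y1] := y01; have /andP[p0 p1] := P1_01; have /andP[q0 q1] := P2_01.
have KE : K%:R / m%:R = (n * L)%:R^-1 :> R.
  rewrite natrM invfM mulrA mulrAC mulfV ?mul1r// pnatr_eq0; lia.
have aux P : 0 <= P <= 1 -> (collision F (S p) x0 <= P%:E)%E ->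
   pessim F m (L * K) (fun xs => (collides p (sshift (j * K) xs))%:R) (P ^+ K + (n * L)%:R^-1).
  move=> P01 cP; have := pessim_collision m_gt0 mF K 0 P01 cP; rewrite eqxx KE => h.
  apply: (pessim_block m_gt0 (f := fun xs => (collides p xs)%:R)) h => //.
  by rewrite addr_ge0 ?invr_ge0 ?exprn_ge0//; case/andP: P01.
case: ifPn => np1.
  by apply: pessim_le (pessim_cst F m_gt0 (L * K) ler01) => // xs; case: collides.
case: ifPn => np2; apply: aux => //.
- by rewrite p1 ltW.
- exact: ring_coll.
- exact: far_coll.
Qed.

(** Write b for the number of near points. Near points contribute at most L b. A ring point
    contributes at most A + 2, since L y <= A + 1 by minimality of [L], and slow growth leaves at
    most N b of them. Far points contribute at most L + 1 since n P2^K <= 1. As b >= 1, the total is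
    at most (3 L + (A + 2) N) b. *)
Lemma pessim_load : slow_growth ->
  pessim F m (L * K) copy_load (load_scale * near_size%:R).
Proof.
move=> /andP[B0 gr]; have /andP[y0 y1] := y01; have /andP[q0 q1] := P2_01.
have h := @pessim_sum R M F m m_gt0 (L * K) 'I_L (index_enum _) xpredT _ _ (fun j _ =>
  @pessim_sum R M F m m_gt0 (L * K) 'I_n (index_enum _) xpredT _ _ (fun p _ => pessim_load_term p j)).
apply: pessim_le h => //.
rewrite sumr_const card_ord -[leLHS]mulr_natl.
set X := \sum_(p < n) _.
pose nr p := (near_pt S x0 (rad i) p)%:R : R.
pose nr' p := (near_pt S x0 (cc * rad i) p)%:R : R.
have q0K : 0 <= P2 ^+ K by exact: exprn_ge0.
have i0 : 0 <= (n * L)%:R^-1 :> R by rewrite invr_ge0.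
have XE : X <= \sum_(p < n) (nr p + nr' p * (y + (n * L)%:R^-1) + (P2 ^+ K + (n * L)%:R^-1)).
  apply: ler_sum => p _; rewrite /nr /nr'.
  by case: near_pt; case: near_pt; rewrite /= ?mulr1n ?mulr0n ?mul1r ?mul0r; lra.
have cnt rr : \sum_(p < n) (near_pt S x0 rr p)%:R = (near_count S x0 rr)%:R :> R.
  rewrite /near_count -sum1_card natr_sum [RHS]big_mkcond/=.
  by apply: eq_bigr => p _; rewrite inE; case: near_pt.
have {}XE : X <= near_size%:R + (near_count S x0 (cc * rad i))%:R * (y + (n * L)%:R^-1) + n%:R * (P2 ^+ K + (n * L)%:R^-1).
  apply: le_trans XE _; rewrite !big_split/= -mulr_suml !cnt.
  have sc (a : R) : \sum_(p < n) a = n%:R * a by rewrite sumr_const card_ord mulr_natl.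
  by rewrite !sc -mulrDr.
have n1 : 1 <= n%:R :> R by rewrite ler1n.
have L1 : 1 <= L%:R :> R by rewrite ler1n.
have B1 : 1 <= near_size%:R :> R by rewrite ler1n.
have Ly : L%:R * y <= A%:R + 1.
  have : (L.-1 < L)%N by rewrite prednK.
  move/hL'; rewrite -/y; have -> : (L.-1)%:R = L%:R - 1 :> R by rewrite -subn1 natrB.
  by rewrite mulrBl mul1r => h; lra.
have nLE : L%:R * (n * L)%:R^-1 <= 1 :> R.
  by rewrite natrM ler_pdivrMr ?mulr_gt0 ?ltr0n// mul1r ler_peMl// ltW// ltr0n.
have nLE' : n%:R * (L%:R * (n * L)%:R^-1) <= 1 :> R.
  by rewrite mulrA natrM mulfV// mulf_neq0// pnatr_eq0 -lt0n.
have grR : (near_count S x0 (cc * rad i))%:R <= N%:R * near_size%:R :> R by rewrite -natrM ler_nat.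
apply: (@le_trans _ _ (L%:R * near_size%:R + N%:R * near_size%:R * (A%:R + 2) + L%:R + 1)).
  apply: (le_trans (ler_wpM2l (ltW (lt_le_trans ltr01 L1)) XE)).
  set C := (near_count _ _ _)%:R in grR XE *; set I := (n * L)%:R^-1 in nLE nLE' i0 XE *.
  have -> : L%:R * (near_size%:R + C * (y + I) + n%:R * (P2 ^+ K + I)) =
     L%:R * near_size%:R + C * (L%:R * y + L%:R * I) + L%:R * (n%:R * P2 ^+ K) + n%:R * (L%:R * I) by ring.
  have t1 : C * (L%:R * y + L%:R * I) <= N%:R * near_size%:R * (A%:R + 2).
    by apply: ler_pM; [exact: ler0n|rewrite addr_ge0 ?mulr_ge0// ltW|exact: grR|lra].
  have t2 : L%:R * (n%:R * P2 ^+ K) <= L%:R by rewrite ler_piMr.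
  by lra.
have -> : load_scale = 3 * L%:R + (A%:R + 2) * N%:R by rewrite /load_scale natrD natrM natrM natrD.
have LB : L%:R <= L%:R * near_size%:R :> R by rewrite ler_peMr.
have -> : (3 * L%:R + (A%:R + 2) * N%:R) * near_size%:R = 3 * (L%:R * near_size%:R) + N%:R * near_size%:R * (A%:R + 2) :> R by ring.
lra.
Qed.

(** A union bound for the misses and Markov's inequality for the loads: the factor 2 in
    [level_failure] brings the mean of each ratio to one half, and the copies are independent. *)
Lemma pessim_level_failure :
  level_estimator lsh n cc rad c0 Kf Lf i level_failure
    ((A * n)%:R * expR (- A%:R) + 2^-1 ^+ A).
Proof.
rewrite /level_estimator /level_failure.
have -> : (A * L * K = A * (L * K))%N by rewrite mulnA.
apply: pessimD.
  have h c (_ : xpredT c) := @pessim_sum R M F m m_gt0 (A * (L * K)) 'I_n (index_enum _) (near_pt S x0 (rad i)) _ _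
    (fun p np => pessim_block m_gt0 (@copy_misses_ge0 p) (expR_ge0 _) (ltn_ord c) (pessim_misses np)).
  apply: pessim_le (@pessim_sum R M F m m_gt0 (A * (L * K)) 'I_A (index_enum _) xpredT _ _ h) => //.
  rewrite sumr_const card_ord sumr_const -mulrnA -[leLHS]mulr_natl mulnC.
  rewrite ler_wpM2r ?expR_ge0// ler_nat leq_mul2l; apply/orP; right.
  by apply: leq_trans (max_card _) _; rewrite card_ord.
case: (boolP slow_growth) => sg; last first.
  by apply: pessim_le (pessim_cst F m_gt0 (A * (L * K)) (lexx 0)) => //; rewrite exprn_ge0.
have B0 : 0 < near_size%:R :> R by rewrite ltr0n; case/andP: sg.
have E0 : 0 < load_scale by rewrite ltr0n; lia.
have h : pessim F m (L * K) (fun xs => (2 * load_scale * near_size%:R)^-1 * copy_load xs)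
    ((2 * load_scale * near_size%:R)^-1 * (load_scale * near_size%:R)).
  by apply: pessimZ; [exact: load_factor_ge0|exact: pessim_load].
apply: pessim_le (pessim_prod A _ _ h) => //.
- by rewrite -mulrA invfM -[2^-1 * _ * _]mulrA mulVf ?mulr1// gt_eqF ?mulr_gt0.
- by move=> xs; rewrite mulr_ge0 ?load_factor_ge0 ?copy_load_ge0.
- by rewrite mulr_ge0 ?load_factor_ge0 ?mulr_ge0// ltW.
Qed.

End expectation.

End sample_quality.

(** Otherwise the ball grows by a factor above [N] at each of the [k] levels, and the last one holds
    more than N^k >= n points. The inequality is strict only after one step, hence the two claims in
    [grow]. *)
Lemma slow_growth_exists (R : realType) (M : metricType R) (n : nat) (S : 'I_n -> M) (x0 : M)
    (k : nat) (cc : R) (rad : nat -> R) (N : nat) :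
  (0 < near_count S x0 (rad 0%N))%N -> (n <= N ^ k)%N -> (0 < k)%N ->
  (forall i, rad i.+1 = cc * rad i) ->
  exists2 i, (i < k)%N & slow_growth S x0 cc rad (fun=> N) i.
Proof.
move=> n0 nN k0 hr; apply: contrapT => h.
have grow i : (i <= k)%N -> (N ^ i <= near_count S x0 (rad i))%N /\
     ((0 < i)%N -> (N ^ i < near_count S x0 (rad i))%N).
  elim: i => [|i IH] ik; first by rewrite expn0.
  have [h1 h2] := IH (ltnW ik).
  have b0 : (0 < near_count S x0 (rad i))%N.
    by case: i ik h1 h2 {IH} => // i ik h1 h2; apply: leq_ltn_trans (h2 isT).
  have : (N * near_count S x0 (rad i) < near_count S x0 (rad i.+1))%N.
    rewrite ltnNge; apply/negP => hN; apply: h; exists i => //.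
    by rewrite /slow_growth /near_size b0 -hr.
  have : (N ^ i.+1 <= N * near_count S x0 (rad i))%N by rewrite expnS leq_mul2l h1 orbT.
  by split; lia.
have [_ /(_ k0)] := grow k (leqnn _).
have : (near_count S x0 (rad k) <= n)%N.
  by rewrite /near_count; apply: leq_trans (max_card _) _; rewrite card_ord.
lia.
Qed.

(** * Sessions *)

Section sessions.
Context {R : realType} {M : metricType R}.
Variables (d : nat) (lsh : R -> R -> hash_family R M).
Variables (n : nat) (S : 'I_n -> M) (W : nat) (query : cmd R).

Local Notation state := (state R M).
Local Notation ask := (ask d lsh S W query).
Local Notation session := (session d lsh S W query).
Local Notation answer_law := (answer_law d lsh S W query).

Lemma session_ge0 m qs (K : seq (nat * nat) -> \bar R) : (forall l, 0 <= K l)%E ->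
  (0 <= session m qs K)%E.
Proof.
elim: qs m K => [|q qs IH] m K K0 //=.
by apply: run_ge0 => s; apply: IH.
Qed.

Lemma session_le1 m qs (K : seq (nat * nat) -> \bar R) : (forall l, 0 <= K l <= 1)%E ->
  (session m qs K <= 1)%E.
Proof.
elim: qs m K => [|q qs IH] m K K0 /=; first by case/andP: (K0 [::]).
apply: run_le1 => s; rewrite session_ge0 ?IH// => l.
by case/andP: (K0 ((wreg s 0%N, st_time s) :: l)).
Qed.

Variables (m0 : memory R M) (Tmax : nat).

Definition query_law (q : M) (mu : seq (R * state)) : Prop :=
  (exists N, yields d lsh S W (Some q) N query (boot n m0) mu) /\
  supported (fun s => st_mem s = m0 /\ (st_time s <= Tmax)%N) mu.

Lemma ask_law q mu (K : state -> \bar R) : query_law q mu -> (forall s, 0 <= K s)%E ->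
  ask m0 q K = (\sum_(x <- mu) x.1%:E * K x.2)%E.
Proof.
move=> [[N y] _] K0; apply: (@run_eventually _ _ _ _ _ _ _ _ N) => // fuel lf.
exact: y.
Qed.

Lemma answer_law_prob q mu o : query_law q mu -> answer_law m0 q o = (answer_prob mu o)%:E.
Proof.
move=> h; rewrite /answer_law (ask_law h); last by move=> s; rewrite lee_fin.
by rewrite (wsumE mu (fun s => (wreg s 0%N == o)%:R)).
Qed.

Lemma session_cons q mu qs (K : seq (nat * nat) -> \bar R) : query_law q mu ->
  (forall l, 0 <= K l)%E ->
  session m0 (q :: qs) K =
  (\sum_(x <- mu) x.1%:E * session m0 qs (fun l => K ((wreg x.2 0%N, st_time x.2) :: l)))%E.
Proof.
move=> h K0; rewrite /= (ask_law h); last by move=> s; apply: session_ge0.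
case: h => _ [+ _]; elim: mu => [|x mu IH] h; first by rewrite !big_nil.
by rewrite !big_cons; inversion_clear h as [|? ? [_ [e _]] h']; rewrite e IH.
Qed.

(** The probability is exactly 1 because the time bound holds at every state of the finite
    support. *)
Lemma session_time qs (f : nat * nat -> bool) : (forall q, q \in qs -> exists mu, query_law q mu) ->
  (forall o t, (t <= Tmax)%N -> f (o, t)) ->
  session m0 qs (fun l => (all f l)%:R%:E) = 1%E.
Proof.
move=> + hf; elim: qs => [|q qs IH] hq //.
have [mu hmu] := hq q (mem_head _ _).
have {}IH := IH (fun q' h => hq q' (mem_behead (s := q :: qs) h)).
rewrite (session_cons _ hmu); last by move=> l; rewrite lee_fin.
case: hmu => _ [h m1].
transitivity (\sum_(x <- mu) x.1%:E * (1 : R)%:E)%E; last first.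
  by rewrite (wsumE mu (fun=> 1)) m1.
elim: {m1} h => [|x l [_ [_ tm]] _ IHl]; first by rewrite !big_nil.
rewrite !big_cons IHl; congr (_ * _ + _)%E.
by rewrite -[RHS]IH; congr session; apply: funext => l'; rewrite /= hf.
Qed.

Lemma session0 qs : (forall q, q \in qs -> exists mu, query_law q mu) ->
  session m0 qs (fun=> 0%E) = 0%E.
Proof.
elim: qs => [|q qs IH] hq //; have [mu hmu] := hq q (mem_head _ _).
rewrite (session_cons _ hmu)// big1// => x _; rewrite IH ?mule0// => q' h.
by apply: hq; rewrite inE h orbT.
Qed.

(** Every query leaves [m0] behind and makes its own random draws, so the law of the answers factors
    over the queries. *)
Lemma session_answers qs os : (forall q, q \in qs -> exists mu, query_law q mu) ->
  size os = size qs ->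
  session m0 qs (fun l => (unzip1 l == os)%:R%:E) =
  (\prod_(x <- zip qs os) answer_law m0 x.1 x.2)%E.
Proof.
elim: qs os => [|q qs IH] [|o os] hq // hs; first by rewrite big_nil.
have [mu hmu] := hq q (mem_head _ _).
have hq' q' (h : q' \in qs) := hq q' (mem_behead (s := q :: qs) h).
have {}IH := IH os hq' (succn_inj hs).
rewrite (session_cons _ hmu); last by move=> l; rewrite lee_fin.
rewrite [zip _ _]/= big_cons [(_, _).1]/= [(_, _).2]/= -{}IH (answer_law_prob _ hmu).
set P := session m0 qs _.
have P0 : (0 <= P)%E by apply: session_ge0 => l; rewrite lee_fin.
rewrite /answer_prob -wsumE.
case: hmu => _ [+ _]; elim=> [|x l [x0 _] hl IHl]; first by rewrite !big_nil mul0e.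
rewrite !big_cons IHl ge0_muleDl; last 2 first.
- by rewrite -EFinM lee_fin mulr_ge0.
- rewrite (wsumE l (fun s => (wreg s 0%N == o)%:R)) lee_fin.
  by elim: hl {IHl} => [|y l' [y0 _] _ IHl]; rewrite ?wsum_nil// wsum_cons addr_ge0// mulr_ge0.
congr (_ + _)%E; rewrite -muleA; congr (_ * _)%E.
case: (eqVneq (wreg x.2 0%N) o) => [e|ne]; last first.
  rewrite mul0e -[RHS](session0 hq'); congr session; apply: funext => l' /=.
  by rewrite eqseq_cons (negbTE ne).
rewrite mul1e; congr session; apply: funext => l' /=.
by rewrite eqseq_cons e eqxx.
Qed.

End sessions.

(** * From mixtures to relaxed fairness *)

Section fairness.
Context {R : realType} {M : metricType R}.
Variables (n : nat) (S : 'I_n -> M) (x0 : M) (k : nat) (rad : nat -> R) (c r : R).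

Local Notation state := (state R M).

(* Only the radii whose ball is not empty are kept. *)
Lemma mixture_relaxed_fair (mu : seq (R * state)) (wt : 'I_k -> R) (delta : R) (law : nat -> \bar R) :
  mixture S x0 rad mu wt -> (forall o, law o = (answer_prob mu o)%:E) ->
  (forall i, (i < k)%N -> r <= rad i <= c * r) ->
  (near_set S x0 r != finset.set0 -> answer_prob mu 0 <= delta) ->
  relaxed_fair S c r delta x0 law.
Proof.
move=> [wt0 hp h0 hn] hlaw hrad hd.
pose E := [set i : 'I_k | ball_at S x0 rad i != finset.set0]%SET.
have bE i : near_set S x0 (rad i) = ball_at S x0 rad i by [].
have sumE (g : 'I_k -> R) : (forall i, i \notin E -> g i = 0) ->
    \sum_(j < #|E|) g (enum_val j) = \sum_i g i.
  move=> g0; rewrite -(big_enum_val g)/= [RHS](bigID (mem E))/= [X in _ + X]big1 ?addr0//.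
have wE i : i \notin E -> wt i = 0.
  by rewrite inE negbK => /eqP; exact: (proj2 (wt0 i)).
exists #|E|, (fun j : 'I_#|E| => rad (enum_val j)), (fun j : 'I_#|E| => wt (enum_val j)); split.
- move=> j; have := enum_valP j; rewrite inE => nE.
  have /andP[rl ru] := hrad _ (ltn_ord (enum_val j)).
  split=> //; last by case: (wt0 (enum_val j)).
  case: ifPn => //; rewrite negbK => e0; rewrite lt_neqAle rl andbT.
  by apply: contra nE => /eqP e; rewrite -bE -e.
- move=> p; rewrite hlaw hp; congr EFin.
  rewrite -(sumE (fun i => wt i * ((p \in ball_at S x0 rad i)%:R / #|ball_at S x0 rad i|%:R))); last first.
    by move=> i /wE ->; rewrite mul0r.
  rewrite [RHS]big_mkcond/=; apply: eq_bigr => j _; rewrite bE; case: (p \in _).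
    by rewrite mul1r.
  by rewrite mul0r mulr0.
- by rewrite hlaw h0 (sumE wt wE).
- by move=> o /hn e; rewrite hlaw e.
- by move=> /hd; rewrite hlaw lee_fin.
Qed.

End fairness.

(** * Guarantees of the complete data structure *)

Section data_structure.
Context {R : realType} {M : metricType R}.
Variables (d : nat) (lsh : R -> R -> hash_family R M).
Variables (n : nat) (S : 'I_n -> M) (W : nat).
Variables (k : nat) (cc c r : R) (P1 P2 rad : nat -> R) (c0 Kf Lf : nat -> nat) (N : nat).
Local Notation Nf := (fun _ : nat => N).
Local Notation copies := (copies c0 Kf).
Local Notation z := (nkinds k).
Local Notation state := (state R M).

Hypotheses (n_gt0 : (0 < n)%N) (k_gt0 : (0 < k)%N).
Hypothesis is_par : forall i, (i < k)%N -> is_params n k (P1 i) (P2 i) (Kf i) (Lf i) (copies i) N.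
Hypothesis fits : forall i, (i < k)%N -> level_fits n W k c0 Kf Lf Nf i.
Hypothesis pos : forall i, (i < k)%N -> level_positive c0 Kf Lf Nf i.

Local Notation pre := (pre_prog k cc P1 P2 rad c0).
Local Notation query := (query_prog k P1 P2 rad c0).
Local Notation Tmax := (query_time d n k c0 Kf Lf Nf).

Section memory.
Variable m0 : memory R M.
Hypothesis ready : forall i, (i < k)%N -> level_ready S k c0 Kf Lf m0 i.
Hypothesis scratch0 : forall a, (k.*2 <= a %% z)%N -> words m0 a = 0%N.

Lemma ready_perms : exists pi : nat -> nat -> {perm 'I_n},
  forall i J, (i < k)%N -> (J < copies i * Lf i)%N -> table_sorted S k i (Kf i) m0 J (pi i J).
Proof.
have h i J : exists pi : {perm 'I_n}, (i < k)%N -> (J < copies i * Lf i)%N ->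
    table_sorted S k i (Kf i) m0 J pi.
  have [ik|ik] := boolP (i < k)%N; last by exists 1%g.
  have [JA|JA] := boolP (J < copies i * Lf i)%N; last by exists 1%g.
  by have [pi hpi] := ready ik JA; exists pi.
have [f hf] := choice (fun x : nat * nat => h x.1 x.2).
by exists (fun i J => f (i, J)) => i J; exact: (hf (i, J)).
Qed.

(** Obtained with [cov] false and all rates 0: it holds for every outcome of the sampling, given
    sorted tables and clean scratch cells. *)
Lemma query_law_exists q : exists mu, query_law d lsh S W query m0 Tmax q mu.
Proof.
have [pi hpi] := ready_perms.
have [||NN [mu [y s _ _]]] := @query_spec R M d lsh n S W q k P1 P2 rad c0 Kf Lf Nf m0 pi False
   n_gt0 is_par fits pos hpi scratch0 (fun _ _ => 0).
- by [].
- by move=> i ik; exact: zero_rates.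
by exists mu; split=> //; exists NN.
Qed.

Variable eps : R.
Hypothesis eps_ge : forall i, (i < k)%N -> expR (- (copies i)%:R) <= eps.
Hypothesis rad0 : rad 0%N = r.
Hypothesis radS : forall i, rad i.+1 = cc * rad i.
Hypothesis rad_le : forall i, (i < k)%N -> r <= rad i <= c * r.

(** If the ball of radius r is inhabited, some level grows slowly and its good copy yields the
    failure bound. If it is empty, bottom is a legitimate answer and all rates may be 0. *)
Lemma good_query_fair q :
  (forall i, (i < k)%N -> level_failure S q cc rad c0 Kf Lf Nf i (samples k i m0) < 1) ->
  relaxed_fair S c r eps q (answer_law d lsh S W query m0 q).
Proof.
move=> good; have [pi hpi] := ready_perms.
have nN : (n <= N ^ k)%N.
  by have [_ _ [h _]] := is_par k_gt0; rewrite -(ler_nat R) natrX.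
have [rate [h1 h2]] : exists rate : nat -> nat -> R,
   (forall i, (i < k)%N -> level_rates S q k rad c0 Kf Lf m0 i (rate i)) /\
   (near_set S q r != finset.set0 -> \prod_(i < k) level_eps c0 Kf Lf Nf i (rate i) <= eps).
  have [e|ne] := eqVneq (near_set S q r) finset.set0.
    by exists (fun _ _ => 0); split=> // [i ik]; exact: zero_rates.
  have b0 : (0 < near_count S q (rad 0%N))%N by rewrite rad0 /near_count card_gt0.
  have [i ik sg] := slow_growth_exists b0 nN k_gt0 radS.
  have [_ _ L0 _] := pos ik.
  have [rt [hr he]] := failure_rates L0 (good i ik) sg.
  exists (fun j => if j == i then rt else fun=> 0); split.
    by move=> j jk; case: eqP => [->//|_]; exact: zero_rates.
  move=> _; rewrite (bigD1 (Ordinal ik))//= eqxx big1 ?mulr1; first exact: le_trans (eps_ge ik).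
  by move=> j; rewrite -val_eqE /= => /negbTE ->; exact: level_eps0.
have [||NN [mu [y s mx un]]] := @query_spec R M d lsh n S W q k P1 P2 rad c0 Kf Lf Nf m0 pi True
   n_gt0 is_par fits pos hpi scratch0 rate.
- by move=> i ik _; exact: (failure_covered (good i ik)).
- exact: h1.
have ql : query_law d lsh S W query m0 Tmax q mu by split=> //; exists NN.
have [wt hwt] := mx I.
apply: (mixture_relaxed_fair hwt) => //.
  by move=> o; exact: (answer_law_prob _ ql).
by move=> ne; apply: le_trans un (h2 ne).
Qed.

Lemma good_session_fair qs :
  (forall q i, q \in qs -> (i < k)%N ->
     level_failure S q cc rad c0 Kf Lf Nf i (samples k i m0) < 1) ->
  fair_session d lsh S W query c r eps qs m0.
Proof.
move=> good; split; first by move=> q qqs; apply: good_query_fair => i; exact: good.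
by move=> os; apply: session_answers => q _; exact: query_law_exists.
Qed.

End memory.

Variable U : nat.
Hypothesis UW : (U < W)%N.
Hypothesis level_space : forall i, (i < k)%N ->
  ((copies i * Lf i * (Kf i + n) + 1) * z <= U)%N.

(** The zero estimator turns [pre_spec] into a statement of probability 1. *)
Lemma pre_surely (Q : state -> \bar R) : (forall s, 0 <= Q s <= 1)%E ->
  (forall s', (wtop s' <= U)%N -> (htop s' <= U)%N ->
     (forall a, (k.*2 <= a %% z)%N -> words (st_mem s') a = 0%N) ->
     (forall i, (i < k)%N -> level_ready S k c0 Kf Lf (st_mem s') i) -> Q s' = 1%E) ->
  preprocess d lsh S W pre Q = 1%E.
Proof.
move=> Q01 HQ; apply/eqP; rewrite eq_le; apply/andP; split; first exact: run_le1.
have := @pre_spec R M d lsh n S W k cc P1 P2 rad c0 Kf Lf Nf n_gt0 is_par fits pos U UW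
  level_space (fun _ _ => 0) (fun=> 0) Q.
rewrite !big1// subr0; apply=> //.
- by move=> s; case/andP: (Q01 s).
- move=> i ik; apply: pessim_cst => //; rewrite !muln_gt0 n_gt0.
  by have [p1 p2 p3 p4] := pos ik; rewrite p2 p3.
- by move=> s' h1 h2 h3 h4; rewrite HQ// big1// subr0.
Qed.

Lemma pre_space (max_space : R) : (U + U)%:R <= max_space ->
  preprocess d lsh S W pre (fun s => ((used_space s)%:R <= max_space)%R%:R%:E) = 1%E.
Proof.
move=> hU; apply: pre_surely => [s|s w h _ _]; first by case: (_ <= _); rewrite !lee_fin ?lexx ?ler01.
have -> : (used_space s)%:R <= max_space by apply: le_trans hU; rewrite ler_nat leq_add.
by [].
Qed.

Lemma pre_time (max_time : R) qs : Tmax%:R <= max_time ->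
  preprocess d lsh S W pre (fun s =>
    session d lsh S W query (st_mem s) qs (fun answers =>
      (all (fun x => x.2%:R <= max_time) answers)%:R%:E)) = 1%E.
Proof.
move=> hT; apply: pre_surely => [s|s w h sc rd].
  apply/andP; split; first by apply: session_ge0 => l; rewrite lee_fin.
  by apply: session_le1 => l; case: all; rewrite !lee_fin ?lexx ?ler01.
apply: (@session_time _ _ _ _ _ _ _ _ _ Tmax) => [q _|o t tT /=]; first exact: query_law_exists.
by apply: le_trans hT; rewrite ler_nat.
Qed.

Hypothesis rad0 : rad 0%N = r.
Hypothesis radS : forall i, rad i.+1 = cc * rad i.
Hypothesis rad_le : forall i, (i < k)%N -> r <= rad i <= c * r.
Hypothesis P1_01 : forall i, (i < k)%N -> 0 < P1 i <= 1.
Hypothesis P2_01 : forall i, (i < k)%N -> 0 <= P2 i <= 1.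
Hypothesis mF : forall i x, (i < k)%N ->
  measurable_fun setT (fun w : hf_seed (lsh cc (rad i)) => hf_eval w x).
Hypothesis near_coll : forall i x y, (i < k)%N -> mdist x y <= rad i ->
  ((P1 i)%:E <= collision (lsh cc (rad i)) x y)%E.
Hypothesis ring_coll : forall i x y, (i < k)%N -> rad i < mdist x y ->
  (collision (lsh cc (rad i)) x y <= (P1 i)%:E)%E.
Hypothesis far_coll : forall i x y, (i < k)%N -> cc * rad i <= mdist x y ->
  (collision (lsh cc (rad i)) x y <= (P2 i)%:E)%E.

Definition level_loss (i : nat) : R :=
  (copies i * n)%:R * expR (- (copies i)%:R) + 2^-1 ^+ copies i.

Lemma level_loss_ge0 i : 0 <= level_loss i.
Proof. by rewrite addr_ge0 ?exprn_ge0// mulr_ge0 ?expR_ge0. Qed.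

Lemma level_failure_estimator q i : (i < k)%N ->
  level_estimator lsh n cc rad c0 Kf Lf i (level_failure S q cc rad c0 Kf Lf Nf i) (level_loss i).
Proof.
move=> ik; have [[hK _] [hL hL'] _] := is_par ik; have [p1 p2 p3 p4] := pos ik.
apply: (@pessim_level_failure R M lsh n S q cc rad c0 Kf Lf Nf i (P1 i) (P2 i)) => //.
- by move=> x; exact: mF.
- exact: P1_01.
- exact: P2_01.
- by move=> p np; exact: near_coll.
- by move=> p np; apply: ring_coll => //; rewrite ltNge.
- by move=> p np; apply: far_coll => //; rewrite ltW// ltNge.
Qed.

(** A union bound over queries and levels, carried by a sum of estimators: where the sum is below 1
    the session is fair, and elsewhere 1 minus the sum is nonpositive and bounds the indicator
    trivially. *)
Lemma pre_fair delta qs : (forall i, (i < k)%N -> expR (- (copies i)%:R) <= delta) ->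
  \sum_(i < k) level_loss i <= delta ->
  ((1 - (size qs)%:R * delta)%:E <=
   preprocess d lsh S W pre (fun s =>
     (\1_(fair_session d lsh S W query c r delta qs) (st_mem s))%:E))%E.
Proof.
move=> he hl.
pose f i xs := \sum_(q <- qs) level_failure S q cc rad c0 Kf Lf Nf i xs.
pose b i := \sum_(q <- qs) level_loss i.
have bE i : b i = (size qs)%:R * level_loss i.
  by rewrite /b big_const_seq count_predT iter_addr_0 mulr_natl.
apply: (@le_trans _ _ (1 - \sum_(i < k) b i)%:E).
  rewrite lee_fin lerD2l lerN2; under eq_bigr do rewrite bE.
  by rewrite -mulr_sumr ler_wpM2l.
apply: (@pre_spec R M d lsh n S W k cc P1 P2 rad c0 Kf Lf Nf n_gt0 is_par fits pos U UW
  level_space f b) => //.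
- move=> i ik; apply: pessim_sum => [|q _]; last exact: level_failure_estimator.
  rewrite !muln_gt0 n_gt0; by have [p1 p2 p3 p4] := pos ik; rewrite p2 p3.
- by move=> i xs; apply: sumr_ge0 => q _; exact: level_failure_ge0.
- by move=> i; apply: sumr_ge0 => q _; exact: level_loss_ge0.
move=> s _ _ sc rd.
have [fr|nfr] := pselect (fair_session d lsh S W query c r delta qs (st_mem s)).
  rewrite indicE mem_set//= lee_fin lerBlDr lerDl; apply: sumr_ge0 => i _.
  by apply: sumr_ge0 => q _; exact: level_failure_ge0.
rewrite indicE memNset//= lee_fin subr_le0 leNgt; apply/negP => lt1; apply: nfr.
apply: good_session_fair => // q i qqs ik; apply: le_lt_trans lt1.
rewrite (bigD1 (Ordinal ik))//= /f (big_rem q qqs)/= -addrA lerDl addr_ge0//.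
  by apply: sumr_ge0 => q' _; exact: level_failure_ge0.
by apply: sumr_ge0 => j _; apply: sumr_ge0 => q' _; exact: level_failure_ge0.
Qed.

End data_structure.

(** * Choice of the parameters *)

Section parameters.
Context {R : realType}.

Lemma least_nat (P : pred nat) : (exists x, P x) ->
  exists x, P x /\ forall j, (j < x)%N -> ~~ P j.
Proof.
move=> h; exists (ex_minn h); case: ex_minnP => x Px min; split=> // j jx.
by apply/negP => /min; lia.
Qed.

Lemma exprn_ln (p : R) (K : nat) : 0 < p -> p ^+ K = expR (K%:R * ln p).
Proof. by move=> p0; rewrite expRM_natl lnK. Qed.

(** Lets additive constants be absorbed into the logarithm. *)
Lemma ln_nat_ge (n : nat) : (2 <= n)%N -> 2^-1 <= ln n%:R :> R.
Proof.
move=> n2; rewrite -[leLHS]expRK ler_ln ?posrE ?expR_gt0 ?ltr0n//; last lia.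
apply: (@le_trans _ _ 2); last by rewrite ler_nat.
have := @expR_le_affine R 2^-1; rewrite lexx invr_ge0 ler0n /= => /(_ isT).
by rewrite mulfV// -natr1.
Qed.

Lemma least_hash_count (p : R) (n : nat) : 0 < p < 1 -> (2 <= n)%N ->
  exists K, [/\ (0 < K)%N, n%:R * p ^+ K <= 1,
    forall j, (j < K)%N -> 1 < n%:R * p ^+ j
    & (K.-1)%:R * - ln p <= ln n%:R].
Proof.
move=> /andP[p0 p1] n2; have n0 : 0 < n%:R :> R by rewrite ltr0n; lia.
have lp : 0 < - ln p by rewrite oppr_gt0 ln_lt0// p0.
have E K : n%:R * p ^+ K = expR (ln n%:R - K%:R * - ln p).
  by rewrite expRD lnK ?posrE// exprn_ln// mulrN opprK.
have [|K [hK min]] := @least_nat (fun K => n%:R * p ^+ K <= 1).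
  exists (Num.truncn (ln n%:R / - ln p)).+1; rewrite E -[leRHS]expR0 ler_expR subr_le0.
  by rewrite -ler_pdivrMr// ltW// truncnS_gt.
have K0 : (0 < K)%N.
  by case: K hK {min} => //; rewrite expr0 mulr1 leNgt ltr1n n2.
exists K; split=> //; first by move=> j /min; rewrite -ltNge.
have /min : (K.-1 < K)%N by rewrite prednK.
by rewrite -ltNge E -[ltLHS]expR0 ltr_expR subr_gt0 => /ltW.
Qed.

Lemma least_table_count (A : nat) (y : R) : (0 < A)%N -> 0 < y ->
  exists L, [/\ (0 < L)%N, A%:R <= L%:R * y,
    forall j, (j < L)%N -> j%:R * y < A%:R & L%:R <= A%:R / y + 1].
Proof.
move=> A0 y0.
have [|L [hL min]] := @least_nat (fun L => A%:R <= L%:R * y).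
  by exists (Num.truncn (A%:R / y)).+1; rewrite -ler_pdivrMr// ltW// truncnS_gt.
have L0 : (0 < L)%N.
  by case: L hL {min} => //; rewrite mul0r leNgt ltr0n A0.
exists L; split=> //; first by move=> j /min; rewrite -ltNge.
have /min : (L.-1 < L)%N by rewrite prednK.
rewrite -ltNge -ltr_pdivlMr// => /ltW h.
by have -> : L%:R = (L.-1)%:R + 1 :> R; [rewrite natr1 prednK|rewrite lerD2r].
Qed.

Lemma root_pow (c : R) (k : nat) : 0 <= c -> (0 < k)%N -> (c `^ k%:R^-1) ^+ k = c.
Proof.
move=> c0 k0; rewrite -powR_mulrn ?powR_ge0// -powRrM mulVf ?powRr1//.
by rewrite pnatr_eq0 -lt0n.
Qed.

Lemma least_root (n k : nat) : (2 <= n)%N -> (0 < k)%N ->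
  exists N, [/\ (0 < N)%N, n%:R <= (N%:R : R) ^+ k,
    forall j, (j < N)%N -> (j%:R : R) ^+ k < n%:R & N%:R <= n%:R `^ k%:R^-1 + 1 :> R].
Proof.
move=> n2 k0.
have [|N [hN min]] := @least_nat (fun N => n%:R <= (N%:R : R) ^+ k).
  exists n; apply: ler_eXnr => //; rewrite ler1n; lia.
have N0 : (0 < N)%N.
  by case: N hN {min} => //; rewrite expr0n (gtn_eqF k0) leNgt ltr0n; lia.
exists N; split=> //; first by move=> j /min; rewrite -ltNge.
have /min : (N.-1 < N)%N by rewrite prednK.
rewrite -ltNge -[X in _ < X](root_pow (ler0n _ n) k0) => h.
have : (N.-1)%:R < n%:R `^ k%:R^-1 :> R.
  rewrite ltNge; apply/negP => h'; move: h; rewrite ltNge => /negP; apply.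
  by apply: lerXn2r; rewrite ?nnegrE ?powR_ge0.
move/ltW => h'.
by have -> : N%:R = (N.-1)%:R + 1 :> R; [rewrite natr1 prednK|rewrite lerD2r].
Qed.

(* [ln (1 / p1) = rho * ln (1 / p2)] turns [p1 ^ (K - 1)] into a power of
   [p2 ^ (K - 1) > 1 / n]. *)
Lemma near_power_bound (p1 p2 rho : R) (n K : nat) : 0 < p1 < 1 -> 0 < p2 < 1 ->
  rho = ln (1 / p1) / ln (1 / p2) -> (2 <= n)%N -> (0 < K)%N -> 0 < rho ->
  (K.-1)%:R * - ln p2 <= ln n%:R -> (p1 ^+ K)^-1 <= p1^-1 * n%:R `^ rho.
Proof.
move=> /andP[p10 p11] /andP[p20 p21] rhoE n2 K0 rho0 hK.
have n0 : 0 < n%:R :> R by rewrite ltr0n; lia.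
have lp : 0 < - ln p2 by rewrite oppr_gt0 ln_lt0// p20.
have l1 : - ln p1 = rho * - ln p2.
  by rewrite rhoE !div1r !lnV ?posrE// divfK// gt_eqF.
rewrite -{1}(prednK K0) exprS invfM ler_pM2l ?invr_gt0//.
rewrite exprn_ln// -expRN /powR gt_eqF// ler_expR -mulrN l1 mulrCA.
by rewrite ler_wpM2l// ltW.
Qed.

(** The bounds involve [p1] but not the threshold [P], which depends on the hash family: as
    [p1 <= P], tuning to [P] needs no more tables than tuning to [p1]. Additive units are absorbed
    by [1 <= 2 * ln n]. *)
Lemma level_parameters (p1 p2 rho P : R) (n c0 : nat) : 0 < p1 < 1 -> 0 < p2 < 1 ->
  rho = ln (1 / p1) / ln (1 / p2) -> 0 < rho -> p1 <= P <= 1 -> (2 <= n)%N -> (0 < c0)%N ->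
  exists K L, [/\ (0 < K)%N /\ (0 < L)%N,
    n%:R * p2 ^+ K <= 1 /\ (forall j, (j < K)%N -> 1 < n%:R * p2 ^+ j),
    (c0 * K)%:R <= L%:R * P ^+ K /\ (forall j, (j < L)%N -> j%:R * P ^+ K < (c0 * K)%:R),
    K%:R <= (2 + (- ln p2)^-1) * ln n%:R
    & L%:R <= (c0%:R * (2 + (- ln p2)^-1) * p1^-1 + 2) * ln n%:R * n%:R `^ rho].
Proof.
move=> hp1 hp2 rhoE rho0 /andP[pP P1] n2 c00.
have /andP[p10 p11] := hp1; have /andP[p20 p21] := hp2.
have lp : 0 < - ln p2 by rewrite oppr_gt0 ln_lt0// p20.
have ln2 := ln_nat_ge n2; set l := ln n%:R in ln2 *.
have [K [K0 hK hK' bK]] := least_hash_count hp2 n2.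
have P0 : 0 < P by exact: lt_le_trans pP.
have A0 : (0 < c0 * K)%N by rewrite muln_gt0 c00.
have [L [L0 hL hL' bL]] := least_table_count A0 (exprn_gt0 K P0).
have KE : K%:R <= (2 + (- ln p2)^-1) * l.
  have -> : K%:R = (K.-1)%:R + 1 :> R by rewrite natr1 prednK.
  rewrite mulrDl [leRHS]addrC lerD//; first by rewrite mulrC ler_pdivlMr.
  by lra.
exists K, L; split=> //.
have yb : (P ^+ K)^-1 <= p1^-1 * n%:R `^ rho.
  apply: le_trans (near_power_bound hp1 hp2 rhoE n2 K0 rho0 bK).
  rewrite lef_pV2 ?posrE ?exprn_gt0//; apply: lerXn2r => //; rewrite nnegrE ltW//.
have nr1 : 1 <= n%:R `^ rho.
  rewrite -[leLHS](powRr0 n%:R); apply: ler_powR; last exact: ltW.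
  by rewrite ler1n (leq_trans _ n2).
apply: le_trans bL _.
have -> : (c0%:R * (2 + (- ln p2)^-1) * p1^-1 + 2) * l * n%:R `^ rho =
   c0%:R * ((2 + (- ln p2)^-1) * l) * (p1^-1 * n%:R `^ rho) + 2 * l * n%:R `^ rho by ring.
apply: lerD; last by apply: (@le_trans _ _ (2 * l)); [lra|rewrite ler_peMr//; lra].
rewrite natrM; apply: ler_pM => //.
- by rewrite invr_ge0 exprn_ge0// ltW.
- exact: ler_wpM2l.
Qed.

(** This [c1] does not depend on n. Raised to the power K, the inequality turns n p^K <= 1 into a
    polynomial bound on 2^(- c1 K). *)
Lemma copies_exist (p : R) (e : nat) : 0 < p -> exists c1, (0 < c1)%N /\ 2^-1 ^+ c1 <= p ^+ e.
Proof.
move=> p0; have pe : 0 < p ^+ e by exact: exprn_gt0.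
exists (Num.truncn (p ^+ e)^-1).+1; split=> //.
rewrite exprVn -[leRHS]invrK lef_pV2 ?posrE ?exprn_gt0 ?invr_gt0//.
apply: (@le_trans _ _ (Num.truncn (p ^+ e)^-1).+1%:R); first by rewrite ltW// truncnS_gt.
by rewrite -natrX ler_nat ltnW// ltn_expl.
Qed.

Lemma two_expn_double (B : nat) : (0 < B)%N -> (2 * B <= 2 ^ B)%N.
Proof. by elim: B => // -[_ _ //|B IH _]; rewrite expnS; have := IH isT; lia. Qed.

Lemma expRN_double (B : nat) : expR (- (2 * B)%:R) <= (2^-1 ^+ B) * (2^-1 ^+ B) :> R.
Proof.
rewrite -exprD addnn -mul2n exprVn expRN lef_pV2 ?posrE ?exprn_gt0 ?expR_gt0//.
rewrite -[(2 * B)%:R]mulr1 expRM_natl; apply: lerXn2r; rewrite ?nnegrE ?expR_ge0//.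
by apply: le_trans (expR_ge1Dx _); rewrite -natr1.
Qed.

(** Put B = c1 K and t = 2^(-B), so that t <= n^-(a + 1 + 2 k). As exp (- 2 B) <= t^2 and 2 B t <=
    1, the loss is at most (n + 1) t. The exponent pays for delta with n^a, for n + 1 with n^(1 +
    k), and for the division among k levels with n^k. *)
Lemma loss_bound (p : R) (n a k c1 K : nat) : 0 < p < 1 -> (2 <= n)%N -> (0 < k)%N ->
  (0 < c1)%N -> (0 < K)%N -> n%:R * p ^+ K <= 1 -> 2^-1 ^+ c1 <= p ^+ (a + 1 + k + k) ->
  let A := (2 * c1 * K)%N in
  expR (- A%:R) <= (n%:R ^+ a)^-1 :> R /\
  (A * n)%:R * expR (- A%:R) + 2^-1 ^+ A <= (n%:R ^+ a)^-1 / k%:R :> R.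
Proof.
move=> /andP[p0 p1] n2 k0 c10 K0 hK hc A.
have n1 : 1 <= n%:R :> R by rewrite ler1n; lia.
have n0 : 0 < n%:R :> R by rewrite ltr0n; lia.
pose B := (c1 * K)%N; pose t : R := 2^-1 ^+ B.
have t0 : 0 <= t by rewrite exprn_ge0.
have B0 : (0 < B)%N by rewrite muln_gt0 c10.
have AE : A = (2 * B)%N by rewrite /A /B mulnA.
have tb : t * n%:R ^+ (a + 1 + k + k) <= 1.
  have : t <= (p ^+ K) ^+ (a + 1 + k + k).
    rewrite -exprM mulnC exprM /t /B exprM; apply: lerXn2r => //.
      by rewrite nnegrE exprn_ge0.
    by rewrite nnegrE exprn_ge0// ltW.
  move=> ht; apply: le_trans (ler_wpM2r _ ht) _; first by rewrite exprn_ge0// ltW.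
  by rewrite -exprMn exprn_ile1// ?mulr_ge0 ?exprn_ge0 1?mulrC// ltW.
have t1 : t <= 1.
  apply: le_trans tb; rewrite ler_peMr// exprn_ege1//.
have eb : expR (- A%:R) <= t * t by rewrite AE; exact: expRN_double.
have na : 0 < n%:R ^+ a :> R by exact: exprn_gt0.
have tn : t * n%:R ^+ a <= 1.
  apply: le_trans tb; apply: ler_wpM2l => //; rewrite -!addnA ler_weXn2l//.
  exact: leq_addr.
split.
  apply: (le_trans eb); rewrite -[leRHS]mul1r ler_pdivlMr//; apply: le_trans tn.
  by apply: ler_wpM2r; [rewrite ltW|rewrite ler_piMr].
have Bt : (2 * B)%:R * t <= 1.
  rewrite /t exprVn ler_pdivrMr ?exprn_gt0// mul1r -natrX ler_nat.
  exact: two_expn_double.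
have s1 : (A * n)%:R * expR (- A%:R) <= n%:R * t.
  apply: (@le_trans _ _ ((A * n)%:R * (t * t))); first exact: ler_wpM2l.
  rewrite AE natrM; have -> : (2 * B)%:R * n%:R * (t * t) = ((2 * B)%:R * t) * (n%:R * t) by ring.
  by rewrite ler_piMl// mulr_ge0.
have s2 : 2^-1 ^+ A <= t.
  rewrite AE mul2n -addnn exprD -/t ler_piMr//.
apply: (@le_trans _ _ ((n%:R + 1) * t)); first by rewrite mulrDl mul1r lerD.
have kR : 0 < k%:R :> R by rewrite ltr0n.
rewrite ler_pdivlMr// -[leRHS]mul1r ler_pdivlMr//; apply: le_trans tb.
rewrite !exprD expr1.
have k1 : k%:R <= n%:R ^+ k :> R.
  rewrite -natrX ler_nat; apply: leq_trans (_ : 2 ^ k <= n ^ k)%N; first exact/ltnW/ltn_expl.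
  by rewrite leq_exp2r.
have k2 : n%:R + 1 <= n%:R * n%:R ^+ k :> R.
  apply: (@le_trans _ _ (n%:R * n%:R)).
    have : 2 <= n%:R :> R by rewrite ler_nat.
    by nra.
  by rewrite ler_pM2l// ler_eXnr.
have -> : (n%:R + 1) * t * k%:R * n%:R ^+ a = (t * n%:R ^+ a) * ((n%:R + 1) * k%:R) by ring.
have -> : t * (n%:R ^+ a * n%:R * n%:R ^+ k * n%:R ^+ k) =
  (t * n%:R ^+ a) * ((n%:R * n%:R ^+ k) * n%:R ^+ k) by ring.
apply: ler_wpM2l; first by rewrite mulr_ge0 ?exprn_ge0// ltW.
by apply: ler_pM => //; rewrite addr_ge0 ?ltW.
Qed.

End parameters.

(** * Running time, space and word size *)

Section costs.
Context {R : realType}.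

Lemma lg_le_ln (x : nat) : (0 < x)%N -> (lg x)%:R <= 2 * ln x%:R + 1 :> R.
Proof.
case: x => // x _; rewrite /lg -natr1 lerD2r; set t := trunc_log 2 x.+1.
have h : (2 ^ t <= x.+1)%N by exact: trunc_logP.
have : ln (2 ^ t)%:R <= ln x.+1%:R :> R by rewrite ler_ln ?posrE ?ltr0n ?expn_gt0// ler_nat.
have -> : ln (2 ^ t)%:R = t%:R * ln 2 :> R by rewrite natrX lnXn// mulr_natl.
move=> h'.
have ln2 := @ln_nat_ge R 2 (leqnn _).
have := ler_wpM2l (ler0n R t) ln2.
by lra.
Qed.

Lemma budget_bound c0 Kf Lf N i (u Y : R) : 1 <= u -> 1 <= Y ->
  (copies c0 Kf i)%:R <= u -> (Lf i)%:R <= u * Y -> N%:R <= u * Y ->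
  (level_budget c0 Kf Lf (fun=> N) i)%:R <= 36 * (u ^+ 3 * Y).
Proof.
move=> u1 Y1; rewrite /level_budget /budget.
move: (copies c0 Kf i) (Lf i) => A L A_le L_le N_le.
have -> : (6 * A * (3 * L + (A + 2) * N))%:R = 6 * A%:R * (3 * L%:R + (A%:R + 2) * N%:R) :> R.
  by rewrite natrM natrM natrD natrM natrM natrD.
have A0 : 0 <= A%:R :> R by [].
have u0 : 0 <= u by exact: le_trans u1.
have uY : u * Y <= u * (u * Y) by rewrite ler_peMl// mulr_ge0// (le_trans _ Y1).
have e1 : (A%:R + 2) * N%:R <= (3 * u) * (u * Y).
  by apply: ler_pM => //; lra.
have e2 : 3 * L%:R + (A%:R + 2) * N%:R <= 6 * (u * (u * Y)) by lra.
have -> : 36 * (u ^+ 3 * Y) = 6 * u * (6 * (u * (u * Y))) by ring.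
have e3 : 0 <= 3 * L%:R + (A%:R + 2) * N%:R by [].
by apply: ler_pM => //; lra.
Qed.

Section query_cost.
Variables (d n k : nat) (c0 Kf Lf : nat -> nat) (N : nat).
Variables (u Y : R).
Local Notation copies := (copies c0 Kf).
Local Notation D := (d%:R : R).
Hypotheses (u1 : 1 <= u) (Y1 : 1 <= Y) (d_gt0 : (0 < d)%N).
Hypothesis hK : forall i, (i < k)%N -> (Kf i)%:R <= u.
Hypothesis hA : forall i, (i < k)%N -> (copies i)%:R <= u.
Hypothesis hL : forall i, (i < k)%N -> (Lf i)%:R <= u * Y.
Hypothesis hN : N%:R <= u * Y.
Hypothesis hlgn : (lg n)%:R <= u.
Hypothesis hlgL : forall i, (i < k)%N -> (lg (Lf i))%:R <= u.

Let D1 : 1 <= D. Proof. by rewrite ler1n. Qed.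
Let u0 : 0 <= u. Proof. exact: le_trans u1. Qed.
Let Y0 : 0 <= Y. Proof. exact: le_trans Y1. Qed.
Let D0 : 0 <= D. Proof. by []. Qed.

(** Of the five factors [u], one comes from the K evaluations in a fingerprint, three from the
    budget and one from the number of copies. *)
Lemma level_time_bound i : (i < k)%N ->
  (level_time d n k c0 Kf Lf (fun=> N) i)%:R <= (63 * 1000 + 40 * k%:R) * (u ^+ 5 * D * Y).
Proof.
move=> ik; have B_le := budget_bound u1 Y1 (hA ik) (hL ik) hN; have K_le := hK ik; have A_le := hA ik; have L_le := hL ik.
have l_le := hlgL ik.
rewrite /level_time /params_time /copy_time.
set Bu := level_budget _ _ _ _ _ in B_le *; set A := copies i in A_le *.
move: Bu A B_le A_le => Bu A B_le A_le.
have [u1' Y1' D1' hN' hlgn'] := And5 u1 Y1 D1 hN hlgn.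
have K0 : 0 <= (Kf i)%:R :> R by [].
have A0 : 0 <= A%:R :> R by [].
have L0 : 0 <= (Lf i)%:R :> R by [].
have N0 : 0 <= N%:R :> R by [].
have B0 : 0 <= Bu%:R :> R by [].
have k0 : 0 <= k%:R :> R by [].
have hash : (hash_time d (Kf i))%:R <= 82 * (u * D).
  rewrite /hash_time natrM natrD -[(Kf i).+1%:R]natr1.
  have -> : 82 * (u * D) = (41 * D) * (2 * u) by ring.
  by apply: ler_pM; lra.
have uD : 1 <= u * D by rewrite mulr_ege1.
have probe : (probe_time d n (Kf i))%:R <= 364 * (u * (u * D)).
  rewrite /probe_time natrM natrD -[(lg n).+1%:R]natr1.
  have -> : 364 * (u * (u * D)) = (182 * (u * D)) * (2 * u) by ring.
  by apply: ler_pM => //; lra.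
have trial : (trial_time d (Kf i) (Lf i))%:R <= 700 * (u * D).
  rewrite /trial_time; move: (hash_time d (Kf i)) hash => ht hash; rewrite !natrD !natrM -[(lg _).+1%:R]natr1.
  have h1 : u <= u * D by rewrite ler_peMr.
  have h2 : D <= u * D by rewrite ler_peMl.
  by lra.
have uuD : 1 <= u * (u * D) by rewrite mulr_ege1.
have uY : 1 <= u * Y by rewrite mulr_ege1.
set P := (probe_time _ _ _) in probe *; set Tt := (trial_time _ _ _) in trial *.
have P0 : 0 <= P%:R :> R by [].
have T0 : 0 <= Tt%:R :> R by [].
have [X XE] : exists X, X = u ^+ 4 * D * Y by exists (u ^+ 4 * D * Y).
have X3 : u ^+ 3 * D * Y <= X.
  by rewrite XE; do 2 apply: ler_wpM2r => //; exact: ler_weXn2l.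
have X1 : 1 <= X by rewrite XE !mulr_ege1// exprn_ege1.
have s1 : (3 * P%:R + 60) * ((Lf i)%:R + 1) <= 2304 * X.
  apply: (@le_trans _ _ ((1152 * (u * (u * D))) * (2 * (u * Y)))).
    by apply: ler_pM; clear K_le l_le B_le A_le hN' hlgn' K0 A0 N0 B0 k0 hash trial XE X3 X1; lra.
  have -> : (1152 * (u * (u * D))) * (2 * (u * Y)) = 2304 * (u ^+ 3 * D * Y) by ring.
  exact: (ler_wpM2l (ler0n _ _) X3).
have s2 : (Tt%:R + 20) * (Bu%:R + (Lf i)%:R) <= 720 * 37 * X.
  have -> : 720 * 37 * X = (720 * (u * D)) * (37 * (u ^+ 3 * Y)) by rewrite XE; ring.
  have h : u * Y <= u ^+ 3 * Y by rewrite ler_wpM2r// ler_eXnr.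
  by apply: ler_pM; clear K_le l_le A_le hN' hlgn' K0 A0 N0 k0 hash probe XE X3 X1 s1; lra.
pose CT := ((3 * P + 60) * (Lf i).+1 + (Tt + 20) * (Bu + Lf i) + 60)%N.
have cp : CT%:R <= 30 * 1000 * X.
  rewrite /CT natrD natrD natrM natrM natrD natrM natrD natrD -[(Lf i).+1%:R]natr1.
  by clear K_le l_le B_le A_le hN' hlgn' K0 A0 N0 k0 hash probe trial XE X3; lra.
rewrite -/CT; move: CT cp => CT cp.
have X5 : u ^+ 5 * D * Y = u * X by rewrite XE exprS; ring.
rewrite X5; have uX : X <= u * X by rewrite ler_peMl// (le_trans ler01).
have s3 : (CT%:R + 20) * (A%:R + 1) <= 62 * 1000 * (u * X).
  have -> : 62 * 1000 * (u * X) = (31 * 1000 * X) * (2 * u) by ring.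
  have c0' : 0 <= CT%:R :> R by [].
  by apply: ler_pM; clear K_le L_le l_le B_le hN' hlgn' K0 N0 k0 hash probe trial XE X3 s1 s2 X5; lra.
have uYX : u * Y <= X.
  apply: le_trans X3; apply: ler_wpM2r => //; apply: (@le_trans _ _ (u ^+ 3)).
    exact: ler_eXnr.
  by rewrite ler_peMr// exprn_ge0.
have uu : u <= u * Y by rewrite ler_peMr.
have NX : k.+1%:R * N%:R <= (k%:R + 1) * X.
  rewrite natr1; apply: ler_wpM2l => //; exact: le_trans uYX.
have -> : (40 * (Kf i + Lf i + k.+1 * N + 10) + (CT + 20) * A.+1)%:R =
  40 * ((Kf i)%:R + (Lf i)%:R + k.+1%:R * N%:R + 10) + (CT%:R + 20) * (A%:R + 1) :> R.
  by rewrite natr1 -[k.+1%:R * _]natrM -!natrD -!natrM -natrD.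
have kX : k%:R * X <= k%:R * (u * X) by exact: ler_wpM2l.
by clear l_le B_le A_le hN' hlgn' hash probe trial XE X3 s1 s2 cp X5; lra.
Qed.

Lemma query_time_bound :
  (query_time d n k c0 Kf Lf (fun=> N))%:R <=
    (k%:R * (63 * 1000 + 40 * k%:R) + 10) * (u ^+ 5 * D * Y).
Proof.
rewrite /query_time natrD natr_sum mulrDl; apply: lerD; last first.
  by rewrite ler_peMr// !mulr_ege1// exprn_ege1.
apply: (@le_trans _ _ (\sum_(i < k) (63 * 1000 + 40 * k%:R) * (u ^+ 5 * D * Y))).
  by apply: ler_sum => i _; exact: level_time_bound.
by rewrite sumr_const card_ord -[leLHS]mulr_natl mulrA.
Qed.

End query_cost.

(** One bound on the addresses of every level is enough, so a sum stands in for their maximum. *)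
Definition total_space (n k : nat) (c0 Kf Lf : nat -> nat) : nat :=
  (\sum_(i < k) (copies c0 Kf i * Lf i * (Kf i + n) + 1) * nkinds k)%N.

Lemma level_space_total n k c0 Kf Lf i : (i < k)%N ->
  ((copies c0 Kf i * Lf i * (Kf i + n) + 1) * nkinds k <= total_space n k c0 Kf Lf)%N.
Proof. by move=> ik; rewrite /total_space (bigD1 (Ordinal ik))//= leq_addr. Qed.

Lemma total_space_bound n k c0 Kf Lf (x y w : R) : 1 <= x -> 1 <= y -> 1 <= w ->
  (forall i, (i < k)%N -> (copies c0 Kf i)%:R <= x) ->
  (forall i, (i < k)%N -> (Lf i)%:R <= y) ->
  (forall i, (i < k)%N -> (Kf i + n)%:R <= w) ->
  (total_space n k c0 Kf Lf)%:R <= (2 * k * nkinds k)%:R * (x * y * w).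
Proof.
move=> x1 y1 w1 hA hL hK; rewrite /total_space natr_sum.
have xyw : 1 <= x * y * w by rewrite !mulr_ege1.
apply: (@le_trans _ _ (\sum_(i < k) (2 * (x * y * w)) * (nkinds k)%:R)).
  apply: ler_sum => i _; rewrite natrM ler_wpM2r// natrD.
  have : (copies c0 Kf i * Lf i * (Kf i + n))%:R <= x * y * w.
    rewrite natrM natrM; apply: ler_pM; rewrite ?mulr_ge0//; last exact: hK.
    by apply: ler_pM => //; [exact: hA|exact: hL].
  by lra.
rewrite sumr_const card_ord -[leLHS]mulr_natl !natrM le_eqVlt; apply/orP; left; apply/eqP; ring.
Qed.

(** A deliberately crude count: with [v] a multiple of n, every word stays below a constant times
    n^4. *)
Lemma words_fit n W k c0 Kf Lf N (v : R) : (0 < k)%N -> (0 < n)%N -> 1 <= v -> n%:R <= v ->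
  (forall i, (i < k)%N -> (Kf i)%:R <= v) ->
  (forall i, (i < k)%N -> (copies c0 Kf i)%:R <= v) ->
  (forall i, (i < k)%N -> (Lf i)%:R <= v * n%:R) -> N%:R <= v ->
  (forall i, (i < k)%N -> (c0 i <= \sum_(j < k) c0 j)%N) ->
  (42 + 6 * k * nkinds k + \sum_(j < k) c0 j)%:R * (v ^+ 3 * n%:R) < W%:R ->
  (total_space n k c0 Kf Lf < W)%N /\ forall i, (i < k)%N -> level_fits n W k c0 Kf Lf (fun=> N) i.
Proof.
move=> k0 n0 v1 nv hK hA hL hN hc.
set s := (\sum_(j < k) c0 j)%N in hc *; set z := nkinds k; pose X := v ^+ 3 * n%:R.
rewrite -/X => hW.
have n1 : 1 <= n%:R :> R by rewrite ler1n.
have v0 : 0 <= v by exact: le_trans v1.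
have n0' : 0 <= n%:R :> R by [].
have X1 : 1 <= X by rewrite mulr_ege1// exprn_ege1.
have zk : 1 <= z%:R :> R by rewrite ler1n.
have kz : z%:R <= (k * z)%:R :> R by rewrite ler_nat leq_pmull.
have {}hW : 42 * X + 6 * ((k * z)%:R * X) + s%:R * X < W%:R.
  suff <- : (42 + 6 * k * z + s)%:R * X = 42 * X + 6 * ((k * z)%:R * X) + s%:R * X by [].
  by rewrite natrD natrD -mulnA natrM; ring.
have sX : 0 <= s%:R * X by rewrite mulr_ge0// (le_trans ler01).
have kzX : z%:R * X <= (k * z)%:R * X by rewrite ler_wpM2r// (le_trans ler01).
have zX : X <= z%:R * X by rewrite ler_peMl// (le_trans ler01).
have vn : v * n%:R <= X by rewrite /X ler_wpM2r// ler_eXnr.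
have vX : v <= v * n%:R by rewrite ler_peMr.
have vn1 : 1 <= v * n%:R by rewrite mulr_ege1.
have Kn i : (i < k)%N -> (Kf i + n)%:R <= 2 * v.
  by move=> /hK h; rewrite natrD; lra.
have ALK i : (i < k)%N -> (copies c0 Kf i * Lf i * (Kf i + n))%:R <= 2 * X.
  move=> ik; have -> : 2 * X = v * (v * n%:R) * (2 * v) by rewrite /X; ring.
  rewrite natrM natrM; apply: ler_pM; rewrite ?mulr_ge0 ?Kn//.
  by apply: ler_pM; rewrite ?hA ?hL.
split.
  rewrite -(ltr_nat R); apply: le_lt_trans hW.
  have v2 : 1 <= 2 * v by lra.
  apply: le_trans (total_space_bound v1 vn1 v2 hA hL Kn) _.
  have -> : v * (v * n%:R) * (2 * v) = 2 * X by rewrite /X; ring.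
  have -> : (2 * k * nkinds k)%:R * (2 * X) = 4 * ((k * z)%:R * X) by rewrite -mulnA natrM; ring.
  by lra.
move=> i ik; split; rewrite -(ltr_nat R); apply: le_lt_trans hW.
- rewrite natrD; have : (c0 i)%:R <= s%:R :> R by rewrite ler_nat hc.
  have : s%:R <= s%:R * X by rewrite ler_peMr.
  by lra.
- rewrite natrM !natrD.
  have h : (copies c0 Kf i * Lf i * (Kf i + n))%:R + (Lf i)%:R + 3 <= 6 * X.
    by have := ALK i ik; have := hL i ik; lra.
  apply: (@le_trans _ _ (6 * X * z%:R)); first by rewrite ler_wpM2r.
  by rewrite -mulrA (mulrC X); lra.
- by rewrite -natr1; lra.
- by have := budget_bound v1 n1 (hA i ik) (hL i ik) (le_trans hN vX); rewrite -/X; lra.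
- apply: (@le_trans _ _ X); last lra.
  rewrite natrM natrM; have -> : X = (v * (v * n%:R)) * v by rewrite /X; ring.
  by apply: ler_pM; rewrite ?mulr_ge0 ?hK//; apply: ler_pM; rewrite ?hL.
Qed.

End costs.

(** [P] is the infimum of the collision probabilities of pairs within distance [s]; by monotonicity
    a more distant pair collides no more often than any of these. With [p1] in its place nothing
    would bound the collisions of points lying between [s] and [cc * s]. *)
Lemma collision_threshold (R : realType) (M : metricType R) (F : hash_family R M)
    (cc s p1 p2 : R) : 0 < s -> 0 < p1 < 1 -> is_LSH F cc s p1 p2 -> monotone_LSH F ->
  exists P, [/\ p1 <= P <= 1,
    forall x y : M, mdist x y <= s -> (P%:E <= collision F x y)%E
    & forall x y : M, s < mdist x y -> (collision F x y <= P%:E)%E].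
Proof.
move=> s0 /andP[p10 p11] [mF hn _] mono.
have mE (x y : M) : measurable [set w : hf_seed F | hf_eval w x = hf_eval w y].
  by rewrite -collision_set; exact: measurable_collision.
have fc (x y : M) : collision F x y = (fine (collision F x y))%:E.
  by rewrite fineK//; exact: fin_num_measure.
(* Every point is within [s] of itself, so without such a pair the space is empty and any threshold
   does. *)
have [[x1 [y1 d1]]|none] := pselect (exists x y : M, mdist x y <= s); last first.
  exists p1; split=> [|x y d|x y d]; first by rewrite lexx ltW.
    by exfalso; apply: none; exists x, y.
  by exfalso; apply: none; exists x, x; rewrite mdistxx ltW.
pose E := [set v : R | exists x y : M, mdist x y <= s /\ v = fine (collision F x y)].
have lb : lbound E p1.
  by move=> _ [x [y [d ->]]]; rewrite -lee_fin -fc; exact: hn.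
have hE : has_inf E by split; [exists (fine (collision F x1 y1)), x1, y1|exists p1].
have near x y : mdist x y <= s -> inf E <= fine (collision F x y).
  by move=> d; apply: ge_inf; [exists p1|exists x, y].
exists (inf E); split.
- apply/andP; split; first by apply: lb_le_inf => //; exact: (proj1 hE).
  apply: le_trans (near _ _ d1) _; by rewrite -lee_fin -fc; exact: probability_le1.
- by move=> x y /near; rewrite -lee_fin -fc.
- move=> x y d; rewrite fc lee_fin; apply: lb_le_inf; first exact: (proj1 hE).
  move=> _ [x' [y' [d' ->]]]; rewrite -lee_fin -!fc; apply: mono.
  exact: le_trans d' (ltW d).
Qed.

(** The space carries only the second power of [l]; passing to the fifth costs a factor 8 because 2
    l >= 1, and the other 8 in [Cs] gathers the factors 2. *)
Lemma space_arith (R : realType) (u kz al l x Z Ct Cs : R) : 0 <= al -> 2^-1 <= l -> 0 <= x ->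
  0 <= Z -> 0 <= kz -> 0 <= Ct -> Cs = 64 * kz * al ^+ 3 ->
  u <= 2 * kz * (al * l * (al * l * Z) * (2 * al * x)) ->
  u + u <= (Ct + Cs) * (x * Z) * l ^+ 5.
Proof.
move=> al0 l2 x0 Z0 kz0 Ct0 CsE hu.
have l0 : 0 <= l by lra.
have l5 : l ^+ 2 <= 8 * l ^+ 5.
  have -> : 8 * l ^+ 5 = l ^+ 2 * (2 * l) ^+ 3 by ring.
  by apply: ler_peMr; [exact: exprn_ge0|apply: exprn_ege1; lra].
have p0 : 0 <= 8 * kz * al ^+ 3 * (x * Z).
  by apply: mulr_ge0; [apply: mulr_ge0; [exact: mulr_ge0|exact: exprn_ge0]|exact: mulr_ge0].
have e1 : 2 * (2 * kz * (al * l * (al * l * Z) * (2 * al * x))) =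
  8 * kz * al ^+ 3 * (x * Z) * l ^+ 2 by ring.
have e2 : Cs * (x * Z) * l ^+ 5 = 8 * kz * al ^+ 3 * (x * Z) * (8 * l ^+ 5) by rewrite CsE; ring.
have h := ler_wpM2l p0 l5; rewrite -e1 -e2 in h.
have : 0 <= Ct * (x * Z) * l ^+ 5.
  by apply: mulr_ge0; [apply: mulr_ge0 Ct0 (mulr_ge0 x0 Z0)|exact: exprn_ge0].
rewrite mulrDl mulrDl; move: h hu; lra.
Qed.

(** Each of [al] and [l] is at most its own exponential, so ln L <= al + l + rh l. *)
Lemma lg_table_bound (R : realType) (L : nat) (al l rh : R) : (0 < L)%N -> 2 <= al ->
  2^-1 <= l -> 0 < rh < 1 -> L%:R <= al * l * expR (rh * l) -> (lg L)%:R <= 14 * al * l.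
Proof.
move=> L0 al2 l2 /andP[rh0 rh1] hL.
have h1 := @lg_le_ln R L L0.
have h2 : ln L%:R <= al + l + rh * l.
  rewrite -[leRHS]expRK ler_ln ?posrE ?expR_gt0 ?ltr0n//.
  apply: le_trans hL _; rewrite !expRD; apply: ler_wpM2r; first exact: expR_ge0.
  by apply: ler_pM; [lra|lra|have := expR_ge1Dx al; lra|have := expR_ge1Dx l; lra].
have h3 : rh * l <= l by nra.
have h4 : al <= 2 * (al * l) by nra.
have h5 : 2 * l <= al * l by nra.
by rewrite -mulrA; lra.
Qed.

Theorem theorem7 (R : realType) (rho : R -> R) (p1 p2 : R -> R -> R) (c r : R)
    (kbar : nat)
    (hc : 1 < c) (hr : 0 < r)
    (hp : forall c' s : R, 1 < c' -> 0 < s ->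
       [/\ 0 < p1 c' s < 1, 0 < p2 c' s < 1,
           rho c' = ln (1 / p1 c' s) / ln (1 / p2 c' s) & 0 < rho c' < 1])
    (hk0 : (0 < kbar)%N)
    (hkbar : forall k : nat, (0 < k)%N ->
       level_exponent rho c kbar <= level_exponent rho c k)
    (a : nat) :
  exists (C : R) (e w : nat),
  forall (d : nat) (M : metricType R) (lsh : R -> R -> hash_family R M),
    (0 < d)%N ->
    (forall c' s : R, 1 < c' -> 0 < s ->
       is_LSH (lsh c' s) c' s (p1 c' s) (p2 c' s) /\ monotone_LSH (lsh c' s)) ->
  exists pre query : cmd R,
  forall (n : nat) (S : 'I_n -> M), (2 <= n)%N -> injective S ->
    let W := (n ^ w)%N in
    let log_n := ln (n%:R : R) in
    let delta : R := (n%:R ^+ a)^-1 in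
    let max_space : R :=
      C * n%:R `^ (1 + rho (c `^ kbar%:R^-1)) * log_n ^+ e in
    let max_time : R :=
      C * d%:R * n%:R `^ (level_exponent rho c kbar) * log_n ^+ e in
    preprocess d lsh S W pre
      (fun s => ((used_space s)%:R <= max_space)%R%:R%:E) = 1%E /\
    forall qs : seq M,
      preprocess d lsh S W pre (fun s =>
        session d lsh S W query (st_mem s) qs (fun answers =>
          (all (fun x => x.2%:R <= max_time) answers)%:R%:E)) = 1%E /\
      ((1 - (size qs)%:R * delta)%:E <=
       preprocess d lsh S W pre (fun s =>
         (\1_(fair_session d lsh S W query c r delta qs) (st_mem s))%:E))%E.
Proof.
rename kbar into k; set beta := level_exponent rho c k.
pose cc := c `^ k%:R^-1.
have c_gt0 : 0 < c by exact: lt_trans hc.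
have cck : cc ^+ k = c by apply: root_pow => //; exact: ltW.
have cc1 : 1 < cc.
  rewrite ltNge; apply/negP => h; move: hc; rewrite -cck ltNge exprn_ile1//.
  exact: powR_ge0.
(* The radii of index below [k] stay within c r; the next one, c r itself, occurs only as the outer
   ball of the last level. *)
pose rad i := r * cc ^+ i.
have rad_gt0 i : 0 < rad i by rewrite mulr_gt0// exprn_gt0// (lt_trans _ cc1).
have rad_le i : (i < k)%N -> r <= rad i <= c * r.
  move=> ik; apply/andP; split.
    by rewrite /rad ler_peMr; [|exact: ltW|apply: exprn_ege1; exact: ltW].
  rewrite /rad mulrC ler_pM2r// -cck.
  by apply: (ler_weXn2l (ltW cc1)); exact: ltnW.
pose q1 i := p1 cc (rad i); pose q2 i := p2 cc (rad i); pose rh := rho cc.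
have q1_01 i : 0 < q1 i < 1 by have [] := hp cc (rad i) cc1 (rad_gt0 i).
have q2_01 i : 0 < q2 i < 1 by have [] := hp cc (rad i) cc1 (rad_gt0 i).
have rhoE i : rh = ln (1 / q1 i) / ln (1 / q2 i) by have [] := hp cc (rad i) cc1 (rad_gt0 i).
have /andP[rh0 rh1] : 0 < rh < 1 by have [] := hp cc (rad 0%N) cc1 (rad_gt0 0%N).
have q2_gt0 i : 0 < q2 i by have /andP[] := q2_01 i.
have [c1 hc1] := choice (fun i => copies_exist (a + 1 + k + k) (q2_gt0 i)).
pose c0 i := (2 * c1 i)%N.
have c0_gt0 i : (0 < c0 i)%N by rewrite muln_gt0; case: (hc1 i).
pose kp i : R := 2 + (- ln (q2 i))^-1.
have kp0 i : 0 <= kp i.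
  by rewrite addr_ge0// invr_ge0 oppr_ge0 ltW// ln_lt0.
pose ta i : R := (c0 i)%:R * kp i * (q1 i)^-1 + 2.
have ta0 i : 0 <= ta i.
  by have /andP[h _] := q1_01 i; rewrite addr_ge0// !mulr_ge0// invr_ge0 ltW.
(* One constant dominates those of all [k] levels, which makes the bounds below uniform in the
   level. *)
have [al [al2 al_ge]] : exists al : R, 2 <= al /\
    forall i, (i < k)%N -> [/\ kp i <= al, (c0 i)%:R * kp i <= al & ta i <= al].
  have T0 i : 0 <= kp i + (c0 i)%:R * kp i + ta i.
    exact: (addr_ge0 (addr_ge0 (kp0 i) (mulr_ge0 (ler0n _ _) (kp0 i))) (ta0 i)).
  exists (2 + \sum_(i < k) (kp i + (c0 i)%:R * kp i + ta i)); split.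
    by rewrite lerDl; apply: sumr_ge0 => j _.
  move=> i ik; rewrite (bigD1 (Ordinal ik))//=; set X := \sum_(_ | _) _.
  have X0 : 0 <= X by apply: sumr_ge0 => j _.
  have k0 := kp0 i; have t0 := ta0 i; have ck0 : 0 <= (c0 i)%:R * kp i by rewrite mulr_ge0.
  by move: X0 k0 t0 ck0; move: X (ta i) (kp i) (_ * _) => X x1 x2 x3 *; split; lra.
have al0 : 0 <= al by lra.
pose z := nkinds k; pose sc := (\sum_(j < k) c0 j)%N.
(* [Cw] exceeds the constant required by [words_fit], and n^Cw >= 2^Cw > Cw since n >= 2: a larger
   power of n pays for the constant. *)
pose Cw := (Num.truncn ((42 + 6 * k * z + sc)%:R * (2 * al) ^+ 3)).+1.
(* The factor 14 is that of [lg_table_bound] and the fifth power that of [query_time_bound]. *)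
have [Ct [CtE Ct0]] : exists Ct : R,
    Ct = (k%:R * (63 * 1000 + 40 * k%:R) + 10) * (14 * al) ^+ 5 /\ 0 <= Ct.
  eexists; split; [reflexivity|apply: mulr_ge0; last exact: (exprn_ge0 _ (mulr_ge0 (ler0n _ _) al0))].
  by apply: addr_ge0 (ler0n _ _); apply: mulr_ge0 (ler0n _ _) _; apply: addr_ge0; exact: (mulr_ge0 (ler0n _ _) (ler0n _ _)).
have [Cs [CsE Cs0]] : exists Cs : R, Cs = 64 * (k * z)%:R * al ^+ 3 /\ 0 <= Cs.
  eexists; split; [reflexivity|apply: mulr_ge0 (mulr_ge0 (ler0n _ _) (ler0n _ _)) (exprn_ge0 _ al0)].
exists (Ct + Cs), 5%N, (4 + Cw)%N => d M lsh d_gt0 hlsh.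
(* The thresholds depend on the hash families, hence are chosen after the constants; they enter the
   two programs as real literals. *)
have [P1 hP1] := choice (fun i => collision_threshold (rad_gt0 i) (q1_01 i)
  (proj1 (hlsh cc (rad i) cc1 (rad_gt0 i))) (proj2 (hlsh cc (rad i) cc1 (rad_gt0 i)))).
exists (pre_prog k cc P1 q2 rad c0), (query_prog k P1 q2 rad c0) => n S n2 Sinj W lambda delta max_space max_time.
have n_gt0 : (0 < n)%N by exact: ltnW.
have n1 : 1 <= n%:R :> R by rewrite ler1n.
have n2R : 2 <= n%:R :> R by rewrite ler_nat.
have l_ge : 2^-1 <= lambda by exact: ln_nat_ge.
have l0 : 0 <= lambda by apply: le_trans l_ge; rewrite invr_ge0.
have l_le : lambda <= n%:R.
  have h := expR_ge1Dx (ln n%:R : R); rewrite lnK ?posrE ?ltr0n// in h.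
  by apply: le_trans h; rewrite lerDr ler01.
have [f hf] := choice (fun i => level_parameters (q1_01 i) (q2_01 i) (rhoE i) rh0
  (let: And3 h _ _ := hP1 i in h) n2 (c0_gt0 i)).
have [Lf {}hf] := choice hf.
rename f into Kf.
have [N [N0 hN hN' bN]] := @least_root R n k n2 hk0.
pose Y : R := n%:R `^ beta; pose Z : R := n%:R `^ rh.
have Z1 : 1 <= Z by rewrite -[leLHS](powRr0 n%:R); apply: ler_powR => //; exact: ltW.
have ZY : Z <= Y by apply: ler_powR => //; rewrite /beta /level_exponent le_max lexx.
have NY : n%:R `^ k%:R^-1 <= Y by apply: ler_powR => //; rewrite /beta /level_exponent le_max lexx orbT.
have Y1 : 1 <= Y by exact: le_trans ZY.
have Zn : Z <= n%:R.
  by rewrite -[leRHS]powRr1//; apply: ler_powR => //; exact: ltW.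
have Nn : n%:R `^ k%:R^-1 <= n%:R :> R.
  by rewrite -[leRHS]powRr1//; apply: ler_powR => //; rewrite invf_le1 ?ltr0n// ler1n.
have all_ge1 : 1 <= al * lambda by clear -al2 l_ge; nra.
have bK i : (i < k)%N -> (Kf i)%:R <= al * lambda.
  move=> ik; have [_ _ _ h _] := hf i; have [h' _ _] := al_ge i ik.
  by apply: le_trans h _; apply: ler_wpM2r; [exact: l0|exact: h'].
have bA i : (i < k)%N -> (copies c0 Kf i)%:R <= al * lambda.
  move=> ik; have [_ _ _ h _] := hf i; have [_ h' _] := al_ge i ik.
  rewrite /copies natrM; apply: (@le_trans _ _ ((c0 i)%:R * (kp i * lambda))); first exact: ler_wpM2l.
  by rewrite mulrA; apply: ler_wpM2r; [exact: l0|exact: h'].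
have bL i : (i < k)%N -> (Lf i)%:R <= al * lambda * Z.
  move=> ik; have [_ _ _ _ h] := hf i; have [_ _ h'] := al_ge i ik.
  apply: le_trans h _; apply: ler_wpM2r; first exact: powR_ge0.
  by apply: ler_wpM2r; [exact: l0|exact: h'].
have is_par i : (i < k)%N -> is_params n k (P1 i) (q2 i) (Kf i) (Lf i) (copies c0 Kf i) N.
  by move=> ik; have [_ h1 h2 _ _] := hf i.
have pos i : (i < k)%N -> level_positive c0 Kf Lf (fun=> N) i.
  by move=> ik; have [[h1 h2] _ _ _ _] := hf i.
have aln : al * lambda <= al * n%:R by apply: ler_wpM2l; [exact: al0|exact: l_le].
have alnn : n%:R <= al * n%:R by rewrite ler_peMl//; clear -al2; lra.
have [UW fits] : (total_space n k c0 Kf Lf < W)%N /\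
    forall i, (i < k)%N -> level_fits n W k c0 Kf Lf (fun=> N) i.
  apply: (@words_fit R n W k c0 Kf Lf N (2 * al * n%:R)) => //.
  - by rewrite -mulrA; clear -n1 alnn; lra.
  - by rewrite -mulrA; clear -n1 alnn; lra.
  - by move=> i ik; apply: le_trans (bK i ik) _; rewrite -mulrA; clear -n1 aln alnn; lra.
  - by move=> i ik; apply: le_trans (bA i ik) _; rewrite -mulrA; clear -n1 aln alnn; lra.
  - move=> i ik; apply: le_trans (bL i ik) _; apply: ler_pM (le_trans ler01 all_ge1) (le_trans ler01 Z1) _ Zn.
    by rewrite -mulrA; clear -n1 aln alnn; lra.
  - rewrite -mulrA; have : 2 * n%:R <= al * n%:R by apply: ler_wpM2r.
    by move=> h; clear -h bN Nn n1; lra.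
  - by move=> i ik; rewrite (bigD1 (Ordinal ik))//= leq_addr.
  have -> : (2 * al * n%:R) ^+ 3 * n%:R = (2 * al) ^+ 3 * n%:R ^+ 4 by ring.
  rewrite mulrA /W expnD natrM mulrC natrX ltr_pM2l ?exprn_gt0 ?ltr0n//.
  apply: (@lt_le_trans _ _ Cw%:R); first exact: truncnS_gt.
  rewrite natrX -natrX ler_nat; apply: leq_trans (ltnW (ltn_expl _ (ltnSn 1))) _.
  by rewrite leq_exp2r.
have lsp i : (i < k)%N -> ((copies c0 Kf i * Lf i * (Kf i + n) + 1) * nkinds k <= total_space n k c0 Kf Lf)%N.
  exact: level_space_total.
have rad0 : rad 0%N = r by rewrite /rad expr0 mulr1.
have radS i : rad i.+1 = cc * rad i by rewrite /rad exprS mulrCA.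
have Cpow : 0 <= lambda ^+ 5 by exact: exprn_ge0.
split; last move=> qs; last split.
- apply: (pre_space d lsh S cc rad n_gt0 is_par fits pos UW lsp).
  have b1 : 1 <= al * lambda * Z by rewrite mulr_ege1.
  have b2 : 1 <= 2 * al * n%:R by rewrite -mulrA; clear -n1 alnn; lra.
  have bKn i : (i < k)%N -> (Kf i + n)%:R <= 2 * al * n%:R.
    by move=> ik; rewrite natrD -mulrA; have h := bK i ik; clear -h aln alnn; lra.
  have := total_space_bound all_ge1 b1 b2 bA bL bKn.
  rewrite -/z natrD /max_space powRD; last by apply/implyP => _; rewrite pnatr_eq0 -lt0n.
  rewrite powRr1// -/rh -/Z.
  move=> hu; apply: (space_arith al0 l_ge _ _ _ Ct0 CsE) => //; first exact: powR_ge0.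
  by apply: le_trans hu _; rewrite -mulnA natrM.
- apply: (pre_time lsh S cc rad n_gt0 is_par fits pos UW lsp).
  have u1 : 1 <= 14 * al * lambda by rewrite -mulrA; clear -all_ge1; lra.
  have ule : al * lambda <= 14 * al * lambda by rewrite -mulrA; clear -all_ge1; lra.
  have uY : 14 * Y <= 14 * al * lambda * Y.
    by rewrite -mulrA -mulrA ler_pM2l// mulrA; apply: ler_peMl (le_trans ler01 Y1) all_ge1.
  have lgb i : (i < k)%N -> (lg (Lf i))%:R <= 14 * al * lambda.
    move=> ik; have [_ _ L0 _] := pos i ik.
    apply: (lg_table_bound (rh := rh) L0 al2 l_ge); first by rewrite rh0.
    by have := bL i ik; rewrite /Z /powR gt_eqF ?ltr0n.
  have lgn : (lg n)%:R <= 14 * al * lambda.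
    have h1 := @lg_le_ln R n n_gt0; rewrite -/lambda in h1.
    have h5 : 2 * lambda <= al * lambda by apply: ler_wpM2r; [exact: l0|exact: al2].
    by rewrite -mulrA; clear -h1 h5 all_ge1; lra.
  have bK' i (ik : (i < k)%N) := le_trans (bK i ik) ule.
  have bA' i (ik : (i < k)%N) := le_trans (bA i ik) ule.
  have bL' i : (i < k)%N -> (Lf i)%:R <= 14 * al * lambda * Y.
    by move=> ik; apply: le_trans (bL i ik) _; apply: ler_pM (le_trans ler01 all_ge1) (le_trans ler01 Z1) ule ZY.
  have bN' : N%:R <= 14 * al * lambda * Y by clear -bN NY Y1 uY; lra.
  apply: le_trans (query_time_bound u1 Y1 d_gt0 bK' bA' bL' bN' lgn lgb) _.
  have E (B X l5 D y : R) : B * (X * l5 * D * y) = B * X * D * y * l5 by ring.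
  rewrite [(14 * al * lambda) ^+ 5]exprMn E -CtE.
  rewrite /max_time -/Y; apply: ler_wpM2r => //; apply: ler_wpM2r; first exact: powR_ge0.
  by apply: ler_wpM2r => //; rewrite lerDl.
- have lb i : (i < k)%N -> expR (- (copies c0 Kf i)%:R) <= delta /\ level_loss n c0 Kf i <= delta / k%:R.
    move=> ik; have [[h1 _] [h2 _] _ _ _] := hf i; have [h3 h4] := hc1 i.
    exact: (loss_bound (a := a) (q2_01 i) n2 hk0 h3 h1 h2 h4).
  apply: (pre_fair d S n_gt0 hk0 is_par fits pos UW lsp rad0 radS rad_le) => //.
  + by move=> i _; have [/andP[h1 h2] _ _] := hP1 i; have /andP[h3 _] := q1_01 i; rewrite h2 (lt_le_trans h3).
  + by move=> i _; have /andP[h1 h2] := q2_01 i; rewrite !ltW.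
  + by move=> i x _; have [[h _ _] _] := hlsh cc (rad i) cc1 (rad_gt0 i).
  + by move=> i x y _; have [_ h _] := hP1 i; exact: h.
  + by move=> i x y _; have [_ _ h] := hP1 i; exact: h.
  + by move=> i x y _; have [[_ _ h] _] := hlsh cc (rad i) cc1 (rad_gt0 i); exact: h.
  + by move=> i /lb[].
  apply: (@le_trans _ _ (\sum_(i < k) (delta / k%:R))).
    by apply: ler_sum => i _; have [] := lb i (ltn_ord i).
  by rewrite sumr_const card_ord -[leLHS]mulr_natl mulrCA mulfV ?mulr1// pnatr_eq0 -lt0n.
Qed.
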